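(* Assume that $2<p<\infty$ and that $g$ is an analytic function on $\mathbb{D}$ given by a lacunary series. Let $\tilde p$ be defined by $\frac1{\tilde p}=\frac12-\frac1p$. Then $\mathcal{H}_g$ is bounded on $H^p$ (i.e. from $H^p$ to $H^p$) if and only if $g'\in A^{2,\tilde p}_{\tilde p/2}$. Moreover, $$\|\mathcal{H}_g\|_{H^p\to H^p}\asymp\|g'\|_{A^{2,\tilde p}_{\tilde p/2}}.$$
   Context: $\mathbb{D}$ is the open unit disc in $\mathbb{C}$. For $f$ analytic on $\mathbb{D}$, $0<p<\infty$ and $0<r<1$, put $M_p(r,f)=\left(\frac1{2\pi}\int_0^{2\pi}|f(re^{i\theta})|^p\,d\theta\right)^{1/p}$. The Hardy space $H^p$ consists of the analytic $f$ on $\mathbb{D}$ with $\|f\|_{H^p}=\sup_{0<r<1}M_p(r,f)<\infty$. For $g$ analytic on $\mathbb{D}$, the generalized Hilbert operator is $$\mathcal{H}_g(f)(z)=\int_0^1 f(t)g'(tz)\,dt,\qquad z\in\mathbb{D},\ f\in H^1;$$ the integral converges absolutely for $f\in H^1$ (by the Fejér–Riesz inequality) and defines an analytic function on $\mathbb{D}$. $\mathcal{H}_g:H^p\to H^q$ is bounded if there is a constant $C$ with $\|\mathcal{H}_g(f)\|_{H^q}\le C\|f\|_{H^p}$ for all $f\in H^p$; $\|\mathcal{H}_g\|_{H^p\to H^q}$ is the smallest such $C$ (and $\infty$ if there is none). Likewise a function norm is understood to be $\infty$ when the function does not belong to the space. A lacunary series is a power series $g(z)=\sum_{j=0}^\infty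 a_jz^{n_j}$, where $(n_j)$ is a strictly increasing sequence of non-negative integers for which there is $\lambda>1$ with $n_{j+1}\ge\lambda n_j$ for every $j$ ($g$ is then lacunary of step $\lambda$). Mixed-norm spaces: for $0<p\le\infty$, $0<q<\infty$, $\alpha>-1$, $A^{p,q}_\alpha$ consists of the analytic $f$ on $\mathbb{D}$ with $$\|f\|_{A^{p,q}_\alpha}^q=\int_0^1 M_p^q(r,f)\,(\alpha+1)(1-r^2)^\alpha\,dr<\infty.$$ $a\asymp b$ means $C^{-1}b\le a\le Cb$ for a constant $C>0$; here $C$ depends only on $p$ and on the step $\lambda$ of the lacunary series. *)

(* Defs.v *)
From HB Require Import structures.
From mathcomp Require Import all_boot all_order all_algebra.
From mathcomp Require Import all_classical all_reals all_analysis.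
From mathcomp Require Export complex.

Set Implicit Arguments.
Unset Strict Implicit.
Unset Printing Implicit Defensive.

Import Order.TTheory GRing.Theory Num.Theory.
Import numFieldNormedType.Exports.

Local Open Scope classical_set_scope.
Local Open Scope ring_scope.

(* The library puts the norm topology on abstract numeric fields only; this
   gives R[i] the same structure, as a normed space over itself. *)
HB.instance Definition _ (R : realType) := GRing.ComAlgebra.copy R[i] R[i]^o.
HB.instance Definition _ (R : realType) := Vector.copy R[i] R[i]^o.
HB.instance Definition _ (R : realType) := NormedModule.copy R[i] R[i]^o.

Section Defs.
Context {R : realType}.

Local Notation C := R[i].
Local Notation mu := (@lebesgue_measure R).

(* The norm `|z| of R[i] takes its values in R[i]; this is the same quantity
   as an element of R. *)
Definition modulus (z : C) : R := complex.Re `|z|.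

(* Functions on the unit disc are total functions on R[i]; none of the notions
   below depends on their values outside the disc. *)
Definition analytic_disc (f : C -> C) : Prop :=
  forall z0 : C, modulus z0 < 1 ->
    exists (a : nat -> C) (e : R), 0 < e /\
      forall z : C, modulus (z - z0) < e ->
        series (fun k => a k * (z - z0) ^+ k) @ \oo --> f z.

Definition circle_point (r theta : R) : C :=
  Complex (r * cos theta) (r * sin theta).

Definition integral_mean (p r : R) (f : C -> C) : \bar R :=
  (((2 * pi)^-1%:E *
     \int[mu]_(theta in `[0%R, (2 * pi)%R])
       (modulus (f (circle_point r theta)) `^ p)%:E) `^ (p^-1))%E.

Definition hardy_norm (p : R) (f : C -> C) : \bar R :=
  ereal_sup [set integral_mean p r f | r in `]0, 1[].

Definition hardy (p : R) (f : C -> C) : Prop :=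
  analytic_disc f /\ (hardy_norm p f < +oo)%E.

(* The mixed norm with a finite inner exponent p. *)
Definition mixed_norm (p q alpha : R) (f : C -> C) : \bar R :=
  ((\int[mu]_(r in `[0%R, 1%R[)
      (integral_mean p r f `^ q *
        ((alpha + 1) * (1 - r ^+ 2) `^ alpha)%R%:E)) `^ (q^-1))%E.

Definition mixed_space (p q alpha : R) (f : C -> C) : Prop :=
  analytic_disc f /\ (mixed_norm p q alpha f < +oo)%E.

(* Integral over [0, 1) of a complex-valued function of a real variable;
   meaningful when the real and imaginary parts are integrable. *)
Definition cintegral01 (h : R -> C) : C :=
  Complex (\int[mu]_(t in `[0%R, 1%R[) complex.Re (h t))
          (\int[mu]_(t in `[0%R, 1%R[) complex.Im (h t)).

(* derive1 g is the complex derivative: the base field is R[i]. *)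
Definition hilbert_op (g f : C -> C) (z : C) : C :=
  cintegral01 (fun t => f t%:C%C * derive1 g (t%:C%C * z)).

Definition op_bound (T : (C -> C) -> C -> C) (p q c : R) : Prop :=
  0 <= c /\ forall f, hardy p f ->
    hardy q (T f) /\ (hardy_norm q (T f) <= c%:E * hardy_norm p f)%E.

Definition op_bounded (T : (C -> C) -> C -> C) (p q : R) : Prop :=
  exists c, op_bound T p q c.

(* The set of bounds is closed, so the infimum is the smallest bound; it is
   +oo when there is no bound. *)
Definition op_norm (T : (C -> C) -> C -> C) (p q : R) : \bar R :=
  ereal_inf [set c%:E | c in [set c | op_bound T p q c]].

Definition lacunary (lambda : R) (g : C -> C) : Prop :=
  exists (a : nat -> C) (n : nat -> nat),
    [/\ (forall j, (n j < n j.+1)%N),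
        (forall j, lambda * (n j)%:R <= (n j.+1)%:R) &
        forall z : C, modulus z < 1 ->
          series (fun j => a j * z ^+ n j) @ \oo --> g z].

End Defs.

(* Main.v *)
(** Write g'(z) = sum_j a_j n_j z^(n_j - 1) with n lacunary, 1/q = 1/2 - 1/p,
    and S = sum_j (n_j^(1/p) |a_j|)^q. Both sides of the equivalence are
    comparable to S^(1/q).

    - The mixed norm: M_2(r, g')^2 is a sum of squares. Superadditivity of
      x^(q/2), on the r with 1 - r close to 1/n_j, bounds S from above;
      Jensen's inequality with the weights n_j r^(n_j - 1), whose sum is
      O(1/(1 - r)), bounds S from below.
    - H_g f = sum_j a_j n_j beta_j z^(n_j - 1), where beta_j is the moment
      int_0^1 f(t) t^(n_j - 1) dt. Cauchy's formula on the circle gives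
      sum_j (n_j^(1-1/p) |beta_j|)^p <= C |f|_p^p. The L^p and L^2 norms of a
      lacunary series are comparable (Riesz products), so Hoelder's inequality
      yields |H_g f|_p <= C S^(1/q) |f|_p.
    - Conversely f = sum_j b_j n_j^(1/p - 1) / (1 + 1/n_j - z) satisfies
      |f|_p^p <= C sum_j b_j^p and n_j^(1-1/p) beta_j >= b_j / 2. Bessel's
      inequality with b_j = (n_j^(1/p) |a_j|)^(q/p) then bounds S by the norm of
      H_g. *)

(* For a single j, Hoelder's inequality applied to Cauchy's kernel bounds n_j^(1-1/p) |beta_j| by C
   |f|_p, but such bounds cannot be summed over j. The weight [omega] makes them summable: omega(n_j
   d), with d the angular distance to 1, is concentrated near d = 1/n_j, its integral against the
   measure dd/d is bounded independently of n_j, and its sum over lacunary n_j is bounded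
   independently of d. The first property gives Hoelder's inequality at each scale, the second adds
   the scales up. The L^p bound of the test function rests on the same two properties, used in the
   dual direction. The exponent 1/(2p) in [omega] is small enough for the powers of the kernel to
   stay integrable on both sides of the scale 1/n_j.

   Functions of H^p are given no boundary values. Cauchy's formula is used on circles of radius rho
   < 1, at points t <= 2 rho - 1, with constants independent of rho; rho tends to 1 at the end. *)
Require Import Defs.
From mathcomp Require Import all_boot all_order all_algebra.
From mathcomp Require Import all_classical all_reals all_analysis.
From mathcomp Require Import measurable_realfun ring lra.
Import Order.TTheory GRing.Theory Num.Theory.
Import numFieldNormedType.Exports.
Local Open Scope classical_set_scope.
Local Open Scope ring_scope.

Set Implicit Arguments.
Unset Strict Implicit.
Unset Printing Implicit Defensive.

(** * Moduli, convergence and derivatives in R[i] *)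

Section ComplexBasics.
Context {R : realType}.
Local Notation C := R[i].
Implicit Types (z w h d : C) (f g : C -> C).

Lemma modulusE z : modulus z = Num.sqrt (complex.Re z ^+ 2 + complex.Im z ^+ 2).
Proof. by case: z. Qed.

Lemma norm_modulus z : `|z| = (modulus z)%:C%C.
Proof. by []. Qed.

Lemma modulus_ge0 z : 0 <= modulus z.
Proof. by rewrite modulusE sqrtr_ge0. Qed.
Hint Resolve modulus_ge0 : core.

Lemma modulus0 : modulus (0 : C) = 0.
Proof. by rewrite /modulus normr0. Qed.

Lemma modulus1 : modulus (1 : C) = 1.
Proof. by rewrite /modulus normr1. Qed.

Lemma modulus_eq0 z : (modulus z == 0) = (z == 0).
Proof.
rewrite -[z == 0]normr_eq0 norm_modulus.
by apply/eqP/eqP => [->//|/(congr1 (@complex.Re _))].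
Qed.

Lemma modulus_gt0 z : (0 < modulus z) = (z != 0).
Proof. by rewrite lt_def modulus_ge0 andbT modulus_eq0. Qed.

Lemma modulusM z w : modulus (z * w) = modulus z * modulus w.
Proof. exact: ComplexField.Normc.normcM. Qed.

Lemma modulusV z : modulus z^-1 = (modulus z)^-1.
Proof. exact: ComplexField.Normc.normcV. Qed.

Lemma modulusX z n : modulus (z ^+ n) = modulus z ^+ n.
Proof. by elim: n => [|n ih]; rewrite ?modulus1// !exprS modulusM ih. Qed.

Lemma modulusN z : modulus (- z) = modulus z.
Proof. by rewrite /modulus normrN. Qed.

Lemma modulusBC z w : modulus (z - w) = modulus (w - z).
Proof. by rewrite -opprB modulusN. Qed.

Lemma modulusD z w : modulus (z + w) <= modulus z + modulus w.
Proof.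
have := ler_normD z w; rewrite !norm_modulus -rmorphD/=.
by rewrite lecR.
Qed.

Lemma modulusB z w : modulus (z - w) <= modulus z + modulus w.
Proof. by rewrite -(modulusN w); exact: modulusD. Qed.

Lemma modulus_sum (I : Type) (r : seq I) (P : pred I) (F : I -> C) :
  modulus (\sum_(i <- r | P i) F i) <= \sum_(i <- r | P i) modulus (F i).
Proof.
elim/big_ind2 : _ => //; first by rewrite modulus0.
by move=> x1 x2 y1 y2 h1 h2; rewrite (le_trans (modulusD _ _))// lerD.
Qed.

Lemma modulus_real (x : R) : modulus x%:C%C = `|x|.
Proof. by rewrite modulusE /= expr0n addr0 sqrtr_sqr. Qed.

Lemma normr_Re_le z : `|complex.Re z| <= modulus z.
Proof. by rewrite modulusE -sqrtr_sqr ler_wsqrtr// lerDl sqr_ge0. Qed.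

Lemma normr_Im_le z : `|complex.Im z| <= modulus z.
Proof. by rewrite modulusE -sqrtr_sqr ler_wsqrtr// lerDr sqr_ge0. Qed.

Lemma modulus_le_ReIm z : modulus z <= `|complex.Re z| + `|complex.Im z|.
Proof.
rewrite {1}(complexE z) (le_trans (modulusD _ _))// modulus_real lerD2l.
rewrite modulusM modulus_real modulusE/= expr0n expr1n add0r sqrtr1 mul1r//.
Qed.

Lemma modulus_sqr z : modulus z ^+ 2 = complex.Re z ^+ 2 + complex.Im z ^+ 2.
Proof. by rewrite modulusE sqr_sqrtr// addr_ge0 ?sqr_ge0. Qed.

Lemma circle_pointE (r theta : R) :
  circle_point r theta = r%:C%C * circle_point 1 theta.
Proof. by rewrite /circle_point; simpc. Qed.

Lemma modulus_circle_point (r theta : R) : modulus (circle_point r theta) = `|r|.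
Proof.
by rewrite modulusE /= !exprMn -mulrDr cos2Dsin2 mulr1 sqrtr_sqr.
Qed.

Lemma circle_pointX (r theta : R) n :
  circle_point r theta ^+ n = circle_point (r ^+ n) (n%:R * theta).
Proof.
elim: n => [|n ih].
  by rewrite !expr0 mul0r /circle_point cos0 sin0 mulr1 mulr0.
rewrite exprS ih /circle_point; simpc; rewrite -natr1 mulrDl mul1r cosD sinD.
by rewrite exprS; congr Complex; ring.
Qed.

Lemma ReD z w : complex.Re (z + w) = complex.Re z + complex.Re w.
Proof. by case: z; case: w. Qed.

Lemma ImD z w : complex.Im (z + w) = complex.Im z + complex.Im w.
Proof. by case: z; case: w. Qed.

Lemma ReN z : complex.Re (- z) = - complex.Re z.
Proof. by case: z. Qed.

Lemma ImN z : complex.Im (- z) = - complex.Im z.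
Proof. by case: z. Qed.

Lemma ReB z w : complex.Re (z - w) = complex.Re z - complex.Re w.
Proof. by rewrite ReD ReN. Qed.

Lemma ImB z w : complex.Im (z - w) = complex.Im z - complex.Im w.
Proof. by rewrite ImD ImN. Qed.

Lemma Re_sum (I : Type) (r : seq I) (P : pred I) (F : I -> C) :
  complex.Re (\sum_(i <- r | P i) F i) = \sum_(i <- r | P i) complex.Re (F i).
Proof. by elim/big_ind2 : _ => // x1 x2 y1 y2 <- <-; rewrite ReD. Qed.

Lemma Im_sum (I : Type) (r : seq I) (P : pred I) (F : I -> C) :
  complex.Im (\sum_(i <- r | P i) F i) = \sum_(i <- r | P i) complex.Im (F i).
Proof. by elim/big_ind2 : _ => // x1 x2 y1 y2 <- <-; rewrite ImD. Qed.

Lemma cvgC_modulus (u : nat -> C) (l : C) : u @ \oo --> l <->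
  forall e : R, 0 < e -> exists N, forall n, (N <= n)%N -> modulus (u n - l) < e.
Proof.
split=> [/cvgrPdist_lt ul e e0|ul].
  have /ul[N _ Nul] : 0 < e%:C%C by rewrite ltcR.
  exists N => n Nn; have := Nul n Nn => /=.
  by rewrite norm_modulus ltcR modulusBC.
apply/cvgrPdist_lt => e e0.
(* An element of [R[i]] above 0 in its partial order has imaginary part 0, so the radius e is a real
   number. *)
have eE : e = (complex.Re e)%:C%C.
  by case: (e) e0 => a b; rewrite ltcE/= => /andP[/eqP ->].
move: e0; rewrite eE ltcR => /ul[N Nul].
by exists N => // n /= Nn; rewrite norm_modulus ltcR modulusBC; exact: Nul.
Qed.

Lemma cvgR_dist (u : nat -> R) (l : R) : u @ \oo --> l <->
  forall e : R, 0 < e -> exists N, forall n, (N <= n)%N -> `|u n - l| < e.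
Proof.
split=> [/cvgrPdist_lt ul e e0|ul].
  have [N _ Nul] := ul _ e0; exists N => n Nn; rewrite distrC; exact: Nul.
apply/cvgrPdist_lt => e /ul[N Nul].
by exists N => // n /= Nn; rewrite distrC; exact: Nul.
Qed.

Lemma cvgC_Re (u : nat -> C) (l : C) : u @ \oo --> l ->
  (fun n => complex.Re (u n)) @ \oo --> complex.Re l.
Proof.
move=> /cvgC_modulus ul; apply/cvgR_dist => e /ul[N Nul]; exists N => n /Nul.
by apply: le_lt_trans; rewrite -ReB normr_Re_le.
Qed.

Lemma cvgC_Im (u : nat -> C) (l : C) : u @ \oo --> l ->
  (fun n => complex.Im (u n)) @ \oo --> complex.Im l.
Proof.
move=> /cvgC_modulus ul; apply/cvgR_dist => e /ul[N Nul]; exists N => n /Nul.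
by apply: le_lt_trans; rewrite -ImB normr_Im_le.
Qed.

Lemma cvgC_ReIm (u : nat -> C) (l : C) :
  (fun n => complex.Re (u n)) @ \oo --> complex.Re l ->
  (fun n => complex.Im (u n)) @ \oo --> complex.Im l -> u @ \oo --> l.
Proof.
move=> /cvgR_dist ul /cvgR_dist vl; apply/cvgC_modulus => e e0.
have e20 : 0 < e / 2 by rewrite divr_gt0.
have [N1 h1] := ul _ e20; have [N2 h2] := vl _ e20.
exists (maxn N1 N2) => n; rewrite geq_max => /andP[/h1{}h1 /h2{}h2].
apply: le_lt_trans (modulus_le_ReIm _) _.
by rewrite ReB ImB [ltRHS]splitr ltrD.
Qed.

Lemma cvgC_modulus_to (u : nat -> C) (l : C) : u @ \oo --> l ->
  (fun n => modulus (u n)) @ \oo --> modulus l.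
Proof.
move=> /cvgC_modulus ul; apply/cvgR_dist => e /ul[N Nul]; exists N => n /Nul.
apply: le_lt_trans; rewrite ler_norml; apply/andP; split.
  by rewrite lerNl opprB lerBlDr modulusBC (le_trans _ (modulusD _ _))// subrK.
by rewrite lerBlDr (le_trans _ (modulusD _ _))// subrK.
Qed.

Lemma cvgC_unique (u : nat -> C) (l m : C) :
  u @ \oo --> l -> u @ \oo --> m -> l = m.
Proof.
move=> /cvgC_modulus ul /cvgC_modulus um; apply/eqP; rewrite -subr_eq0 -modulus_eq0.
rewrite eq_le modulus_ge0 andbT leNgt; apply/negP => lm.
have e20 : 0 < modulus (l - m) / 2 by rewrite divr_gt0.
have [N1 h1] := ul _ e20; have [N2 h2] := um _ e20.
have := h1 _ (leq_maxl N1 N2); have := h2 _ (leq_maxr N1 N2).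
set x := u _ => xm xl.
suff : modulus (l - m) < modulus (l - m) by rewrite ltxx.
rewrite {2}[modulus _]splitr; apply: le_lt_trans (ltrD xl xm).
by rewrite (modulusBC x l) (le_trans _ (modulusD _ _))// addrA subrK.
Qed.

Lemma cvgC_add (u v : nat -> C) (l m : C) : u @ \oo --> l -> v @ \oo --> m ->
  (fun n => u n + v n) @ \oo --> l + m.
Proof.
move=> /cvgC_modulus ul /cvgC_modulus vm; apply/cvgC_modulus => e e0.
have e20 : 0 < e / 2 by rewrite divr_gt0.
have [N1 h1] := ul _ e20; have [N2 h2] := vm _ e20.
exists (maxn N1 N2) => n; rewrite geq_max => /andP[/h1{}h1 /h2{}h2].
rewrite opprD addrACA; apply: le_lt_trans (modulusD _ _) _.
by rewrite [ltRHS]splitr ltrD.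
Qed.

Lemma cvgC_mulr (u : nat -> C) (l m : C) : u @ \oo --> l ->
  (fun n => u n * m) @ \oo --> l * m.
Proof.
move=> /cvgC_modulus ul; apply/cvgC_modulus => e e0.
have m1 : 0 < 1 + modulus m by rewrite ltr_pwDl.
have /ul[N NP] : 0 < e / (1 + modulus m) by rewrite divr_gt0.
exists N => n /NP; rewrite -mulrBl modulusM ltr_pdivlMr//; apply: le_lt_trans.
by rewrite ler_wpM2l// lerDr.
Qed.

Lemma cvgC_sum (u : nat -> nat -> C) (l : nat -> C) M :
  (forall k, u k @ \oo --> l k) ->
  (fun n => \sum_(0 <= k < M) u k n) @ \oo --> \sum_(0 <= k < M) l k.
Proof.
move=> ul; elim: M => [|M ih].
  rewrite big_nil; apply/cvgC_modulus => e e0; exists 0%N => n _.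
  by rewrite big_nil subr0 modulus0.
have recr (v : nat -> C) : \sum_(0 <= k < M.+1) v k = \sum_(0 <= k < M) v k + v M.
  by rewrite big_nat_recr.
rewrite recr.
rewrite (_ : (fun n => _) = (fun n => \sum_(0 <= k < M) u k n + u M n)); last first.
  by apply/funext => n; rewrite recr.
exact: cvgC_add ih (ul M).
Qed.

(** A first-order expansion with a real error bound: h = 0 needs no exclusion, and the chain rule
    reduces to estimates between moduli. *)
Definition cderiv f z d := forall e : R, 0 < e -> exists dl : R, 0 < dl /\
  forall h, modulus h < dl -> modulus (f (z + h) - f z - h * d) <= e * modulus h.

Lemma cderiv_derive1 f z d : cderiv f z d -> derive1 f z = d.
Proof.
move=> fd; rewrite /derive1; apply/cvg_lim => //.
apply/cvgrPdist_le => e e0.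
have eE : e = (complex.Re e)%:C%C.
  by case: (e) e0 => a b; rewrite ltcE/= => /andP[/eqP ->].
move: e0; rewrite eE ltcR => e0.
have [dl [dl0 dlP]] := fd _ e0.
exists dl%:C%C => /=; first by rewrite ltcR.
move=> h /= + h0; rewrite sub0r normrN norm_modulus ltcR => hdl.
have {}dlP := dlP _ hdl.
rewrite norm_modulus lecR.
have -> : d - h^-1 *: (f (h + z) - f z) = - (h^-1 * (f (z + h) - f z - h * d)).
  have -> : h^-1 *: (f (h + z) - f z) = h^-1 * (f (z + h) - f z).
    by rewrite (addrC h z).
  by rewrite [in RHS]mulrBr [h^-1 * (h * d)]mulrA mulVf// mul1r opprB.
by rewrite modulusN modulusM modulusV ler_pdivrMl ?modulus_gt0// [leRHS]mulrC.
Qed.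

Definition ccontinuous_at f z := forall e : R, 0 < e -> exists dl : R, 0 < dl /\
  forall h, modulus h < dl -> modulus (f (z + h) - f z) < e.

Lemma cderiv_continuous f z d : cderiv f z d -> ccontinuous_at f z.
Proof.
move=> fd e e0; have [dl [dl0 dlP]] := fd _ ltr01.
pose K := 1 + modulus d; have K0 : 0 < K by rewrite ltr_pwDl.
exists (Num.min dl (e / K)); split; first by rewrite lt_min dl0 divr_gt0.
move=> h; rewrite lt_min => /andP[/dlP hd]; rewrite ltr_pdivlMr// => hK.
apply: le_lt_trans hK; rewrite -(subrK (h * d) (f (z + h) - f z)).
rewrite (le_trans (modulusD _ _))// modulusM mulrDr mulr1 lerD//.
by rewrite (le_trans hd)// mul1r.
Qed.

End ComplexBasics.
#[global] Hint Extern 0 (is_true (0 <= modulus _)) => exact: modulus_ge0 : core.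

(** * Power series with gaps *)

Section PowerSeries.
Context {R : realType}.
Local Notation C := R[i].
Implicit Types (a u : nat -> C) (n : nat -> nat) (f g : C -> C) (z h : C).

Definition absum u := exists B : R, forall J, \sum_(0 <= j < J) modulus (u j) <= B.

Lemma absum_cvg u : absum u -> exists l : C, series u @ \oo --> l.
Proof.
move=> [B uB].
have cvgn_dom (v : nat -> R) : (forall j, `|v j| <= modulus (u j)) -> cvgn (series v).
  move=> vu; apply: normed_cvg; apply: nondecreasing_is_cvgn.
    by apply: nondecreasing_series => i _ _; exact: normr_ge0.
  exists B => _ [J _ <-]; rewrite /= (le_trans _ (uB J))//.
  by rewrite /series/=; apply: ler_sum.
exists (Complex (limn (series (fun j => complex.Re (u j))))
                (limn (series (fun j => complex.Im (u j))))).
apply: cvgC_ReIm => /=.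
  under eq_fun do rewrite Re_sum.
  by apply: cvgn_dom => j; exact: normr_Re_le.
under eq_fun do rewrite Im_sum.
by apply: cvgn_dom => j; exact: normr_Im_le.
Qed.

Lemma absumW u (v : nat -> R) B : (forall j, modulus (u j) <= v j) ->
  (forall J, \sum_(0 <= j < J) v j <= B) -> absum u.
Proof. by move=> uv vB; exists B => J; rewrite (le_trans _ (vB J))// ler_sum. Qed.

Lemma modulus_series_le u l B : series u @ \oo --> l ->
  (forall J, modulus (\sum_(0 <= j < J) u j) <= B) -> modulus l <= B.
Proof.
move=> ul uB; have cu := cvgC_modulus_to ul.
rewrite -(cvg_lim _ cu)//; apply: limr_le; first by apply/cvg_ex; exists (modulus l).
by apply: nearW => J; exact: uB.
Qed.

(** Abel's form of a radius of convergence at least rho: bounded terms at every smaller radius. It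
    survives termwise differentiation with the same rho, and it tolerates repeated exponents, which
    appear as soon as 0 and 1 both have predecessor 0. *)
Definition psradius a n (rho : R) := forall r, 0 < r < rho ->
  exists M, forall j, modulus (a j) * r ^+ n j <= M.

Lemma cvg_psradius a n rho g :
  (forall z, modulus z < rho -> series (fun j => a j * z ^+ n j) @ \oo --> g z) ->
  psradius a n rho.
Proof.
move=> ag r /andP[r0 rrho].
have mr : modulus (r%:C%C : C) = r by rewrite modulus_real gtr0_norm.
have := ag r%:C%C; rewrite mr => /(_ rrho).
move=> /cvgC_modulus /(_ _ ltr01)[N NP].
pose t j := modulus (a j * r%:C%C ^+ n j).
(* Two consecutive partial sums lie within 1 of the limit, so their difference is at most 2; the
   finitely many earlier terms are bounded by their sum. *)
have tN j : (N <= j)%N -> t j <= 2.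
  move=> Nj; have h1 := NP _ Nj; have h2 := NP _ (leqW Nj).
  rewrite /t; move: h1 h2; rewrite /series/= big_nat_recr//=.
  set S := \sum_(0 <= k < j) _; set T := a j * _; set l := g _ => h1 h2.
  have -> : T = (S + T - l) - (S - l) by ring.
  by rewrite (le_trans (modulusB _ _))//; lra.
exists (2 + \sum_(0 <= j < N) t j) => j.
have -> : modulus (a j) * r ^+ n j = t j by rewrite /t modulusM modulusX mr.
have [Nj|jN] := leqP N j.
  by rewrite (le_trans (tN _ Nj))// lerDl sumr_ge0// => i _; exact: modulus_ge0.
rewrite (bigD1_seq j)//= ?mem_index_iota ?iota_uniq//.
rewrite addrCA lerDl addr_ge0// sumr_ge0// => i _; exact: modulus_ge0.
Qed.

Lemma sum_expr_le (x : R) J : 0 <= x < 1 -> \sum_(0 <= j < J) x ^+ j <= (1 - x)^-1.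
Proof.
move=> /andP[x0 x1]; rewrite big_mkord; have x10 : 0 < 1 - x by rewrite subr_gt0.
rewrite -(ler_pM2l x10) divff ?gt_eqF//.
have -> : (1 - x) * \sum_(i < J) x ^+ i = 1 - x ^+ J.
  by rewrite -[in RHS]opprB subrX1 -mulNr opprB.
by rewrite lerBlDr lerDl exprn_ge0.
Qed.

Lemma ler_natM_expr (x : R) k : 0 <= x < 1 -> k%:R * x ^+ k <= (1 - x)^-1.
Proof.
move=> x01; apply: le_trans (sum_expr_le k x01).
move: x01 => /andP[x0 x1].
rewrite -[k in k%:R]subn0 mulr_natl -sumr_const_nat; apply: ler_sum_nat => i /andP[_ ik].
by apply: ler_wiXn2l => //; [exact: ltW|exact: ltnW].
Qed.

(** At an intermediate radius s the terms are bounded by M, and the extra factor n_j is absorbed by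
    (r/s)^(n_j), since k x^k <= 1/(1 - x). *)
Lemma psradius_deriv a n rho :
  psradius a n rho -> psradius (fun j => a j * (n j)%:R) (fun j => (n j).-1) rho.
Proof.
move=> ar r /andP[r0 rrho].
pose s := (r + rho) / 2.
have [rs srho] : r < s /\ s < rho by rewrite /s; lra.
have s0 : 0 < s by lra.
have [|M MP] := ar s; first by rewrite s0 srho.
pose x := r / s.
have x01 : 0 <= x < 1 by rewrite /x divr_ge0 ?(ltW s0)//= ?(ltW r0)//= ltr_pdivrMr// mul1r.
exists (M * (1 - x)^-1 / r) => j.
have M0 : 0 <= M by rewrite (le_trans _ (MP 0%N))// mulr_ge0// exprn_ge0// ltW.
case: (posnP (n j)) => [->|nj].
  rewrite mulr0 modulus0 mul0r divr_ge0 ?(ltW r0)// mulr_ge0// invr_ge0 subr_ge0.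
  by case/andP: x01 => _ /ltW.
rewrite ler_pdivlMr// -mulrA -exprSr prednK// modulusM.
have -> : modulus ((n j)%:R : C) = (n j)%:R.
  by rewrite -(rmorph_nat (real_complex R)) modulus_real normr_nat.
have -> : r ^+ n j = s ^+ n j * x ^+ n j by rewrite -exprMn /x mulrCA divff ?mulr1// gt_eqF.
case/andP: (x01) => x0 _; have s0' := ltW s0.
rewrite mulrACA ler_pM// ?mulr_ge0// ?exprn_ge0//.
exact: ler_natM_expr.
Qed.

(** The condition j <= n j + m compares the terms with x^(j - m); m counts the derivatives taken,
    each lowering exponents by one. The subtraction is truncated, so the first m terms are only
    bounded by 1 each, whence the summand m in the bound. *)
Lemma psradius_sum a n rho (m : nat) (r : R) : (forall j, (j <= n j + m)%N) ->
  psradius a n rho -> 0 <= r < rho ->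
  exists B, forall J, \sum_(0 <= j < J) modulus (a j) * r ^+ n j <= B.
Proof.
move=> jn ar /andP[r0 rrho].
pose s := (r + rho) / 2.
have [rs srho] : r < s /\ s < rho by rewrite /s; lra.
have s0 : 0 < s by lra.
have [|M MP] := ar s; first by rewrite s0 srho.
have M0 : 0 <= M by rewrite (le_trans _ (MP 0%N))// mulr_ge0// exprn_ge0// ltW.
pose x := r / s.
have x01 : 0 <= x < 1 by rewrite /x divr_ge0 ?(ltW s0)//= ltr_pdivrMr// mul1r.
exists (M * (m%:R + (1 - x)^-1)) => J.
apply: (@le_trans _ _ (\sum_(0 <= j < J) M * x ^+ (j - m))).
  apply: ler_sum => j _.
  have -> : r ^+ n j = s ^+ n j * x ^+ n j by rewrite -exprMn /x mulrCA divff ?mulr1// gt_eqF.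
  case/andP: x01 => x0 x1; have s0' := ltW s0.
  rewrite mulrA ler_pM// ?mulr_ge0// ?exprn_ge0//.
  by apply: ler_wiXn2l => //; [exact: ltW|rewrite leq_subLR addnC].
rewrite -mulr_sumr ler_wpM2l//.
have [Jm|mJ] := leqP J m.
  rewrite (le_trans (y := \sum_(0 <= j < J) 1))//.
    by case/andP: x01 => x0 x1; apply: ler_sum => j _; rewrite exprn_ile1// ltW.
  rewrite sumr_const_nat subn0 ler_wpDr// ?ler_nat// invr_ge0 subr_ge0.
  by case/andP: x01 => _ /ltW.
rewrite (@big_cat_nat _ _ _ m)//= ?(ltnW mJ)// lerD//.
  rewrite (le_trans (y := \sum_(0 <= j < m) 1))//.
    by case/andP: x01 => x0 x1; apply: ler_sum => j _; rewrite exprn_ile1// ltW.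
  by rewrite sumr_const_nat subn0.
rewrite -[m in X in X <= _]add0n big_addn.
under eq_bigr do rewrite addnK.
exact: sum_expr_le.
Qed.

Lemma psradius_cvg a n rho (m : nat) z : (forall j, (j <= n j + m)%N) ->
  psradius a n rho -> modulus z < rho ->
  exists l : C, series (fun j => a j * z ^+ n j) @ \oo --> l.
Proof.
move=> jn ar zr; apply: absum_cvg.
have [|B BP] := psradius_sum jn ar (r := modulus z); first by rewrite modulus_ge0.
by apply: absumW BP => j; rewrite modulusM modulusX.
Qed.

(** For i >= M the factor |h|^i is at most (|h|/d)^M d^i, and what remains is part of the binomial
    expansion of (|z| + d)^k. *)
Lemma binomial_remainder z h (d : R) k M : 0 < d -> modulus h <= d ->
  modulus ((z + h) ^+ k - \sum_(0 <= i < M) z ^+ (k - i) * h ^+ i * 'C(k, i)%:R)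
    <= (modulus h / d) ^+ M * (modulus z + d) ^+ k.
Proof.
(* Padding the expansion with vanishing binomial coefficients up to N allows it to be cut at M
   whether or not M exceeds k. *)
move=> d0 hd; pose N := (k.+1 + M)%N.
have expand (K : comNzRingType) (x y : K) :
    (x + y) ^+ k = \sum_(0 <= i < N) x ^+ (k - i) * y ^+ i * 'C(k, i)%:R.
  rewrite exprDn (@big_cat_nat _ _ _ k.+1)//= ?leq_addr// [X in _ + X]big1_seq ?addr0.
    by rewrite big_mkord; apply: eq_bigr => i _; rewrite mulr_natr.
  move=> i /andP[_]; rewrite mem_index_iota => /andP[ki _].
  by rewrite bin_small// mulr0.
rewrite !expand (@big_cat_nat _ _ _ M 0%N N)//= ?leq_addl// addrAC subrr add0r.
rewrite (@big_cat_nat _ _ _ M 0%N N)//= ?leq_addl// mulrDr.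
have x0 : 0 <= modulus h / d by rewrite divr_ge0// ltW.
rewrite ler_wpDl//.
  rewrite mulr_ge0 ?exprn_ge0// sumr_ge0// => i _.
  by rewrite !mulr_ge0// exprn_ge0// ltW.
rewrite (le_trans (modulus_sum _ _ _))// mulr_sumr.
apply: ler_sum_nat => i /andP[Mi _].
rewrite !modulusM !modulusX.
have -> : modulus ('C(k, i)%:R : C) = 'C(k, i)%:R.
  by rewrite -(rmorph_nat (real_complex R)) modulus_real normr_nat.
have -> : modulus h ^+ i = (modulus h / d) ^+ i * d ^+ i.
  by rewrite -exprMn divfK// gt_eqF.
have -> : modulus z ^+ (k - i) * ((modulus h / d) ^+ i * d ^+ i) * 'C(k, i)%:R
  = (modulus h / d) ^+ i * (modulus z ^+ (k - i) * d ^+ i * 'C(k, i)%:R) by ring.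
rewrite ler_wpM2r//.
  by rewrite !mulr_ge0// exprn_ge0// ltW.
by rewrite ler_wiXn2l// ler_pdivrMr// mul1r.
Qed.

(** Re-expansion about z with a geometric remainder valid for all orders at once: M = 2 gives the
    derivative in [ps_cderiv], and M tending to infinity gives analyticity in [ps_analytic]. The
    constant K is the sum of |a_j| (|z| + d)^(n_j). *)
Lemma ps_taylor a n rho (m : nat) g z (d : R) : (forall j, (j <= n j + m)%N) ->
  (forall z, modulus z < rho -> series (fun j => a j * z ^+ n j) @ \oo --> g z) ->
  0 < d -> modulus z + d < rho ->
  exists (A : nat -> C) (K : R),
    (forall k, series (fun j => a j * (z ^+ (n j - k) * 'C(n j, k)%:R)) @ \oo --> A k) /\
    forall M h, modulus h <= d ->
      modulus (g (z + h) - \sum_(0 <= k < M) A k * h ^+ k) <= K * (modulus h / d) ^+ M.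
Proof.
move=> jn ag d0 zd; have ar := cvg_psradius ag.
have [|B BP] := psradius_sum jn ar (r := modulus z + d).
  by rewrite zd andbT addr_ge0// ltW.
have /choice[A AP] : forall k, exists l : C,
    series (fun j => a j * (z ^+ (n j - k) * 'C(n j, k)%:R)) @ \oo --> l.
  move=> k; apply: absum_cvg; apply: (@absumW _
      (fun j => (d ^+ k)^-1 * (modulus (a j) * (modulus z + d) ^+ n j)) ((d ^+ k)^-1 * B)).
    move=> j; rewrite [leRHS]mulrCA modulusM ler_wpM2l// modulusM modulusX.
    have -> : modulus ('C(n j, k)%:R : C) = 'C(n j, k)%:R.
      by rewrite -(rmorph_nat (real_complex R)) modulus_real normr_nat.
    (* Multiplied by d^k, the summand of A_k becomes one term of the binomial expansion of (|z| +
       d)^(n_j), or 0 when k > n_j. *)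
    rewrite ler_pdivlMl ?exprn_gt0// mulrA [d ^+ k * _]mulrC mulr_natr exprDn.
    have [kn|nk] := ltnP k (n j).+1.
      rewrite (bigD1 (Ordinal kn))//= lerDl sumr_ge0// => i _.
      by rewrite mulrn_wge0// mulr_ge0// exprn_ge0// ltW.
    rewrite bin_small// mulr0n sumr_ge0// => i _.
    by rewrite mulrn_wge0// mulr_ge0// exprn_ge0// ltW.
  by move=> J; rewrite -mulr_sumr ler_wpM2l// invr_ge0 exprn_ge0// ltW.
exists A, B; split=> // M h hd.
have hz : modulus (z + h) < rho by rewrite (le_lt_trans (modulusD _ _))//; lra.
have cA : series (fun j => a j * ((z + h) ^+ n j -
    \sum_(0 <= i < M) z ^+ (n j - i) * h ^+ i * 'C(n j, i)%:R)) @ \oo -->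
    g (z + h) - \sum_(0 <= k < M) A k * h ^+ k.
  have -> : series (fun j => a j * ((z + h) ^+ n j -
      \sum_(0 <= i < M) z ^+ (n j - i) * h ^+ i * 'C(n j, i)%:R)) =
      (fun J => series (fun j => a j * (z + h) ^+ n j) J -
        \sum_(0 <= k < M)
          series (fun j => a j * (z ^+ (n j - k) * 'C(n j, k)%:R)) J * h ^+ k).
    apply/funext => J; rewrite /series/=.
    under eq_bigr do rewrite mulrBr.
    rewrite sumrB; congr (_ - _).
    under [RHS]eq_bigr do rewrite mulr_suml.
    rewrite exchange_big/=; apply: eq_bigr => j _; rewrite mulr_sumr.
    by apply: eq_bigr => i _; ring.
  apply: cvgB; first exact: ag.
  by apply: cvgC_sum => k; apply: cvgC_mulr; exact: AP.
apply: (modulus_series_le cA) => J.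
apply: (le_trans (modulus_sum _ _ _)).
rewrite mulrC; apply: (@le_trans _ _ ((modulus h / d) ^+ M *
    \sum_(0 <= j < J) modulus (a j) * (modulus z + d) ^+ n j)); last first.
  by rewrite ler_wpM2l// exprn_ge0// divr_ge0// ltW.
rewrite mulr_sumr; apply: ler_sum => j _.
by rewrite modulusM mulrCA ler_wpM2l// binomial_remainder.
Qed.

Lemma ps_cderiv a n rho (m : nat) g (g1 : C) z : (forall j, (j <= n j + m)%N) ->
  (forall z, modulus z < rho -> series (fun j => a j * z ^+ n j) @ \oo --> g z) ->
  series (fun j => a j * (n j)%:R * z ^+ (n j).-1) @ \oo --> g1 ->
  modulus z < rho -> cderiv g z g1.
Proof.
move=> jn ag ag1 zr; pose d := (rho - modulus z) / 2.
have d0 : 0 < d by rewrite divr_gt0// subr_gt0.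
have [|A [K [AP KP]]] := ps_taylor jn ag d0 (z := z); first by rewrite /d; lra.
have A0 : A 0%N = g z.
  apply: cvgC_unique (AP 0%N) _.
  rewrite (_ : (fun j => _) = (fun j => a j * z ^+ n j)); first exact: ag.
  by apply/funext => j; rewrite subn0 bin0 mulr1.
have A1 : A 1%N = g1.
  apply: cvgC_unique (AP 1%N) _.
  rewrite (_ : (fun j => _) = (fun j => a j * (n j)%:R * z ^+ (n j).-1)) //.
  by apply/funext => j; rewrite subn1 bin1 -mulrA (mulrC _%:R).
move=> e e0; have K0 : 0 <= K.
  have := KP 0%N 0; rewrite modulus0 expr0 mulr1 => /(_ (ltW d0)).
  exact: le_trans.
exists (Num.min d (e * d ^+ 2 / (1 + K))); split.
  rewrite lt_min d0/= divr_gt0//; first by rewrite mulr_gt0// exprn_gt0.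
  by rewrite ltr_pwDl.
move=> h; rewrite lt_min => /andP[hd]; rewrite ltr_pdivlMr ?ltr_pwDl// => he.
have := KP 2%N h (ltW hd); rewrite !big_nat_recr//= big_nil add0r expr0 mulr1 expr1.
rewrite A0 A1 opprD addrA (mulrC g1) => /le_trans; apply.
rewrite expr_div_n mulrA ler_pdivrMr ?exprn_gt0//.
have : 0 <= modulus h by []. move: (modulus h) he => t he t0.
have Kt : t * K <= e * d ^+ 2 by rewrite (le_trans _ (ltW he))// ler_wpM2l// lerDr.
have := ler_wpM2l t0 Kt; rewrite expr2 => H.
by rewrite (_ : K * _ = t * (t * K)) 1?(_ : e * t * _ = t * (e * d ^+ 2))//; ring.
Qed.

Lemma ps_analytic a n (m : nat) g : (forall j, (j <= n j + m)%N) ->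
  (forall z, modulus z < 1 -> series (fun j => a j * z ^+ n j) @ \oo --> g z) ->
  analytic_disc g.
Proof.
move=> jn ag z zr; pose d := (1 - modulus z) / 2.
have d0 : 0 < d by rewrite divr_gt0// subr_gt0.
have [|A [K [AP KP]]] := ps_taylor jn ag d0 (z := z); first by rewrite /d; lra.
exists A, d; split=> // w wd; apply/cvgC_modulus => e e0.
pose x := modulus (w - z) / d.
have x01 : `|x| < 1.
  have x0 : 0 <= x by rewrite divr_ge0// ltW.
  by rewrite ger0_norm// ltr_pdivrMr// mul1r.
have /cvgR_dist/(_ _ e0)[N NP] : (fun k => K * x ^+ k) @ \oo --> (0 : R).
  by rewrite -(mulr0 K); apply: cvgMl_tmp; exact: cvg_expr.
exists N => k /NP; rewrite subr0; apply: le_lt_trans.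
have := KP k _ (ltW wd); rewrite subrKC => kP; rewrite modulusBC.
exact: le_trans kP (ler_norm _).
Qed.

(** The homotopy argument requires a continuous derivative. It is obtained by differentiating the
    local expansion at z twice: the derived series represents f' near z and is itself differentiable
    at z. *)
Lemma analytic_cderiv f z : analytic_disc f -> modulus z < 1 ->
  cderiv f z (derive1 f z) /\ ccontinuous_at (derive1 f) z.
Proof.
move=> fa z1; have [a [e [e0 ae]]] := fa z z1.
have jn j : (j <= j + 0)%N by rewrite addn0.
have ag w : modulus w < e -> series (fun j => a j * w ^+ j) @ \oo --> f (z + w).
  by move=> we; have := ae (z + w); rewrite addrAC subrr add0r; exact.
have ar := cvg_psradius ag.
have ar1 := psradius_deriv ar.
have jn1 j : (j <= j.-1 + 1)%N by rewrite addn1 leqSpred.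
have /choice[g1 g1P] : forall w, exists l : C, modulus w < e ->
    series (fun j => a j * j%:R * w ^+ j.-1) @ \oo --> l.
  move=> w; have [we|] := ltP (modulus w) e; last by exists 0.
  by have [l] := psradius_cvg jn1 ar1 we; exists l.
have jn2 j : (j <= j.-1.-1 + 2)%N by rewrite addn2; case: j => [|[]].
have shift w d : modulus w < e -> cderiv (fun w => f (z + w)) w d -> cderiv f (z + w) d.
  move=> we fw r /fw[dl [dl0 dlP]]; exists dl; split=> // h /dlP.
  by rewrite addrA.
have fd w : modulus w < e -> cderiv f (z + w) (g1 w).
  by move=> we; apply: shift => //; apply: ps_cderiv jn ag (g1P _ we) we.
have f1 w : modulus w < e -> derive1 f (z + w) = g1 w.
  by move=> /fd/cderiv_derive1.
have m0 : modulus (0 : C) < e by rewrite modulus0.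
have f10 : derive1 f z = g1 0 by have := f1 0 m0; rewrite addr0.
split; first by have := fd 0 m0; rewrite addr0 f10.
have [l lP] := psradius_cvg jn2 (psradius_deriv ar1) m0.
have /cderiv_continuous g1c : cderiv g1 0 l by apply: ps_cderiv jn1 g1P lP m0.
move=> r /g1c[dl [dl0 dlP]]; exists (Num.min dl e); split; first by rewrite lt_min dl0.
by move=> h; rewrite lt_min => /andP[/dlP + he]; rewrite f1// f10 add0r.
Qed.

End PowerSeries.

(** * Integrals over the circle *)

Section CircleIntegral.
Context {R : realType}.
Local Notation mu := (@lebesgue_measure R).
Implicit Types (h k F : R -> R).

Local Notation T := (`[0%R, (2 * pi)%R]%classic : set R).
Definition circle_int h : R := \int[mu]_(x in T) h x.

Lemma two_pi_gt0 : 0 < 2 * pi :> R.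
Proof. by rewrite mulr_gt0// pi_gt0. Qed.

Lemma continuous_integrable_itv h (a b : R) : continuous h ->
  mu.-integrable `[a, b]%classic (EFin \o h).
Proof.
move=> ch; apply: continuous_compact_integrable; first exact: segment_compact.
exact: continuous_subspaceT.
Qed.

Lemma continuous_integrable_circle h : continuous h -> mu.-integrable T (EFin \o h).
Proof. exact: continuous_integrable_itv. Qed.

Lemma circle_int_EFin h : continuous h ->
  (\int[mu]_(x in T) (h x)%:E = (circle_int h)%:E)%E.
Proof.
move=> ch; rewrite /circle_int /Rintegral fineK//.
exact: integrable_fin_num (continuous_integrable_circle ch).
Qed.

Lemma circle_intD h k : continuous h -> continuous k ->
  circle_int (fun x => h x + k x) = circle_int h + circle_int k.
Proof. by move=> ch ck; apply: RintegralD => //; exact: continuous_integrable_circle. Qed.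

Lemma circle_intZ c h : continuous h ->
  circle_int (fun x => c * h x) = c * circle_int h.
Proof. by move=> ch; apply: RintegralZl => //; exact: continuous_integrable_circle. Qed.

Lemma circle_int_cst c : circle_int (fun=> c) = c * (2 * pi).
Proof.
rewrite /circle_int Rintegral_cst//= lebesgue_measure_itv/= lte_fin two_pi_gt0.
by rewrite sube0.
Qed.

Lemma continuous_sum_fun (I : Type) (s : seq I) (u : I -> R -> R) :
  (forall i, continuous (u i)) -> continuous (fun x => \sum_(i <- s) u i x).
Proof.
move=> cu; elim: s => [|i s ih] x.
  by under eq_fun do rewrite big_nil; exact: cvg_cst.
rewrite (_ : (fun x => _) = (fun x => u i x + \sum_(i <- s) u i x)); last first.
  by apply/funext => y; rewrite big_cons.
by apply: cvgD; [exact: cu|exact: ih].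
Qed.

Lemma circle_int_sum (I : Type) (s : seq I) (u : I -> R -> R) :
  (forall i, continuous (u i)) ->
  circle_int (fun x => \sum_(i <- s) u i x) = \sum_(i <- s) circle_int (u i).
Proof.
move=> cu; elim: s => [|i s ih].
  under [in LHS]eq_fun do rewrite big_nil.
  by rewrite circle_int_cst mul0r big_nil.
under [in LHS]eq_fun do rewrite big_cons.
by rewrite circle_intD ?ih ?big_cons//; exact: continuous_sum_fun.
Qed.

Lemma le_circle_int h k : continuous h -> continuous k ->
  (forall x, 0 <= x <= 2 * pi -> h x <= k x) -> circle_int h <= circle_int k.
Proof.
move=> ch ck hk; apply: le_Rintegral => //; try exact: continuous_integrable_circle.
Qed.

Lemma circle_int_ge0 h : (forall x, 0 <= h x) -> 0 <= circle_int h.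
Proof. by move=> h0; apply: Rintegral_ge0. Qed.

Lemma eq_circle_int h k : (forall x, h x = k x) -> circle_int h = circle_int k.
Proof. by move=> hk; congr circle_int; exact/funext. Qed.

Lemma is_derive_continuous h k (x : R) : is_derive x 1 h (k x) -> {for x, continuous h}.
Proof. by move=> [hd _]; exact/differentiable_continuous/derivable1_diffP. Qed.

Lemma FTC2_itv h F (a b : R) : a <= b -> (forall x : R, is_derive x 1 F (h x)) ->
  continuous h -> (\int[mu]_(x in `[a, b]) (h x)%:E = (F b - F a)%:E)%E.
Proof.
rewrite le_eqVlt => /predU1P[->|ab] dF ch.
  by rewrite subrr set_itv1 integral_set1.
have cF : continuous F by move=> x; exact: (is_derive_continuous (dF x)).
rewrite (continuous_FTC2 ab (continuous_subspaceT ch) (F := F)) ?EFinB//.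
  split; first by move=> x _; have [] := dF x.
  - exact/cvg_at_right_filter/cF.
  - exact/cvg_at_left_filter/cF.
by move=> x _; rewrite derive1E; exact: derive_val.
Qed.

Lemma circle_int_deriv h F : (forall x : R, is_derive x 1 F (h x)) -> continuous h ->
  F (2 * pi) = F 0 -> circle_int h = 0.
Proof.
move=> dF ch F0; apply/EFin_inj; rewrite -circle_int_EFin//.
by rewrite (FTC2_itv (F := F)) ?ltW ?two_pi_gt0// F0 subrr.
Qed.

Lemma sin_2pik (j : nat) (phi : R) : sin (j%:R * (2 * pi) + phi) = sin phi.
Proof.
have -> : j%:R * (2 * pi) + phi = phi + (pi *+ 2) *+ j.
  by rewrite -[(pi *+ 2) *+ j]mulr_natl -[pi *+ 2]mulr_natl addrC.
by rewrite periodicn//; exact: sinD2pi.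
Qed.

Lemma continuous_cos_affine (a b : R) : continuous (fun x => cos (a * x + b)).
Proof.
move=> x; apply: continuous_comp; last exact: continuous_cos.
by apply: cvgD; [apply: cvgMl_tmp; exact: cvg_id|exact: cvg_cst].
Qed.

Lemma circle_int_cos (j : nat) (phi : R) : (0 < j)%N ->
  circle_int (fun x => cos (j%:R * x + phi)) = 0.
Proof.
move=> j0; have j0' : j%:R != 0 :> R by rewrite pnatr_eq0 -lt0n.
apply: (@circle_int_deriv _ (fun x => j%:R^-1 * sin (j%:R * x + phi))).
- move=> x; apply: is_derive_eq.
  by rewrite addr0 /GRing.scale/= mulr1 mulrCA mulVf ?mulr1.
- exact: continuous_cos_affine.
- by rewrite sin_2pik mulr0 add0r.
Qed.

Definition rderiv (gam : R -> R[i]) (s : R) (v : R[i]) := forall e : R, 0 < e -> exists dl : R, 0 < dl /\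
  forall x : R, `|x| < dl -> modulus (gam (s + x) - gam s - x%:C%C * v) <= e * `|x|.

Lemma is_deriveP h (s a : R) : is_derive s 1 h a <-> forall e : R, 0 < e -> exists dl : R,
  0 < dl /\ forall x : R, `|x| < dl -> `|h (s + x) - h s - x * a| <= e * `|x|.
Proof.
split=> [hd e e0|hd].
  case: hd => /cvg_ex[l /= hl] ha.
  have {ha} al : a = l by rewrite -ha; exact: cvg_lim hl.
  rewrite {}al; move/cvgrPdist_le : hl => /(_ _ e0)[dl/= dl0 dlP].
  exists dl; split=> // x xdl; have [->|x0] := eqVneq x 0.
    by rewrite addr0 subrr mul0r subrr normr0 mulr0.
  have := dlP x; rewrite /ball_/= sub0r normrN => /(_ xdl x0).
  rewrite -(ler_pM2l (_ : 0 < `|x|)) ?normr_gt0// -normrM mulrBr.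
  rewrite [x%:A]mulr1 (addrC x s) /GRing.scale/= mulrA divff// mul1r distrC.
  by rewrite [leRHS]mulrC.
have cv : x^-1 *: (h (x *: 1 + s) - h s) @[x --> 0^'] --> a.
  apply/cvgrPdist_le => e /hd[dl [dl0 dlP]]; exists dl => //= x /=.
  rewrite sub0r normrN => xdl x0; have H := dlP x xdl.
  rewrite -(ler_pM2l (_ : 0 < `|x|)) ?normr_gt0// -normrM mulrBr.
  rewrite [x%:A]mulr1 (addrC x s) /GRing.scale/= mulrA divff// mul1r distrC.
  by rewrite (le_trans H)// mulrC.
by apply: DeriveDef; [apply/cvg_ex; exists a|exact: cvg_lim cv].
Qed.

Lemma rderiv_ReIm gam (s : R) (v : R[i]) :
  is_derive s 1 (fun x => complex.Re (gam x)) (complex.Re v) ->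
  is_derive s 1 (fun x => complex.Im (gam x)) (complex.Im v) -> rderiv gam s v.
Proof.
move=> /is_deriveP hR /is_deriveP hI e e0.
have e20 : 0 < e / 2 by rewrite divr_gt0.
have [d1 [d10 h1]] := hR _ e20; have [d2 [d20 h2]] := hI _ e20.
exists (Num.min d1 d2); split; first by rewrite lt_min d10.
move=> x; rewrite lt_min => /andP[/h1{}h1 /h2{}h2].
rewrite (le_trans (modulus_le_ReIm _))// (splitr e) mulrDl.
have xv : x%:C%C * v = Complex (x * complex.Re v) (x * complex.Im v).
  by case: v {h1 h2 hR hI} => a b; simpc.
by rewrite !(ReB, ImB) xv/= lerD.
Qed.

Lemma rderiv_Re gam (s : R) (v : R[i]) : rderiv gam s v ->
  is_derive s 1 (fun x => complex.Re (gam x)) (complex.Re v).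
Proof.
move=> gv; apply/is_deriveP => e /gv[dl [dl0 dlP]]; exists dl; split=> // x /dlP.
apply: le_trans; apply: le_trans (normr_Re_le _); rewrite !ReB.
by case: v {gv dlP} => a b; simpc.
Qed.

Lemma rderiv_comp (f : R[i] -> R[i]) gam s v d : rderiv gam s v ->
  cderiv f (gam s) d -> rderiv (fun x => f (gam x)) s (d * v).
Proof.
move=> gv fd e e0.
pose K := 1 + modulus v; have K0 : 0 < K by rewrite ltr_pwDl.
have [d1 [d10 h1]] := fd (e / 2 / K) (divr_gt0 (divr_gt0 e0 (ltr0n _ 2)) K0).
have md : 0 < 1 + modulus d by rewrite ltr_pwDl.
(* The bound 1 makes the increment y of gam Lipschitz with constant K; the other bound makes the
   error multiplied by d at most e/2 |x|. *)
have [d2 [d20 h2]] := gv (Num.min 1 (e / 2 / (1 + modulus d)))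
  ltac:(by rewrite lt_min ltr01 divr_gt0// divr_gt0).
exists (Num.min d2 (d1 / K)); split; first by rewrite lt_min d20 divr_gt0.
move=> x; rewrite lt_min ltr_pdivlMr// => /andP[/h2{}h2 xK].
pose y := gam (s + x) - gam s.
have yx : modulus y <= K * `|x|.
  rewrite -(subrK (x%:C%C * v) y) (le_trans (modulusD _ _))// /K mulrDl.
  rewrite modulusM modulus_real [modulus v * _]mulrC lerD//.
  by rewrite (le_trans h2)// ler_wpM2r// ge_min lexx.
have yd1 : modulus y < d1 by rewrite (le_lt_trans yx)// mulrC.
have {}h1 := h1 y yd1.
rewrite [gam s + y]addrC /y subrK in h1.
have -> : f (gam (s + x)) - f (gam s) - x%:C%C * (d * v) =
  (f (gam (s + x)) - f (gam s) - y * d) + (y - x%:C%C * v) * d by ring.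
rewrite (le_trans (modulusD _ _))// [e in leRHS]splitr [leRHS]mulrDl lerD//.
  rewrite (le_trans h1)// -[e / 2 / K * _]mulrA ler_wpM2l ?divr_ge0 ?(ltW e0)//.
  by rewrite ler_pdivrMl.
rewrite modulusM (le_trans (ler_wpM2r _ h2))//.
rewrite mulrAC ler_wpM2r//.
apply: (@le_trans _ _ (e / 2 / (1 + modulus d) * modulus d)).
  by rewrite ler_wpM2r// ge_min lexx orbT.
by rewrite -mulrA ler_piMr ?divr_ge0 ?(ltW e0)// ler_pdivrMl// mulr1 lerDr.
Qed.

Lemma rderiv_circle (r x : R) :
  rderiv (circle_point r) x ('i%C * circle_point r x).
Proof.
have -> : 'i%C * circle_point r x = Complex (r * - sin x) (r * cos x).
  by rewrite /circle_point; simpc.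
by apply: rderiv_ReIm; rewrite /circle_point/=.
Qed.

End CircleIntegral.

(** * Cauchy's theorem by homotopy *)

Section CauchyFormula.
Context {R : realType}.
Local Notation C := R[i].
Local Notation mu := (@lebesgue_measure R).
Implicit Types (f g : C -> C) (z w h d : C) (u : R -> C).

Lemma cderiv_comp f g z d1 d2 : cderiv g (f z) d2 -> cderiv f z d1 ->
  cderiv (fun w => g (f w)) z (d2 * d1).
Proof.
move=> fd gv e e0.
pose K := 1 + modulus d1; have K0 : 0 < K by rewrite ltr_pwDl.
have [r1 [r10 h1]] := fd (e / 2 / K) (divr_gt0 (divr_gt0 e0 (ltr0n _ 2)) K0).
have md : 0 < 1 + modulus d2 by rewrite ltr_pwDl.
have [r2 [r20 h2]] := gv (Num.min 1 (e / 2 / (1 + modulus d2)))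
  ltac:(by rewrite lt_min ltr01 divr_gt0// divr_gt0).
exists (Num.min r2 (r1 / K)); split; first by rewrite lt_min r20 divr_gt0.
move=> x; rewrite lt_min ltr_pdivlMr// => /andP[/h2{}h2 xK].
pose y := f (z + x) - f z.
have yx : modulus y <= K * modulus x.
  rewrite -(subrK (x * d1) y) (le_trans (modulusD _ _))// /K mulrDl.
  rewrite modulusM [modulus d1 * _]mulrC lerD//.
  by rewrite (le_trans h2)// ler_wpM2r// ge_min lexx.
have yr1 : modulus y < r1 by rewrite (le_lt_trans yx)// mulrC.
have {}h1 := h1 y yr1.
rewrite [f z + y]addrC /y subrK in h1.
have -> : g (f (z + x)) - g (f z) - x * (d2 * d1) =
  (g (f (z + x)) - g (f z) - y * d2) + (y - x * d1) * d2 by ring.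
rewrite (le_trans (modulusD _ _))// [e in leRHS]splitr [leRHS]mulrDl lerD//.
  rewrite (le_trans h1)// -[e / 2 / K * _]mulrA ler_wpM2l ?divr_ge0 ?(ltW e0)//.
  by rewrite ler_pdivrMl.
rewrite modulusM (le_trans (ler_wpM2r _ h2))//.
rewrite mulrAC ler_wpM2r//.
apply: (@le_trans _ _ (e / 2 / (1 + modulus d2) * modulus d2)).
  by rewrite ler_wpM2r// ge_min lexx orbT.
by rewrite -mulrA ler_piMr ?divr_ge0 ?(ltW e0)// ler_pdivrMl// mulr1 lerDr.
Qed.

Lemma cderiv_affine (a b : C) z : cderiv (fun w => a + b * w) z b.
Proof.
move=> e e0; exists 1; split=> // h _.
have -> : a + b * (z + h) - (a + b * z) - h * b = 0 by ring.
by rewrite modulus0 mulr_ge0// ltW.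
Qed.

Lemma cderiv_inv z : z != 0 -> cderiv GRing.inv z (- (z ^+ 2)^-1).
Proof.
move=> z0 e e0; have mz : 0 < modulus z by rewrite modulus_gt0.
exists (Num.min (modulus z / 2) (e * modulus z ^+ 3 / 2)); split.
  by rewrite lt_min divr_gt0//= divr_gt0// mulr_gt0// exprn_gt0.
move=> h; rewrite lt_min => /andP[hz]; rewrite ltr_pdivlMr// => he.
have zh : modulus z / 2 <= modulus (z + h).
  have := modulusB (z + h) h; rewrite addrK; lra.
have zh0 : z + h != 0 by rewrite -modulus_gt0 (lt_le_trans _ zh)// divr_gt0.
have -> : (z + h)^-1 - z^-1 - h * - (z ^+ 2)^-1 = h * (h * (z ^+ 2)^-1 * (z + h)^-1).
  by field; rewrite z0 zh0.
rewrite !modulusM !modulusV modulusX mulrC ler_wpM2r//.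
rewrite ler_pdivrMr ?(lt_le_trans _ zh) ?divr_gt0// ler_pdivrMr ?exprn_gt0//.
apply: (@le_trans _ _ (e * (modulus z / 2) * modulus z ^+ 2)); last first.
  by rewrite ler_wpM2r ?exprn_ge0// ler_wpM2l// ltW.
by move: he; rewrite !exprS expr0; nra.
Qed.

Definition rcontinuous_at u (s : R) := forall e : R, 0 < e -> exists dl : R, 0 < dl /\
  forall x : R, `|x| < dl -> modulus (u (s + x) - u s) < e.

Lemma rderiv_continuous u s v : rderiv u s v -> rcontinuous_at u s.
Proof.
move=> fd e e0; have [dl [dl0 dlP]] := fd _ ltr01.
pose K := 1 + modulus v; have K0 : 0 < K by rewrite ltr_pwDl.
exists (Num.min dl (e / K)); split; first by rewrite lt_min dl0 divr_gt0.
move=> h; rewrite lt_min => /andP[/dlP hd]; rewrite ltr_pdivlMr// => hK.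
apply: le_lt_trans hK; rewrite -(subrK (h%:C%C * v) (u (s + h) - u s)).
rewrite (le_trans (modulusD _ _))// modulusM modulus_real mulrDr mulr1 lerD//.
by rewrite (le_trans hd)// mul1r.
Qed.

Lemma rcontinuous_comp f u s : ccontinuous_at f (u s) -> rcontinuous_at u s ->
  rcontinuous_at (fun x => f (u x)) s.
Proof.
move=> cf cu e /cf[d1 [/cu[d2 [d20 h2]] h1]]; exists d2; split=> // x /h2/h1.
by rewrite [u s + _]addrC subrK.
Qed.

Lemma rcontinuousM u v s : rcontinuous_at u s -> rcontinuous_at v s ->
  rcontinuous_at (fun x => u x * v x) s.
Proof.
move=> cu cv e e0.
pose K := 1 + modulus (u s) + modulus (v s).
have K0 : 0 < K by rewrite /K -addrA ltr_pwDl// addr_ge0.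
have e1 : 0 < Num.min 1 (e / (2 * K)) by rewrite lt_min ltr01 divr_gt0// mulr_gt0.
have [d1 [d10 h1]] := cu _ e1; have [d2 [d20 h2]] := cv _ e1.
exists (Num.min d1 d2); split; first by rewrite lt_min d10.
move=> x; rewrite lt_min => /andP[/h1{}h1 /h2{}h2].
have -> : u (s + x) * v (s + x) - u s * v s =
  (u (s + x) - u s) * (v (s + x) - v s) + (u (s + x) - u s) * v s + u s * (v (s + x) - v s).
  by ring.
move: h1 h2; rewrite !lt_min; set a := modulus (_ - _); set b := modulus (_ - _).
rewrite !ltr_pdivlMr ?mulr_gt0// => /andP[a1 aK] /andP[b1 bK].
rewrite (le_lt_trans (modulusD _ _))// (le_lt_trans (lerD (modulusD _ _) (lexx _)))//.
rewrite !modulusM -/a -/b.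
have a0 : 0 <= a by exact: modulus_ge0.
have b0 : 0 <= b by exact: modulus_ge0.
 
have u0 := modulus_ge0 (u s); have v0 := modulus_ge0 (v s).
move: aK bK; rewrite /K; move: (modulus (u s)) (modulus (v s)) u0 v0 => p q p0 q0; nra.
Qed.

Lemma rcontinuous_cst (c : C) s : rcontinuous_at (fun=> c) s.
Proof. by move=> e e0; exists 1; split=> // x _; rewrite subrr modulus0. Qed.

Lemma rcontinuous_real_at u (p : C -> R) s :
  (forall z w, `|p z - p w| <= modulus (z - w)) ->
  rcontinuous_at u s -> {for s, continuous (fun x => p (u x))}.
Proof.
move=> pL cu; apply/(@cvgrPdist_lt _ R^o) => e e0.
have [dl [dl0 dlP]] := cu e e0.
exists dl => //= x; rewrite /ball_/= => sx.
rewrite distrC (le_lt_trans (pL _ _))//.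
have := dlP (x - s); rewrite distrC => /(_ sx).
by rewrite subrKC.
Qed.

Lemma rcontinuous_real u (p : C -> R) :
  (forall z w, `|p z - p w| <= modulus (z - w)) ->
  (forall s, rcontinuous_at u s) -> continuous (fun x => p (u x)).
Proof. by move=> pL cu s; exact: rcontinuous_real_at. Qed.

Lemma Re_lipschitz z w : `|complex.Re z - complex.Re w| <= modulus (z - w).
Proof. by rewrite -ReB normr_Re_le. Qed.

Lemma Im_lipschitz z w : `|complex.Im z - complex.Im w| <= modulus (z - w).
Proof. by rewrite -ImB normr_Im_le. Qed.

Lemma modulus_lipschitz z w : `|modulus z - modulus w| <= modulus (z - w).
Proof.
rewrite ler_norml; apply/andP; split.
  by rewrite lerNl opprB lerBlDr modulusBC (le_trans _ (modulusD _ _))// subrK.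
by rewrite lerBlDr (le_trans _ (modulusD _ _))// subrK.
Qed.

Lemma rcontinuous_Re u : (forall s, rcontinuous_at u s) ->
  continuous (fun x => complex.Re (u x)).
Proof. exact: rcontinuous_real Re_lipschitz. Qed.

Lemma rcontinuous_modulus u : (forall s, rcontinuous_at u s) ->
  continuous (fun x => modulus (u x)).
Proof. exact: rcontinuous_real modulus_lipschitz. Qed.

Lemma rderivMr u (s : R) v c : rderiv u s v -> rderiv (fun x => u x * c) s (v * c).
Proof.
move=> uv; rewrite mulrC; apply: (@rderiv_comp _ (fun w => w * c)) => //.
rewrite (_ : (fun w => w * c) = (fun w => 0 + c * w)); last first.
  by apply/funext => w; rewrite add0r mulrC.
exact: cderiv_affine.
Qed.

Section Homotopy.
Variables (f f1 : C -> C) (r0 rho : R) (z : C).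
Hypotheses (rho0 : 0 < rho) (rhor : rho < r0) (zrho : modulus z < rho).
Hypothesis fd : forall w, modulus w < r0 -> cderiv f w (f1 w) /\ ccontinuous_at f1 w.

Let W := circle_point rho.
Let gam (s theta : R) := z + s%:C%C * (W theta - z).
Let c theta := W theta / (W theta - z).
(** Room around [0, 1] for differentiating in s: |1 - s| + |s| <= 1 + 2 eta on the enlarged
    interval, and (1 + 2 eta) rho is the midpoint of rho and r0. *)
Let eta := (r0 - rho) / (4 * rho).

Let eta0 : 0 < eta.
Proof. by rewrite divr_gt0 ?subr_gt0// mulr_gt0. Qed.

Let Wz theta : W theta - z != 0.
Proof.
rewrite subr_eq0; apply/eqP => Wz; move: zrho.
by rewrite -Wz /W modulus_circle_point gtr0_norm// ltxx.
Qed.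

Let gam_lt s theta : - eta <= s <= 1 + eta -> modulus (gam s theta) < r0.
Proof.
move=> sI.
have -> : gam s theta = (1 - s)%:C%C * z + s%:C%C * W theta.
  by rewrite /gam rmorphB rmorph1; ring.
rewrite (le_lt_trans (modulusD _ _))// !modulusM !modulus_real modulus_circle_point.
rewrite (gtr0_norm rho0).
apply: (@le_lt_trans _ _ ((1 + 2 * eta) * rho)); last first.
  rewrite /eta (_ : _ * rho = rho + (r0 - rho) / 2); last by field; rewrite gt_eqF.
  by move: rhor; lra.
apply: (@le_trans _ _ (`|1 - s| * rho + `|s| * rho)).
  by rewrite lerD// ler_wpM2l// ltW.
rewrite -mulrDl ler_wpM2r ?(ltW rho0)//; move: eta0 sI => e0 /andP[s1 s2].
by have [? | ?] := ler0P s; have [? | ?] := ler0P (1 - s); lra.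
Qed.

Let W_deriv theta : rderiv W theta ('i%C * W theta).
Proof. exact: rderiv_circle. Qed.

Let gam_deriv_s theta s : rderiv (gam ^~ theta) s (W theta - z).
Proof.
move=> e e0; exists 1; split=> // x _.
have -> : gam (s + x) theta - gam s theta - x%:C%C * (W theta - z) = 0.
  by rewrite /gam rmorphD/=; ring.
by rewrite modulus0 mulr_ge0// ltW.
Qed.

Let gam_deriv_t theta s : rderiv (gam s) theta (s%:C%C * ('i%C * W theta)).
Proof.
have := @rderiv_comp _ (fun w => (z - s%:C%C * z) + s%:C%C * w) W theta _ _
  (W_deriv theta) (cderiv_affine _ _ _).
rewrite (_ : (fun x => _) = gam s)//; apply/funext => x; rewrite /gam; ring.
Qed.

Let gam_cont s theta : rcontinuous_at (gam s) theta.
Proof. exact: rderiv_continuous (gam_deriv_t _ _). Qed.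

Let W_cont theta : rcontinuous_at W theta.
Proof. exact: rderiv_continuous (W_deriv theta). Qed.

Let c_cont theta : rcontinuous_at c theta.
Proof.
apply: rcontinuousM; first exact: W_cont.
apply: (@rcontinuous_comp (fun w => (w - z)^-1)); last exact: W_cont.
have := @cderiv_comp (fun w => - z + 1 * w) GRing.inv (W theta) _ _ (cderiv_inv _)
  (cderiv_affine _ _ _); rewrite mul1r addrC => /(_ (Wz theta))/cderiv_continuous.
by rewrite (_ : (fun w => _) = (fun w => (w - z)^-1))//; apply/funext => x;
  rewrite mul1r addrC.
Qed.

Let k s theta := complex.Re (f (gam s theta) * c theta).
Let k1 s theta := complex.Re (f1 (gam s theta) * W theta).

Let k_cont s : - eta <= s <= 1 + eta -> continuous (k s).
Proof.
move=> sI; apply: rcontinuous_Re => t; apply: rcontinuousM; last exact: c_cont.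
apply: rcontinuous_comp; last exact: gam_cont.
exact: cderiv_continuous (fd (gam_lt t sI)).1.
Qed.

Let k1_cont s : - eta <= s <= 1 + eta -> continuous (k1 s).
Proof.
move=> sI; apply: rcontinuous_Re => t; apply: rcontinuousM; last exact: W_cont.
apply: rcontinuous_comp; last exact: gam_cont.
exact: (fd (gam_lt t sI)).2.
Qed.

Let k_deriv s theta : - eta <= s <= 1 + eta -> is_derive s 1 (k ^~ theta) (k1 s theta).
Proof.
move=> sI.
have := rderivMr (c theta) (rderiv_comp (gam_deriv_s theta s) (fd (gam_lt theta sI)).1).
move/rderiv_Re; rewrite /k1 /c.
by rewrite -mulrA [(_ - z) * _]mulrC divfK.
Qed.

Let k1_int s : 0 < s < 1 -> circle_int (k1 s) = 0.
Proof.
move=> /andP[s0 s1].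
have sI : - eta <= s <= 1 + eta by move: eta0; lra.
have s0' : s%:C%C != 0 :> C by apply/eqP => /(congr1 (@complex.Re _))/=; lra.
have i0 : 'i%C != 0 :> C.
  by apply/eqP => /(congr1 (@complex.Im _))/=; lra.
(* The theta-derivative of f(gam s t) is f1(gam s t) s i W, so division by s i produces the
   integrand of [k1]. The value s = 0, where this fails, is an endpoint that the mean value theorem
   leaves out. *)
apply: (@circle_int_deriv _ _
    (fun t => complex.Re (f (gam s t) * (s%:C%C * 'i%C)^-1))) => [t||].
- have := rderivMr (s%:C%C * 'i%C)^-1 (rderiv_comp (gam_deriv_t t s) (fd (gam_lt t sI)).1).
  move/rderiv_Re; rewrite /k1.
  rewrite (_ : f1 (gam s t) * (s%:C%C * ('i%C * W t)) / (s%:C%C * 'i%C)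
    = f1 (gam s t) * W t)//.
  by field; rewrite s0' i0.
- exact: k1_cont.
- have p2 : cos (2 * pi) = 1 :> R by rewrite mulr_natl cos2pi.
  have q2 : sin (2 * pi) = 0 :> R by rewrite mulr_natl sin2pi.
  by rewrite /gam /W /circle_point p2 q2 cos0 sin0.
Qed.

(** Compactness of the parameter rectangle yields the constant majorant required for differentiation
    under the integral sign. *)
Let k1_bound : exists B : R, 0 <= B /\ forall s theta, - eta <= s <= 1 + eta ->
  0 <= theta <= 2 * pi -> `|k1 s theta| <= B.
Proof.
pose A : set (R * R) := `[- eta, 1 + eta]%classic `*` `[0, 2 * pi]%classic.
have cA : compact A by apply: compact_setX; exact: segment_compact.
have A0 : A !=set0.
  exists (0, 0); split => /=; rewrite in_itv/=; last by rewrite lexx ltW// two_pi_gt0.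
  by apply/andP; split; move: eta0; lra.
pose phi (p : R * R) := modulus (f1 (gam p.1 p.2)).
have cphi : {within A, continuous phi}.
  apply: continuous_in_subspaceT => -[s t] /set_mem[/= sI tI].
  move: sI; rewrite in_itv/= => sI.
  apply/cvgrPdist_lt => e e0.
  have [d1 [d10 h1]] := (fd (gam_lt t sI)).2 _ e0.
  pose K := 2 * (1 + `|s|); have K0 : 0 < K by rewrite mulr_gt0// ltr_pwDl.
  have [d2 [d20 h2]] := W_cont t (divr_gt0 d10 K0).
  (* |W - z| is at most 2 rho, so |s' - s| < d1 / L moves gam by less than d1/2; K plays the same
     role for the move in theta. *)
  pose L := 4 * rho; have L0 : 0 < L by rewrite mulr_gt0.
  exists ([set s' | `|s - s'| < d1 / L], [set t' | `|t - t'| < d2]) => /=.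
    by split; [exists (d1 / L) => //=; rewrite divr_gt0|exists d2].
  move=> [s' t'] /= [ss tt]; rewrite /phi/=.
  have gg : modulus (gam s' t' - gam s t) < d1.
    have -> : gam s' t' - gam s t =
        (s' - s)%:C%C * (W t' - z) + s%:C%C * (W t' - W t).
      by rewrite /gam rmorphB/=; ring.
    rewrite (le_lt_trans (modulusD _ _))// !modulusM !modulus_real.
    rewrite (splitr d1) ltr_leD//.
      apply: (@le_lt_trans _ _ (`|s' - s| * (2 * rho))).
        rewrite ler_wpM2l// (le_trans (modulusB _ _))// modulus_circle_point.
        by rewrite (gtr0_norm rho0); move: zrho; lra.
      by move: ss; rewrite distrC ltr_pdivlMr// /L; lra.
    have := h2 (t' - t); rewrite distrC => /(_ tt); rewrite (addrC t) subrK.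
    rewrite ltr_pdivlMr// /K => h3.
    have : 0 <= modulus (W t' - W t) by [].
    move: (modulus _) h3 => m h3 m0; have := normr_ge0 s; nra.
  have := h1 _ gg; rewrite (addrC (gam s t)) subrK => h3.
  rewrite distrC; apply: le_lt_trans h3.
  rewrite ler_norml; apply/andP; split.
    by rewrite lerNl opprB lerBlDr modulusBC (le_trans _ (modulusD _ _))// subrK.
  by rewrite lerBlDr (le_trans _ (modulusD _ _))// subrK.
have [p pA pmax] := compact_EVT_max A0 cA cphi.
exists (phi p * rho); split; first by apply: mulr_ge0; [exact: modulus_ge0|exact: ltW].
move=> s t sI tI; rewrite (le_trans (normr_Re_le _))// modulusM.
rewrite modulus_circle_point (gtr0_norm rho0) ler_wpM2r ?(ltW rho0)//.
by apply: (pmax (s, t)); rewrite inE; split; rewrite /= in_itv.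
Qed.

(* The derivative in the homotopy parameter is the derivative along the circle
   of a periodic function, so its integral vanishes. *)
Lemma circle_int_homotopy :
  circle_int (fun t => complex.Re (f (W t) * (W t / (W t - z)))) =
  circle_int (fun t => complex.Re (f z * (W t / (W t - z)))).
Proof.
have -> : (fun t => complex.Re (f (W t) * (W t / (W t - z)))) = k 1.
  by apply/funext => t; rewrite /k /gam rmorph1 mul1r subrKC.
have -> : (fun t => complex.Re (f z * (W t / (W t - z)))) = k 0.
  by apply/funext => t; rewrite /k /gam rmorph0 mul0r addr0.
have [B [B0 kB]] := k1_bound.
have kd s t : - eta < s < 1 + eta -> is_derive s 1 (k ^~ t) (k1 s t).
  by move=> /andP[s1 s2]; apply: k_deriv; rewrite !ltW.
have intk s : `]- eta, 1 + eta[%classic s ->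
    mu.-integrable `[0, 2 * pi]%classic (EFin \o k s).
  rewrite /= in_itv/= => /andP[s1 s2]; apply: continuous_integrable_circle.
  by apply: k_cont; rewrite !ltW.
have k1E s t : - eta < s < 1 + eta -> partial1of2 k s t = k1 s t.
  by move=> sI; have := kd s t sI => ?; rewrite partial1of2E; exact: derive_val.
have derk s t : `]- eta, 1 + eta[%classic s -> `[0, 2 * pi]%classic t ->
    derivable (k ^~ t) s 1.
  by rewrite /= !in_itv/= => sI _; have [] := kd s t sI.
have ubk s t : `]- eta, 1 + eta[%classic s -> `[0, 2 * pi]%classic t ->
    `|partial1of2 k s t| <= (cst B : R -> R) t.
  rewrite /= !in_itv/= => sI tI; rewrite k1E// kB//.
  by case/andP: sI => s1 s2; rewrite !ltW.
have intB : mu.-integrable `[0, 2 * pi]%classic (EFin \o (cst B : R -> R)).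
  by apply: continuous_integrable_circle => x; exact: cvg_cst.
have dF s : - eta < s < 1 + eta -> is_derive s 1 (fun s => circle_int (k s))
    (circle_int (k1 s)).
  move=> sI.
  have sI' : `]- eta, 1 + eta[%classic s by rewrite /= in_itv/=.
  apply: DeriveDef.
    have := derivable_under_integral (mu := mu) (measurable_itv _) sI' intk derk
      (G := cst B) (fun=> B0) intB ubk.
    exact.
  rewrite -derive1E.
  rewrite (differentiation_under_integral (mu := mu) (measurable_itv _) sI' intk derk
      (G := cst B) (fun=> B0) intB ubk).
  by apply: eq_Rintegral => t _; rewrite k1E.
have I01 s : 0 <= s <= 1 -> - eta < s < 1 + eta by move: eta0; lra.
have [] := @MVT R (fun s => circle_int (k s)) (fun s => circle_int (k1 s)) 0 1 ltr01.
- move=> s; rewrite in_itv/= => /andP[s1 s2]; apply: dF; apply: I01.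
  by rewrite !ltW.
- apply: continuous_in_subspaceT => s; rewrite inE/= in_itv/= => /I01/dF.
  exact: (@is_derive_continuous _ _ (fun s => circle_int (k1 s))).
- move=> s; rewrite in_itv/= => s01; rewrite k1_int// mul0r => /eqP.
  by rewrite subr_eq0 => /eqP.
Qed.

End Homotopy.
End CauchyFormula.

(** * The Cauchy kernel *)

Section CauchyBound.
Context {R : realType}.
Local Notation C := R[i].
Implicit Types (f g : C -> C) (z w h d : C).

Lemma cderiv_sqr z : cderiv (fun w => w * w) z (2 * z).
Proof.
move=> e e0; exists e; split=> // h he.
have -> : (z + h) * (z + h) - z * z - h * (2 * z) = h * h by ring.
by rewrite modulusM ler_wpM2r// ltW.
Qed.

Lemma modulus_conjc z : modulus (z^*)%C = modulus z.
Proof. by case: z => a b; rewrite !modulusE /= sqrrN. Qed.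

Lemma Re_conjc z : complex.Re (z^*)%C = complex.Re z.
Proof. by case: z. Qed.

Lemma mul_conjc z : z * (z^*)%C = ((modulus z) ^+ 2)%:C%C.
Proof. by rewrite modulus_sqr; case: z => a b; simpc; congr Complex; ring. Qed.

Lemma circle_point_neq (rho theta : R) z : modulus z < rho ->
  circle_point rho theta - z != 0.
Proof.
move=> zr; rewrite subr_eq0; apply/eqP => Wz; move: zr.
by rewrite -Wz modulus_circle_point ltNge ler_norm.
Qed.

Lemma inv_kernel (w q zc : C) : w != 0 -> q != 0 -> 1 + - (zc / q) * w != 0 ->
  (1 + - (zc / q) * w)^-1 = q / w / (q / w - zc).
Proof.
move=> w0 q0 dn.
have -> : q / w - zc = q / w * (1 + - (zc / q) * w) by field; rewrite w0 q0.
by rewrite invfM mulrA divff ?mul1r// mulf_neq0// invr_neq0.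
Qed.

(** On the circle the conjugate of W / (W - z) is 1 / (1 - a W) with a = conj z / rho^2, because
    conj W = rho^2 / W. This is analytic on a larger disc, so [circle_int_homotopy] at the centre 0,
    where the kernel is 1, evaluates its mean. *)
Lemma circle_kernel_int (rho : R) z (c : C) : modulus z < rho ->
  circle_int (fun t => complex.Re (c * (circle_point rho t / (circle_point rho t - z))))
  = 2 * pi * complex.Re c.
Proof.
move=> zr; have rho0 : 0 < rho by rewrite (le_lt_trans _ zr).
pose a : C := (z^*)%C / (rho ^+ 2)%:C%C.
(* Strictly between rho and rho^2 / |z|, the modulus of the pole of G, and still meaningful when z =
   0. *)
pose r0 := 2 * rho ^+ 2 / (rho + modulus z).
have mz := modulus_ge0 z.
have s0 : 0 < rho + modulus z by rewrite ltr_wpDr.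
have rr0 : rho < r0 by rewrite /r0 ltr_pdivlMr//; nra.
have ma : modulus a = modulus z / rho ^+ 2.
  by rewrite modulusM modulusV modulus_conjc modulus_real ger0_norm// exprn_ge0// ltW.
have ar w : modulus w < r0 -> modulus (a * w) < 1.
  move=> wr; rewrite modulusM ma mulrAC ltr_pdivrMr ?exprn_gt0// mul1r.
  apply: (@le_lt_trans _ _ (modulus z * r0)); first by rewrite ler_wpM2l// ltW.
  rewrite /r0 mulrA ltr_pdivrMr//.
  have : 0 < rho ^+ 2 * (rho - modulus z) by rewrite mulr_gt0 ?exprn_gt0// subr_gt0.
  by lra.
have aw w : modulus w < r0 -> 1 - a * w != 0.
  move=> /ar aw1; rewrite subr_eq0; apply/eqP => E.
  by move: aw1; rewrite -E modulus1 ltxx.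
pose G w := (1 + - a * w)^-1.
pose f w := 0 + (c^*)%C * G w.
pose f1 w := (c^*)%C * (- ((1 + - a * w) ^+ 2)^-1 * - a).
have Gd w : modulus w < r0 -> cderiv G w (- ((1 + - a * w) ^+ 2)^-1 * - a).
  move=> wr; apply: (cderiv_comp (f := fun w => 1 + - a * w) (g := GRing.inv)).
    by apply: cderiv_inv; rewrite mulNr aw.
  exact: cderiv_affine.
have fd w : modulus w < r0 -> cderiv f w (f1 w) /\ ccontinuous_at f1 w.
  move=> wr; split.
    apply: (cderiv_comp (f := G) (g := fun w => 0 + (c^*)%C * w)); last exact: Gd.
    exact: cderiv_affine.
  have := cderiv_comp (g := fun w => 0 + (c^*)%C * a * w)
    (@cderiv_affine _ _ _ _)
    (cderiv_comp (g := fun w => w * w) (@cderiv_sqr _) (Gd _ wr)).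
  move/cderiv_continuous; rewrite (_ : (fun w => _) = f1)//.
  by apply/funext => v; rewrite /f1 /G add0r -invfM expr2; ring.
have z0 : modulus (0 : C) < rho by rewrite modulus0.
have := circle_int_homotopy rho0 rr0 z0 fd.
have W0 t : circle_point rho t != 0 by have := circle_point_neq t z0; rewrite subr0.
rewrite (eq_circle_int (k := fun t =>
  complex.Re (c * (circle_point rho t / (circle_point rho t - z))))); last first.
  move=> t; rewrite subr0 divff// mulr1.
  rewrite -[RHS]Re_conjc; congr complex.Re; rewrite /f /G add0r rmorphM/=; congr (_ * _).
  have Wc : (circle_point rho t)^*%C = (rho ^+ 2)%:C%C / circle_point rho t.
    apply: (mulfI (W0 t)); rewrite mul_conjc mulrCA divff// mulr1.
    by rewrite modulus_circle_point gtr0_norm.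
  have rho2 : (rho ^+ 2)%:C%C != 0 :> C.
    by apply/eqP => /(congr1 (@complex.Re _))/= /eqP; rewrite gt_eqF// exprn_gt0.
  have dn : 1 + - a * circle_point rho t != 0.
    by rewrite mulNr aw// modulus_circle_point gtr0_norm.
  have := inv_kernel (W0 t) rho2 dn; rewrite -Wc => ->.
  by rewrite fmorph_div rmorphB.
rewrite (eq_circle_int (h := fun t => complex.Re (f 0 * _)) (k := fun=> complex.Re c)); last first.
  move=> t; rewrite subr0 divff// mulr1 /f /G mulr0 addr0 invr1 mulr1 add0r.
  exact: Re_conjc.
by rewrite circle_int_cst mulrC.
Qed.

Lemma rcontinuous_circle (f f1 : C -> C) (rho r0 t : R) : 0 < rho < r0 ->
  (forall w, modulus w < r0 -> cderiv f w (f1 w)) ->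
  rcontinuous_at (fun t => f (circle_point rho t)) t.
Proof.
move=> /andP[rho0 rr0] fd; apply: rcontinuous_comp.
  apply: cderiv_continuous; apply: fd.
  by rewrite modulus_circle_point gtr0_norm.
exact: rderiv_continuous (@rderiv_circle _ _ _).
Qed.

(** [circle_int_homotopy] speaks of real parts only. Applied to g = conj(f z) f, whose value at z is
    the real number |f z|^2, it loses nothing; one factor |f z| is cancelled at the end. *)
Lemma cauchy_bound (f f1 : C -> C) (rho r0 : R) z : 0 < rho < r0 -> modulus z < rho ->
  (forall w, modulus w < r0 -> cderiv f w (f1 w) /\ ccontinuous_at f1 w) ->
  2 * pi * modulus (f z) <=
  circle_int (fun t => modulus (f (circle_point rho t)) *
                       (rho / modulus (circle_point rho t - z))).
Proof.
move=> /andP[rho0 rr0] zr fd.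
pose W := circle_point rho.
pose c : C := ((f z)^*)%C.
pose g w := 0 + c * f w.
pose g1 w := c * f1 w.
have gd w : modulus w < r0 -> cderiv g w (g1 w) /\ ccontinuous_at g1 w.
  move=> wr; have [fw f1w] := fd w wr; split.
    exact: (cderiv_comp (g := fun w => 0 + c * w) (@cderiv_affine _ _ _ _) fw).
  move=> e e0; have K0 : 0 < 1 + modulus c by rewrite ltr_pwDl.
  have [dl [dl0 dlP]] := f1w _ (divr_gt0 e0 K0); exists dl; split=> // h /dlP.
  rewrite ltr_pdivlMr// /g1 -mulrBr modulusM; apply: le_lt_trans.
  by rewrite mulrC ler_wpM2l// lerDr.
have := circle_int_homotopy rho0 rr0 zr gd.
rewrite circle_kernel_int//.
have -> : complex.Re (g z) = modulus (f z) ^+ 2.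
  by rewrite /g add0r mulrC mul_conjc.
have [f0|f0 E] := eqVneq (modulus (f z)) 0.
  move=> _; rewrite f0 mulr0; apply: circle_int_ge0 => t.
  by rewrite mulr_ge0// divr_ge0// ltW.
have fz : 0 < modulus (f z) by rewrite lt_def f0/=.
have cW t : rcontinuous_at W t by exact: rderiv_continuous (@rderiv_circle _ _ _).
have cf t : rcontinuous_at (fun t => f (W t)) t.
  by apply: (rcontinuous_circle (f1 := f1) (r0 := r0)); [rewrite rho0|move=> w /fd[]].
have cK t : rcontinuous_at (fun t => W t / (W t - z)) t.
  apply: rcontinuousM; first exact: cW.
  apply: (@rcontinuous_comp _ (fun w => (w - z)^-1)); last exact: cW.
  have Wz := @circle_point_neq rho t _ zr.
  have := @cderiv_comp _ (fun w => - z + 1 * w) GRing.inv (W t) _ _ (cderiv_inv _)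
    (@cderiv_affine _ _ _ _); rewrite mul1r addrC => /(_ Wz)/cderiv_continuous.
  by rewrite (_ : (fun w => _) = (fun w => (w - z)^-1))//; apply/funext => x;
    rewrite mul1r addrC.
have cR : continuous (fun t => complex.Re (g (W t) * (W t / (W t - z)))).
  apply: rcontinuous_Re => t; apply: rcontinuousM => //.
  rewrite (_ : (fun x => g (W x)) = (fun x => c * f (W x))); last first.
    by apply/funext => x; rewrite /g add0r.
  by apply: rcontinuousM => //; exact: rcontinuous_cst.
have cM : continuous (fun t => modulus (f (W t)) * (rho / modulus (W t - z))).
  rewrite (_ : (fun t => _) = (fun t => modulus (f (W t) * (W t / (W t - z))))); last first.
    apply/funext => t; rewrite !modulusM modulusV; congr (_ * (_ / _)).
    by rewrite modulus_circle_point gtr0_norm.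
  by apply: rcontinuous_modulus => t; exact: rcontinuousM.
rewrite -(ler_pM2l fz) -circle_intZ// mulrCA -expr2 -E.
apply: le_circle_int => // [x|t _].
  by apply: cvgMl_tmp; exact: cM.
rewrite (le_trans (ler_norm _))// (le_trans (normr_Re_le _))//.
rewrite !modulusM modulusV modulus_circle_point (gtr0_norm rho0) /g add0r modulusM.
by rewrite /c modulus_conjc -mulrA.
Qed.

(** Jordan's inequality with a weaker constant. With y = x/2 <= pi/4, sin x = 2 sin y cos y and sin
    y = y cos u for some u in [0, y]; both cosines are at least cos(pi/4), whose square is 1/2. *)
Lemma ler_half_sin (x : R) : 0 <= x <= pi / 2 -> x / 2 <= sin x.
Proof.
move=> /andP[x0 xp]; pose y := x / 2.
have pi0 := @pi_gt0 R.
have y0 : 0 <= y by rewrite divr_ge0.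
have yp : y <= pi / 4 by rewrite /y; lra.
pose c := cos (pi / 4 : R).
have c2 : c ^+ 2 = 2^-1.
  have := cos_mulr2n (pi / 4 : R).
  rewrite (_ : pi / 4 *+ 2 = pi / 2); last by rewrite -mulr_natr; field.
  by rewrite cos_pihalf -mulr_natr -/c; lra.
have c0 : 0 <= c by apply: cos_ge0_pihalf; lra.
have cm u : 0 <= u <= pi / 4 -> c <= cos u.
  move=> /andP[u0]; rewrite le_eqVlt => /predU1P[->//|up]; rewrite ltW// /c.
  have uI : u \in `[0, pi] by rewrite in_itv/=; apply/andP; split; lra.
  have pI : pi / 4 \in `[0 : R, pi] by rewrite in_itv/=; apply/andP; split; lra.
  by rewrite ltr_cos.
have [|u uI] := @MVT_segment R sin cos 0 y y0.
  by apply: continuous_subspaceT; exact: continuous_sin.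
rewrite sin0 !subr0 => sy.
have uc : c <= cos u by apply: cm; move: uI; rewrite in_itv/= => /andP[? ?]; lra.
have yc : c <= cos y by apply: cm; rewrite y0.
have -> : x = y *+ 2 by rewrite -mulr_natr /y; field.
rewrite sin_mulr2n sy.
have : c * (c * y) <= cos y * (cos u * y).
  by rewrite ler_pM ?mulr_ge0//; rewrite ler_wpM2r.
rewrite mulrA -expr2 c2 !mulr2n; move: (cos y * _) => S; lra.
Qed.

(** The arc length from 1 to the point of angle t, for t in [0, 2 pi]; both ends of the interval are
    close to 1. *)
Definition cdist (t : R) := Num.min t (2 * pi - t).

Lemma cdist_le_modulus (t : R) : 0 <= t <= 2 * pi ->
  cdist t / 2 <= modulus (circle_point 1 t - 1).
Proof.
move=> /andP[t0 t1]; have pi0 := @pi_gt0 R.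
have sp : 0 <= sin (t / 2) by apply: sin_ge0_pi; lra.
have -> : modulus (circle_point 1 t - 1) = 2 * sin (t / 2).
  rewrite modulusE ReB ImB /= !mul1r subr0.
  have tE : t = (t / 2) *+ 2 by rewrite -mulr_natr; field.
  rewrite {1 2}tE cos_mulr2n sin_mulr2n.
  rewrite (_ : _ + _ = (2 * sin (t / 2)) ^+ 2); last first.
    have := cos2Dsin2 (t / 2); move: (cos _) (sin _) => a b ab.
    have -> : a ^+ 2 = 1 - b ^+ 2 by rewrite -ab addrK.
    have -> : (a * b *+ 2) ^+ 2 = 4 * a ^+ 2 * b ^+ 2 by ring.
    have -> : a ^+ 2 = 1 - b ^+ 2 by rewrite -ab addrK.
    by ring.
  by rewrite sqrtr_sqr ger0_norm// mulr_ge0.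
rewrite /cdist; have [tp|pt] := leP t pi.
  apply: (@le_trans _ _ (t / 2)); first by rewrite ler_wpM2r// ge_min lexx.
  by have := @ler_half_sin (t / 2); lra.
apply: (@le_trans _ _ ((2 * pi - t) / 2)); first by rewrite ler_wpM2r// ge_min lexx orbT.
have -> : sin (t / 2) = sin (pi - t / 2) by rewrite sinB sinpi cospi; ring.
by have := @ler_half_sin (pi - t / 2); lra.
Qed.

(** The second bound follows from the first: |w - 1| <= |w - x| + (1 - x) <= 2 |w - x| for w on the
    unit circle. *)
Lemma circle_dist_lower (x t : R) : 0 <= x <= 1 -> 0 <= t <= 2 * pi ->
  1 - x <= modulus (circle_point 1 t - x%:C%C) /\
  cdist t / 4 <= modulus (circle_point 1 t - x%:C%C).
Proof.
move=> /andP[x0 x1] tI.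
have m1 : 1 - x <= modulus (circle_point 1 t - x%:C%C).
  rewrite lerBlDr -[leLHS](_ : modulus (circle_point 1 t) = 1); last first.
    by rewrite modulus_circle_point normr1.
  rewrite -[X in _ + X](_ : modulus x%:C%C = x); last by rewrite modulus_real ger0_norm.
  by rewrite (le_trans _ (modulusD _ _))// subrK.
split=> //; have := cdist_le_modulus tI.
have := modulusD (circle_point 1 t - x%:C%C) (x%:C%C - 1).
rewrite addrA subrK -(rmorph1 (real_complex R)) -rmorphB modulus_real distrC.
rewrite ger0_norm ?subr_ge0// rmorph1; lra.
Qed.

End CauchyBound.

(** * Convexity inequalities and lacunary sums *)

Section RealEstimates.
Context {R : realType}.
Local Notation mu := (@lebesgue_measure R).

Lemma continuous_on_measurable (D : set R) (h : R -> R) : measurable D ->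
  (forall x, D x -> {for x, continuous h}) -> measurable_fun D h.
Proof.
move=> mD ch; apply: subspace_continuous_measurable_fun => //.
by apply: continuous_in_subspaceT => x /set_mem; exact: ch.
Qed.

(** For integrands that may blow up at the ends, such as (1 - t)^(e - 1). F need not extend to a or
    b: only its increments inside the interval are bounded, and closed subintervals exhaust the open
    one. *)
Lemma ge0_integral_le_antideriv (a b M : R) (h F : R -> R) : a < b ->
  (forall x : R, a < x < b -> is_derive x 1 F (h x)) ->
  (forall x, a < x < b -> 0 <= h x) ->
  (forall x, a < x < b -> {for x, continuous h}) ->
  (forall x y, a < x -> x <= y -> y < b -> F y - F x <= M) ->
  (\int[mu]_(x in `]a, b[) (h x)%:E <= M%:E)%E.
Proof.
move=> ab dF h0 ch FM.
(* The denominator i + 2 keeps c i <= (b - a)/2, so that no subinterval is reversed. *)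
pose c (i : nat) := (b - a) / i.+2%:R.
have c0 i : 0 < c i by rewrite divr_gt0// subr_gt0.
have c2 i : c i <= (b - a) / 2.
  by rewrite /c ler_wpM2l ?subr_ge0 ?(ltW ab)// lef_pV2 ?posrE// ler_nat.
have cm i j : (i <= j)%N -> c j <= c i.
  by move=> ij; rewrite /c ler_wpM2l ?subr_ge0 ?(ltW ab)// lef_pV2 ?posrE// ler_nat.
pose E i : set R := `[a + c i, b - c i]%classic.
have Eab i x : E i x -> a < x < b.
  by rewrite /E/= in_itv/= => /andP[h1 h2]; have := c0 i; lra.
have mE i : measurable (E i) by exact: measurable_itv.
have -> : `]a, b[%classic = \bigcup_i E i.
  apply/seteqP; split => [x /=|x [i _] /Eab]; last by rewrite /= in_itv.
  rewrite in_itv/= => /andP[ax xb].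
  pose m := Num.min (x - a) (b - x).
  have m0 : 0 < m by rewrite lt_min !subr_gt0 ax.
  have [i ih] : exists i, c i < m.
    exists (Num.bound ((b - a) / m)); rewrite /c ltr_pdivrMr//.
    have : (b - a) / m < (Num.bound ((b - a) / m))%:R.
      by rewrite archi_boundP// divr_ge0 ?(ltW m0)// subr_ge0 ltW.
    rewrite ltr_pdivrMr// mulrC => H; rewrite (lt_trans H)// ltr_pM2l// ltr_nat.
    by rewrite ltnS leqnSn.
  exists i => //; rewrite /E/= in_itv/=; move: ih; rewrite lt_min; lra.
have nE : nondecreasing_seq E.
  move=> i j ij; apply/subsetPset => x; rewrite /E/= !in_itv/=.
  by have := cm _ _ ij; lra.
have mh i : measurable_fun (E i) (EFin \o h).
  apply/measurable_EFinP; apply: continuous_on_measurable => // x /Eab; exact: ch.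
have hE0 i x : E i x -> (0 <= (EFin \o h) x)%E.
  by move=> /Eab; rewrite lee_fin; exact: h0.
have cv := ge0_nondecreasing_set_cvg_integral nE mE mh hE0 (mu := mu).
rewrite -(cvg_lim (@ereal_hausdorff R) cv).
apply: lime_le; first by apply/cvg_ex; eexists; exact: cv.
apply: nearW => i; rewrite /E.
have [ai aib] : a + c i <= b - c i /\ a < a + c i by have := c0 i; have := c2 i; lra.
have bib : b - c i < b by have := c0 i; lra.
move: ai; rewrite le_eqVlt => /predU1P[->|ai].
  by rewrite set_itv1 integral_set1 lee_fin -[0](subrr (F (b - c i))) FM//; have := c0 i;
    have := c2 i; lra.
have Eab' x : a + c i <= x <= b - c i -> a < x < b by move: aib bib; lra.
rewrite (continuous_FTC2 ai (F := F)).
- by rewrite -EFinB lee_fin; apply: FM => //; exact: ltW.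
- by apply: continuous_in_subspaceT => x /set_mem/= /Eab; exact: ch.
- have cF x : a < x < b -> {for x, continuous F}.
    move=> xab; have [dx _] := dF x xab.
    exact/differentiable_continuous/derivable1_diffP.
  split.
  + move=> x; rewrite in_itv/= => /andP[h1 h2].
    have xab : a < x < b by apply: Eab'; rewrite (ltW h1) (ltW h2).
    by have [] := dF x xab.
  + by apply/cvg_at_right_filter/cF/Eab'; rewrite lexx ltW.
  + by apply/cvg_at_left_filter/cF/Eab'; rewrite lexx ltW.
- move=> x; rewrite in_itv/= => /andP[h1 h2].
  have xab : a < x < b by apply: Eab'; rewrite (ltW h1) (ltW h2).
  by have [_ <-] := dF x xab; rewrite derive1E.
Qed.

Lemma powRN_inv (a e : R) : 0 < a -> a `^ (- e) * a `^ e = 1.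
Proof. by move=> a0; have an0 := lt0r_neq0 a0; rewrite -powRD ?an0 ?implybT// addNr powRr0. Qed.

Lemma powRDp (a r s : R) : 0 < a -> a `^ (r + s) = a `^ r * a `^ s.
Proof. by move=> a0; rewrite powRD// lt0r_neq0 ?implybT. Qed.

(** Young's inequality for the product of x and 1, with exponents s and s / (s - 1), rearranged. *)
Lemma bernoulli_powR (x s : R) : 0 <= x -> 1 <= s -> 1 + s * (x - 1) <= x `^ s.
Proof.
move=> x0; rewrite le_eqVlt => /predU1P[<-|s1].
  by rewrite powRr1// mul1r; lra.
have s0 : 0 < s by lra.
have q0 : 0 < s / (s - 1) by rewrite divr_gt0//; lra.
have := conjugate_powR x0 ler01 s0 q0; rewrite powR1 mulr1 => H.
have {H} : x <= x `^ s / s + (s - 1) / s.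
  have {}H := H ltac:(by field; rewrite ?gt_eqF//; lra).
  by rewrite (le_trans H)// lerD2l// mul1r invf_div.
rewrite -(ler_pM2l s0) mulrDr !(mulrCA s) divff ?gt_eqF//; lra.
Qed.

(** Jensen's inequality with unnormalised weights. The tangent of y^s at the weighted mean c = S/W
    is summed against w; its linear part cancels by the choice of c. *)
Lemma powR_jensen (I : Type) (r : seq I) (y w : I -> R) (s : R) : 1 <= s ->
  (forall i, 0 <= y i) -> (forall i, 0 <= w i) ->
  (\sum_(i <- r) y i * w i) `^ s <=
  (\sum_(i <- r) y i `^ s * w i) * (\sum_(i <- r) w i) `^ (s - 1).
Proof.
move=> s1 y0 w0; set S := \sum_(i <- r) y i * w i; set W := \sum_(i <- r) w i.
have s0 : 0 < s by lra.
have S0 : 0 <= S by apply: sumr_ge0 => i _; exact: mulr_ge0.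
have W0 : 0 <= W by apply: sumr_ge0.
have T0 : 0 <= \sum_(i <- r) y i `^ s * w i.
  by apply: sumr_ge0 => i _; rewrite mulr_ge0// powR_ge0.
have [->|Sn0] := eqVneq S 0; first by rewrite powR0 ?gt_eqF// mulr_ge0// powR_ge0.
have Sp : 0 < S by rewrite lt_def Sn0.
have Wp : 0 < W.
  rewrite lt_def W0 andbT; apply: contra_neq Sn0 => WE.
  have : (\sum_(i <- r) w i) = 0 by [].
  rewrite /S; elim: (r) => [|i t ih]; first by rewrite !big_nil.
  rewrite !big_cons => /eqP; rewrite paddr_eq0//; last by apply: sumr_ge0.
  by move=> /andP[/eqP -> /eqP/ih ->]; rewrite mulr0 addr0.
pose c := S / W; have c0 : 0 < c by rewrite divr_gt0.
have yc i : c `^ s + s * c `^ (s - 1) * (y i - c) <= y i `^ s.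
  have := @bernoulli_powR (y i / c) s (divr_ge0 (y0 i) (ltW c0)) s1.
  have -> : y i `^ s = c `^ s * (y i / c) `^ s.
    by rewrite -powRM ?(ltW c0)// ?divr_ge0 ?(ltW c0)// mulrC divfK// gt_eqF.
  move=> H; apply: le_trans (ler_wpM2l (powR_ge0 _ _) H).
  rewrite -(mulr_powRB1 (ltW c0) s0).
  by rewrite le_eqVlt; apply/orP; left; apply/eqP; field; rewrite gt_eqF.
have : \sum_(i <- r) (c `^ s + s * c `^ (s - 1) * (y i - c)) * w i <=
    \sum_(i <- r) y i `^ s * w i.
  by apply: ler_sum => i _; rewrite ler_wpM2r.
have -> : \sum_(i <- r) (c `^ s + s * c `^ (s - 1) * (y i - c)) * w i =
    c `^ s * W + s * c `^ (s - 1) * (S - c * W).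
  rewrite /W /S !mulr_sumr -sumrB mulr_sumr -big_split/=.
  by apply: eq_bigr => i _; ring.
rewrite {2}/c divfK ?gt_eqF// subrr mulr0 addr0 => cT.
apply: le_trans (ler_wpM2r (powR_ge0 _ _) cT).
rewrite -mulrA mulr_powRB1// ?(ltW Wp)// -powRM ?(ltW c0)//.
by rewrite /c divfK// gt_eqF.
Qed.

(** Hoelder's inequality as Jensen's with weights b^p and values A^2 b^(2-p). Raising the values to
    the power q/2 and multiplying by b^p leaves A^q b^((2-p) q/2 + p), and the exponent of b is 0
    because q p = 2 p + 2 q. Indices with b = 0 contribute nothing on the left. *)
Lemma powR_hoelder_sum (I : Type) (r : seq I) (A b : I -> R) (p q : R) : 2 < p ->
  q^-1 = 2^-1 - p^-1 -> (forall i, 0 <= A i) -> (forall i, 0 <= b i) ->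
  (\sum_(i <- r) A i ^+ 2 * b i ^+ 2) `^ (q / 2) <=
  (\sum_(i <- r) A i `^ q) * (\sum_(i <- r) b i `^ p) `^ (q / 2 - 1).
Proof.
move=> p2 pq A0 b0.
have p0 : 0 < p by lra.
have q0 : 0 < q.
  rewrite -invr_gt0 pq subr_gt0 ltf_pV2 ?posrE//.
have q2 : 2 < q.
  by rewrite -(ltf_pV2 (_ : q \in Num.pos)) ?posrE// pq ltrBlDr ltrDl invr_gt0.
have qE : q * p = 2 * p + 2 * q.
  have : q * p * (2 * q^-1) = q * p * (2 * (2^-1 - p^-1)) by rewrite pq.
  rewrite (_ : q * p * (2 * q^-1) = 2 * p); last by field; rewrite gt_eqF.
  rewrite (_ : q * p * (2 * (2^-1 - p^-1)) = q * p - 2 * q); last by field; rewrite gt_eqF.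
  by move=> ->; ring.
pose y i := A i ^+ 2 * b i `^ (2 - p).
pose w i := b i `^ p.
have yw i : A i ^+ 2 * b i ^+ 2 = y i * w i.
  rewrite /y /w; have [->|bi] := eqVneq (b i) 0.
    by rewrite [0 `^ p]powR0 ?gt_eqF// expr0n/= !mulr0.
  by rewrite -mulrA -powRD ?bi ?implybT// subrK powR_mulrn.
under eq_bigr do rewrite yw.
apply: le_trans (@powR_jensen _ r y w (q / 2) _ _ _) _.
- by rewrite ler_pdivlMr// mul1r ltW.
- by move=> i; rewrite mulr_ge0 ?sqr_ge0// powR_ge0.
- by move=> i; exact: powR_ge0.
rewrite ler_wpM2r ?powR_ge0//; apply: ler_sum => i _.
rewrite /y /w powRM ?sqr_ge0 ?powR_ge0// -[A i ^+ 2]powR_mulrn// -!powRrM.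
rewrite mulrCA divff ?mulr1// -mulrA ler_piMr ?powR_ge0//.
have [->|bi] := eqVneq (b i) 0.
  by rewrite [X in _ * X]powR0 ?gt_eqF// mulr0.
rewrite -powRD ?bi ?implybT// (_ : _ + p = 0) ?powRr0//.
rewrite (_ : _ + _ = (2 * p + 2 * q - q * p) / 2); last by field.
by rewrite qE subrr mul0r.
Qed.

(* A smooth substitute for min(y, 1/y), y = (N x)^dl: omega N x dl / x has the
   antiderivative - 1 / (dl (1 + y)), and sums over lacunary N telescope. *)
Definition omega (N x dl : R) := (N * x) `^ dl / (1 + (N * x) `^ dl) ^+ 2.

Lemma omega_ge0 N x dl : 0 <= omega N x dl.
Proof. by rewrite divr_ge0 ?powR_ge0// exprn_ge0// addr_ge0// powR_ge0. Qed.

Lemma omega_le1 N x dl : omega N x dl <= 1.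
Proof.
rewrite /omega; set y := _ `^ _; have y0 : 0 <= y by exact: powR_ge0.
rewrite ler_pdivrMr ?exprn_gt0 ?ltr_pwDl// mul1r; nra.
Qed.

Lemma omega_sum (lam dl : R) (x : nat -> R) J : 1 < lam -> 0 < dl ->
  (forall j, 0 < x j) -> (forall j, lam * x j <= x j.+1) ->
  \sum_(0 <= j < J) omega (x j) 1 dl <= lam `^ dl / (lam `^ dl - 1).
Proof.
move=> lam1 dl0 x0 xl; set m := lam `^ dl.
have lam0 : 0 < lam by lra.
have m1 : 1 < m.
  by have := @gt0_ltr_powR R dl dl0 1 lam; rewrite powR1 !nnegrE; apply => //; lra.
pose y j := x j `^ dl.
have y0 j : 0 < y j by exact: powR_gt0.
have yl j : m * y j <= y j.+1.
  rewrite /m /y -powRM ?(ltW lam0) ?(ltW (x0 j))//.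
  by apply: ge0_ler_powR; rewrite ?nnegrE ?mulr_ge0 ?(ltW dl0) ?(ltW lam0) ?(ltW (x0 _)).
pose Psi (u : R) := 1 - (1 + u)^-1.
have Psi_mono u v : 0 <= u -> u <= v -> Psi u <= Psi v.
  move=> u0 uv; rewrite lerD2l lerN2 lef_pV2 ?posrE ?lerD2l//; lra.
(* Psi(m u) - Psi(u) = (m - 1) u / ((1 + u)(1 + m u)), and 1 + m u <= m (1 + u). Lacunarity enters
   as y_(j+1) >= m y_j, with Psi increasing. *)
have step j : omega (x j) 1 dl <= m / (m - 1) * (Psi (y j.+1) - Psi (y j)).
  have om : omega (x j) 1 dl = y j / (1 + y j) ^+ 2 by rewrite /omega mulr1.
  have d1 : 0 < 1 + y j by rewrite addr_gt0.
  have my : 0 < m * y j by rewrite mulr_gt0//; lra.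
  have d2 : 0 < 1 + m * y j by rewrite addr_gt0.
  apply: (@le_trans _ _ (m / (m - 1) * (Psi (m * y j) - Psi (y j)))); last first.
    by rewrite ler_wpM2l ?divr_ge0 ?lerD2r ?Psi_mono//; try lra; exact: ltW.
  rewrite om (_ : m / (m - 1) * _ = m * y j / ((1 + y j) * (1 + m * y j))); last first.
    by rewrite /Psi; field; rewrite ?gt_eqF// subr_gt0.
  rewrite ler_pdivrMr ?exprn_gt0// mulrAC ler_pdivlMr ?mulr_gt0//.
  have := y0 j; move: (y j) d1 d2 => u d1 d2 u0; nra.
apply: (@le_trans _ _ (\sum_(0 <= j < J) m / (m - 1) * (Psi (y j.+1) - Psi (y j)))).
  by apply: ler_sum => j _.
rewrite -mulr_sumr telescope_sumr// ler_piMr ?divr_ge0//; try lra.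
have : Psi (y J) <= 1 by rewrite /Psi lerBlDr lerDl invr_ge0 addr_ge0// ltW.
have : 0 <= Psi (y 0%N).
  by rewrite /Psi subr_ge0 invf_le1 ?lerDl ?ltW// addr_gt0.
lra.
Qed.

(** Lacunarity gives n_(K+1) <= c (n_(K+1) - n_K), and r^(n_(K+1) - 1) is the least power of r with
    exponent in [n_K, n_(K+1)). Each term is therefore charged to its own block of the geometric
    series. *)
Lemma lacunary_geom_sum (lam : R) (n : nat -> nat) (r : R) J : 1 < lam ->
  (forall j, lam * (n j)%:R <= (n j.+1)%:R) -> (0 < n 0)%N -> 0 <= r < 1 ->
  \sum_(0 <= j < J) (n j)%:R * r ^+ (n j).-1 <= lam / (lam - 1) / (1 - r).
Proof.
move=> lam1 nl n0 /andP[r0 r1]; set c := lam / (lam - 1).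
have c1 : 1 <= c by rewrite /c ler_pdivlMr ?mul1r; lra.
have r1' : 0 < 1 - r by lra.
have mono j : (n j <= n j.+1)%N.
  rewrite -(ler_nat R) (le_trans _ (nl j))// ler_peMl//; lra.
have block a b : (a <= b)%N -> (b - a)%N%:R * r ^+ b.-1 <= \sum_(a <= k < b) r ^+ k.
  move=> ab; rewrite mulr_natl -sumr_const_nat; apply: ler_sum_nat => k /andP[_ kb].
  by apply: ler_wiXn2l => //; [exact: ltW|rewrite -ltnS prednK// (leq_ltn_trans _ kb)].
have key K : \sum_(0 <= j < K.+1) (n j)%:R * r ^+ (n j).-1 <=
    c * \sum_(0 <= k < n K) r ^+ k.
  elim: K => [|K ih].
    rewrite big_nat1 (le_trans (_ : _ <= \sum_(0 <= k < n 0%N) r ^+ k))//.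
      by have := block 0%N (n 0%N) isT; rewrite subn0.
    by rewrite ler_peMl// sumr_ge0// => k _; rewrite exprn_ge0.
  rewrite big_nat_recr//= (@big_cat_nat _ _ _ (n K) 0%N (n K.+1))//= mulrDr lerD//.
  apply: (@le_trans _ _ (c * ((n K.+1 - n K)%N%:R * r ^+ (n K.+1).-1))); last first.
    by rewrite ler_wpM2l ?block//; lra.
  rewrite mulrA ler_wpM2r ?exprn_ge0// natrB// /c mulrAC ler_pdivlMr; last lra.
  by have := nl K; lra.
case: J => [|J].
  by rewrite big_nil divr_ge0 ?(ltW r1')//; lra.
apply: le_trans (key J) _; rewrite ler_wpM2l//; first lra.
by apply: sum_expr_le; rewrite r0.
Qed.

End RealEstimates.

(** * Kernel estimates *)

Section KernelEstimates.
Context {R : realType}.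
Local Notation mu := (@lebesgue_measure R).

Lemma is_derive_comp1 (u F : R -> R) (x du dF : R) :
  is_derive x 1 u du -> is_derive (u x) 1 F dF ->
  is_derive x 1 (fun y => F (u y)) (dF * du).
Proof.
move=> Hu HF; have := is_derive1_comp HF Hu.
by rewrite (_ : F \o u = fun y => F (u y)).
Qed.

Lemma is_derive_reflect (c t : R) : is_derive t 1 (fun y : R => c - y) (-1).
Proof.
by have := is_deriveB (is_derive_cst c t (1 : R)) (is_derive_id t (1 : R)); rewrite sub0r.
Qed.

Lemma is_derive_expr (n : nat) (t : R) :
  is_derive t 1 (fun y : R => y ^+ n) (n%:R * t ^+ n.-1).
Proof.
have := is_deriveX n (is_derive_id t (1 : R)).
rewrite (_ : id ^+ n = fun y : R => y ^+ n); last by apply/funext => y; rewrite exprfctE.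
by rewrite /GRing.scale/= mulr1.
Qed.

Lemma is_derive_powR_scale (N dl x : R) : 0 < N -> 0 < x ->
  is_derive x 1 (fun y => (N * y) `^ dl) (dl * (N * x) `^ (dl - 1) * N).
Proof.
move=> N0 x0; have Nx : 0 < N * x by rewrite mulr_gt0.
have Hu : is_derive x 1 (fun y : R => N * y) N.
  by apply: is_derive_eq; rewrite /GRing.scale/= mulr1.
exact: is_derive_comp1 Hu (is_derive1_powR dl Nx).
Qed.

Definition omega_prim (N dl x : R) := - (1 + (N * x) `^ dl)^-1.

Lemma is_derive_omega_prim (N dl x : R) : 0 < N -> 0 < dl -> 0 < x ->
  is_derive x 1 (omega_prim N dl) (dl * (omega N x dl / x)).
Proof.
move=> N0 dl0 x0; have Nx : 0 < N * x by rewrite mulr_gt0.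
have y0 : 0 < (N * x) `^ dl by exact: powR_gt0.
have y1 : 1 + (N * x) `^ dl != 0 by rewrite gt_eqF// addr_gt0.
have Hp := is_derive_powR_scale dl N0 x0.
have H2 : is_derive x 1 (fun y : R => 1 + (N * y) `^ dl) (dl * (N * x) `^ (dl - 1) * N).
  by have := is_deriveD (is_derive_cst (1 : R) x 1) Hp; rewrite add0r.
have H3 := is_deriveN (is_deriveV (f := fun y : R => 1 + (N * y) `^ dl) y1 H2).
apply: is_derive_eq H3 _; rewrite /GRing.scale/= /omega.
have := mulr_powRB1 (ltW Nx) dl0; move: y1; move: (_ `^ (_ - 1)) => u + Eu.
by rewrite -Eu => y1; field; rewrite y1 (gt_eqF x0).
Qed.

Lemma omega_div_continuous (N dl x : R) : 0 < N -> 0 < x ->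
  {for x, continuous (fun t => omega N t dl / t)}.
Proof.
move=> N0 x0.
have [dp _] := is_derive_powR_scale dl N0 x0.
have c1 : {for x, continuous (fun y : R => (N * y) `^ dl)}.
  exact/differentiable_continuous/derivable1_diffP.
have y0 : 0 <= (N * x) `^ dl by exact: powR_ge0.
have c2 : {for x, continuous (fun y : R => 1 + (N * y) `^ dl)}.
  by apply: cvgD; [exact: cvg_cst|exact: c1].
apply: cvgM; last by apply: cvgV; [rewrite gt_eqF|exact: cvg_id].
apply: cvgM; first exact: c1.
apply: cvgV; first by rewrite gt_eqF// exprn_gt0// ltr_pwDl.
by apply: cvgM; exact: c2.
Qed.

Lemma omega_prim_itv (N dl x : R) : -1 <= omega_prim N dl x <= 0.
Proof.
have y0 : 0 <= (N * x) `^ dl by exact: powR_ge0.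
rewrite /omega_prim lerN2 oppr_le0 invr_ge0 invf_le1 ?lerDl ?y0 ?addr_ge0//.
by rewrite ltr_pwDl.
Qed.

Lemma cdistE (t : R) : cdist t = pi - `|t - pi|.
Proof.
rewrite /cdist; have [tp|pt] := lerP t pi.
  rewrite min_l; lra.
rewrite min_r; lra.
Qed.

Lemma cdist_continuous : continuous (@cdist R).
Proof.
rewrite (_ : cdist = fun t => pi - `|t - pi|); last by apply/funext => t; rewrite cdistE.
move=> x; apply: cvgB; first exact: cvg_cst.
by apply: cvg_norm; apply: cvgB; [exact: cvg_id|exact: cvg_cst].
Qed.

Lemma cdist_gt0 (t : R) : 0 < t < 2 * pi -> 0 < cdist t.
Proof. by move=> /andP[t0 t1]; rewrite lt_min t0 subr_gt0. Qed.

Lemma omega_cdist_continuous (N dl t : R) : 0 < N -> 0 < t < 2 * pi ->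
  {for t, continuous (fun t => omega N (cdist t) dl / cdist t)}.
Proof.
move=> N0 /cdist_gt0 t0.
apply: (@continuous_comp _ _ _ cdist (fun x => omega N x dl / x)).
  exact: cdist_continuous.
exact: omega_div_continuous.
Qed.

(** The bound is free of N because dx/x is invariant under scaling. As [cdist] is t or 2 pi - t, the
    integrand is at most the sum of two reflected copies, each of integral at most 1/dl. *)
Lemma omega_cdist_int (N dl : R) : 0 < N -> 0 < dl ->
  (\int[mu]_(t in `]0%R, (2 * pi)%R[) (omega N (cdist t) dl / cdist t)%:E
    <= (2 / dl)%:E)%E.
Proof.
move=> N0 dl0; pose h t := omega N t dl / t + omega N (2 * pi - t) dl / (2 * pi - t).
have pi2 := @two_pi_gt0 R.
have ch t : 0 < t < 2 * pi -> {for t, continuous h}.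
  move=> /andP[t0 t1]; apply: cvgD; first exact: omega_div_continuous.
  apply: (@continuous_comp _ _ _ (fun t => 2 * pi - t) (fun x => omega N x dl / x)).
    by apply: cvgB; [exact: cvg_cst|exact: cvg_id].
  by apply: omega_div_continuous; rewrite ?subr_gt0.
have h0 t : 0 < t < 2 * pi -> 0 <= h t.
  by move=> /andP[t0 t1]; rewrite addr_ge0// divr_ge0 ?omega_ge0 ?subr_ge0 ?ltW.
apply: (@le_trans _ _ (\int[mu]_(t in `]0%R, (2 * pi)%R[) (h t)%:E)%E).
  apply: ge0_le_integral => //.
  - move=> t /=; rewrite in_itv/= => /cdist_gt0 t0.
    by rewrite lee_fin divr_ge0 ?omega_ge0// ltW.
  - apply/measurable_EFinP; apply: continuous_on_measurable => // t /=.
    by rewrite in_itv/=; exact: omega_cdist_continuous.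
  - apply/measurable_EFinP; apply: continuous_on_measurable; first exact: measurable_itv.
    by move=> t /=; rewrite in_itv/=; exact: ch.
  - move=> t /=; rewrite in_itv/= => /andP[t0 t1]; rewrite lee_fin /h /cdist.
    have [_|_] := leP t (2 * pi - t).
      by rewrite lerDl divr_ge0 ?omega_ge0// subr_ge0 ltW.
    by rewrite lerDr divr_ge0 ?omega_ge0// ltW.
apply: (@ge0_integral_le_antideriv _ _ _ _ h
  (fun t => dl^-1 * omega_prim N dl t - dl^-1 * omega_prim N dl (2 * pi - t))) => //.
- move=> t /andP[t0 t1].
  have H1 := is_derive_omega_prim N0 dl0 t0.
  have t1' : 0 < 2 * pi - t by rewrite subr_gt0.
  have Hu := is_derive_reflect (2 * pi) t.
  have H2 := is_derive_comp1 Hu (is_derive_omega_prim N0 dl0 t1').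
  apply: is_derive_eq; rewrite /GRing.scale/= /h mulrN1 mulrN opprK.
  by rewrite !mulrA mulVf ?gt_eqF// !mul1r.
- move=> x y _ _ _; rewrite -!mulrBr mulrC ler_pM2r ?invr_gt0//.
  have := omega_prim_itv N dl y; have := omega_prim_itv N dl x.
  have := omega_prim_itv N dl (2 * pi - y); have := omega_prim_itv N dl (2 * pi - x).
  by lra.
Qed.

Lemma powR_lt0_le (a b e : R) : 0 < a -> a <= b -> e <= 0 -> b `^ e <= a `^ e.
Proof.
move=> a0 ab e0; have b0 : 0 < b by rewrite (lt_le_trans a0).
rewrite -[e]opprK (powRN b) (powRN a) lef_pV2 ?posrE ?powR_gt0//.
by apply: ge0_ler_powR; rewrite ?nnegrE ?oppr_ge0// ltW.
Qed.

(** 1/max is the product of its powers with exponents 1 - e and e; one is estimated by a and the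
    other by d. *)
Lemma maxr_inv_le (a d e : R) : 0 < a -> 0 < d -> 0 <= e <= 1 ->
  (Num.max a d)^-1 <= a `^ (e - 1) * d `^ (- e).
Proof.
move=> a0 d0 /andP[e0 e1]; set M := Num.max a d.
have M0 : 0 < M by rewrite lt_max a0.
have -> : M^-1 = M `^ (e - 1) * M `^ (- e).
  by rewrite -powRDp// -(powR_inv1 (ltW M0)); congr powR; ring.
rewrite ler_pM ?powR_ge0//; apply: powR_lt0_le => //.
- by rewrite le_max lexx.
- by rewrite subr_le0.
- by rewrite le_max lexx orbT.
- by rewrite oppr_le0.
Qed.

Lemma omega_ge_min (N x dl : R) : 0 < N -> 0 < x ->
  (N * x) `^ dl <= 4 * omega N x dl \/ (N * x) `^ (- dl) <= 4 * omega N x dl.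
Proof.
move=> N0 x0; have Nx : 0 < N * x by rewrite mulr_gt0.
rewrite powRN /omega; have : 0 < (N * x) `^ dl by exact: powR_gt0.
move: (_ `^ _) => y y0; have y1 : 0 < (1 + y) ^+ 2 by rewrite exprn_gt0// addr_gt0.
have [yle|yge] := leP y 1; [left|right].
  have y4 : (1 + y) ^+ 2 <= 4 by nra.
  by rewrite mulrA ler_pdivlMr// [4 * y]mulrC ler_wpM2l// ltW.
by rewrite mulrA ler_pdivlMr// ler_pdivrMl//; nra.
Qed.

(** Inserts the weight of scale N into the kernel 1/max(a, d). Interpolation with exponent tau - dl
    when (N d)^dl <= 4 omega, and with tau + dl otherwise, leaves d^(-tau) times (N d)^dl or (N
    d)^(-dl), which [omega] dominates. What remains is a power of N and one of a; both cases are
    added since the choice between them depends on d. *)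
Lemma kernel_le (N dl tau a d : R) : 0 < N -> 0 < a -> 0 < d -> 0 < dl -> dl < tau ->
  tau + dl <= 1 ->
  (Num.max a d)^-1 <=
  4 * (N `^ (- dl) * a `^ (tau - dl - 1) + N `^ dl * a `^ (tau + dl - 1)) *
    (omega N d dl * d `^ (- tau)).
Proof.
move=> N0 a0 d0 dl0 dlt tdl.
have Nd0 := powR_gt0 dl N0. have Nd0' := powR_gt0 (- dl) N0.
have a1 := powR_gt0 (tau - dl - 1) a0. have a2 := powR_gt0 (tau + dl - 1) a0.
have dt := powR_gt0 (- tau) d0. have om := omega_ge0 N d dl.
have [H|H] := omega_ge_min dl N0 d0.
- apply: (le_trans (maxr_inv_le a0 d0 (e := tau - dl) _)); first by apply/andP; split; lra.
  apply: (@le_trans _ _ (4 * (N `^ (- dl) * a `^ (tau - dl - 1)) *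
      (omega N d dl * d `^ (- tau)))); last first.
    have W0 : 0 <= omega N d dl * d `^ (- tau) by rewrite mulr_ge0// ltW.
    rewrite (ler_wpM2r W0)// (ler_wpM2l (ler0n _ 4))// lerDl.
    by rewrite mulr_ge0 ?(ltW a1) ?(ltW a2) ?(ltW Nd0) ?(ltW Nd0').
  have -> : 4 * (N `^ (- dl) * a `^ (tau - dl - 1)) * (omega N d dl * d `^ (- tau)) =
    N `^ (- dl) * a `^ (tau - dl - 1) * d `^ (- tau) * (4 * omega N d dl) by ring.
  apply: (@le_trans _ _ (N `^ (- dl) * a `^ (tau - dl - 1) * d `^ (- tau) *
     (N * d) `^ dl)); last by rewrite ler_wpM2l// !mulr_ge0// ltW.
  rewrite powRM ?(ltW N0) ?(ltW d0)//.
  rewrite (_ : - (tau - dl) = - tau + dl); last by ring.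
  rewrite (powRDp (- tau) dl d0).
  have -> : N `^ (- dl) * a `^ (tau - dl - 1) * d `^ (- tau) * (N `^ dl * d `^ dl) =
    (N `^ (- dl) * N `^ dl) * (a `^ (tau - dl - 1) * (d `^ (- tau) * d `^ dl)) by ring.
  by rewrite powRN_inv// mul1r.
- apply: (le_trans (maxr_inv_le a0 d0 (e := tau + dl) _)); first by apply/andP; split; lra.
  apply: (@le_trans _ _ (4 * (N `^ dl * a `^ (tau + dl - 1)) *
      (omega N d dl * d `^ (- tau)))); last first.
    have W0 : 0 <= omega N d dl * d `^ (- tau) by rewrite mulr_ge0// ltW.
    rewrite (ler_wpM2r W0)// (ler_wpM2l (ler0n _ 4))// lerDr.
    by rewrite mulr_ge0 ?(ltW a1) ?(ltW a2) ?(ltW Nd0) ?(ltW Nd0').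
  have -> : 4 * (N `^ dl * a `^ (tau + dl - 1)) * (omega N d dl * d `^ (- tau)) =
    N `^ dl * a `^ (tau + dl - 1) * d `^ (- tau) * (4 * omega N d dl) by ring.
  apply: (@le_trans _ _ (N `^ dl * a `^ (tau + dl - 1) * d `^ (- tau) *
     (N * d) `^ (- dl))); last by rewrite ler_wpM2l// !mulr_ge0// ltW.
  rewrite powRM ?(ltW N0) ?(ltW d0)//.
  rewrite opprD (powRDp (- tau) (- dl) d0).
  have -> : N `^ dl * a `^ (tau + dl - 1) * d `^ (- tau) * (N `^ (- dl) * d `^ (- dl)) =
    (N `^ (- dl) * N `^ dl) * (a `^ (tau + dl - 1) * (d `^ (- tau) * d `^ (- dl))) by ring.
  by rewrite powRN_inv// mul1r.
Qed.

(** Split at b = 1 - 1/n. Before b the singular factor is at most n^(1-e) and t^(n-1) has integral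
    at most 1/n; after b the power of t is at most 1 and the rest integrates to n^(-e)/e. *)
Lemma beta_int_le (n : nat) (e : R) : (0 < n)%N -> 0 < e <= 1 ->
  (\int[mu]_(t in `]0%R, 1%R[) (t ^+ n.-1 * (1 - t) `^ (e - 1))%:E
   <= ((1 + e^-1) * n%:R `^ (- e))%:E)%E.
Proof.
move=> n0 /andP[e0 e1]; set N : R := n%:R; have N0 : 0 < N by rewrite ltr0n.
have N1 : 1 <= N by rewrite ler1n.
pose b := 1 - N^-1.
have b0 : 0 <= b by rewrite subr_ge0 invf_le1.
have b1 : b < 1 by rewrite ltrBlDr ltrDl invr_gt0.
have c1 t : t < 1 -> {for t, continuous (fun t : R => (1 - t) `^ (e - 1))}.
  move=> t1; apply: (@continuous_comp _ _ _ (fun t : R => 1 - t) (fun x : R => x `^ (e - 1))).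
    by apply: cvgB; [exact: cvg_cst|exact: cvg_id].
  have t1' : 0 < 1 - t by rewrite subr_gt0.
  have [dp _] := is_derive1_powR (e - 1) t1'.
  exact/differentiable_continuous/derivable1_diffP.
have c2 t : {for t, continuous (fun t : R => t ^+ n.-1)} by exact: exprn_continuous.
have cf t : t < 1 -> {for t, continuous (fun t : R => t ^+ n.-1 * (1 - t) `^ (e - 1))}.
  by move=> t1; apply: cvgM; [exact: c2|exact: c1].
have f0 t : 0 <= t -> 0 <= t ^+ n.-1 * (1 - t) `^ (e - 1).
  by move=> t0; rewrite mulr_ge0 ?exprn_ge0// powR_ge0.
have -> : `]0, 1[%classic = `]0, b]%classic `|` `]b, 1[%classic :> set R.
  apply/seteqP; split => t /=; rewrite !in_itv/=.
    by move=> /andP[-> ->]; case: (leP t b) => _; [left|right].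
  by move=> [|] /andP[h1 h2]; apply/andP; split; lra.
rewrite ge0_integral_setU//=; first last.
- apply/disj_set2P/seteqP; split => t //= []; rewrite !in_itv/=; lra.
- by move=> t /= []; rewrite in_itv/= => /andP[h1 h2]; rewrite lee_fin f0//; lra.
- apply/measurable_EFinP; apply: continuous_on_measurable; first exact: measurableU.
  by move=> t /= []; rewrite in_itv/= => /andP[h1 h2]; apply: cf; lra.
rewrite mulrDl mul1r EFinD; apply: leeD.
- apply: (@le_trans _ _ (\int[mu]_(t in `]0%R, b]) (N `^ (1 - e) * t ^+ n.-1)%:E)%E).
    apply: ge0_le_integral => //.
    + by move=> t /=; rewrite in_itv/= => /andP[h1 h2]; rewrite lee_fin f0// ltW.
    + apply/measurable_EFinP; apply: continuous_on_measurable => //.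
      by move=> t /=; rewrite in_itv/= => /andP[h1 h2]; apply: cf; lra.
    + apply/measurable_EFinP; apply: continuous_on_measurable => // t _.
      by apply: cvgM; [exact: cvg_cst|exact: c2].
    + move=> t /=; rewrite in_itv/= => /andP[h1 h2].
      rewrite lee_fin mulrC ler_wpM2r ?exprn_ge0 ?(ltW h1)//.
      rewrite -[N in leRHS]invrK -powR_inv1 ?invr_ge0 ?(ltW N0)// -powRrM mulN1r opprB.
      apply: powR_lt0_le; rewrite ?invr_gt0//; last by rewrite subr_le0.
      by move: h2; rewrite /b; lra.
  apply: (@le_trans _ _ (\int[mu]_(t in `]0%R, 1%R[) (N `^ (1 - e) * t ^+ n.-1)%:E)%E).
    apply: ge0_subset_integral => //.
    + apply/measurable_EFinP; apply: continuous_on_measurable => // t _.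
      by apply: cvgM; [exact: cvg_cst|exact: c2].
    + move=> t /=; rewrite in_itv/= => /andP[h1 h2].
      by rewrite lee_fin mulr_ge0 ?powR_ge0// exprn_ge0// ltW.
    + by move=> t /=; rewrite !in_itv/= => /andP[-> h2]; lra.
  apply: (@ge0_integral_le_antideriv _ _ _ _ _ (fun t => N `^ (- e) * t ^+ n)) => //.
  + move=> t _; have Hn := is_derive_expr n t.
    apply: is_derive_eq.
    rewrite /GRing.scale/=.
    rewrite (_ : 1 - e = - e + 1); last by ring.
    by rewrite (powRDp (- e) 1 N0) powRr1 ?(ltW N0)// mulrA.
  + by move=> t /andP[t0 t1]; rewrite mulr_ge0 ?powR_ge0// exprn_ge0// ltW.
  + by move=> t _; apply: cvgM; [exact: cvg_cst|exact: c2].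
  + move=> x y x0 xy y1; rewrite -mulrBr ler_piMr ?powR_ge0//.
    have y0 : 0 <= y by lra.
    have : y ^+ n <= 1 by rewrite exprn_ile1// ltW.
    have : 0 <= x ^+ n by rewrite exprn_ge0// ltW.
    by lra.
- apply: (@le_trans _ _ (\int[mu]_(t in `]b, 1%R[) ((1 - t) `^ (e - 1))%:E)%E).
    apply: ge0_le_integral => //.
    + by move=> t /=; rewrite in_itv/= => /andP[h1 h2]; rewrite lee_fin f0//; lra.
    + apply/measurable_EFinP; apply: continuous_on_measurable => //.
      by move=> t /=; rewrite in_itv/= => /andP[h1 h2]; apply: cf; lra.
    + apply/measurable_EFinP; apply: continuous_on_measurable => //.
      by move=> t /=; rewrite in_itv/= => /andP[h1 h2]; apply: c1; lra.
    + move=> t /=; rewrite in_itv/= => /andP[h1 h2].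
      rewrite lee_fin ler_piMl ?powR_ge0// exprn_ile1 ?ltW//; lra.
  apply: (@ge0_integral_le_antideriv _ _ _ _ _ (fun t => - e^-1 * (1 - t) `^ e)) => //.
  + move=> t /andP[t0 t1]; have t1' : 0 < 1 - t by rewrite subr_gt0.
    have Hu := is_derive_reflect 1 t.
    have H2 := is_derive_comp1 Hu (is_derive1_powR e t1').
    apply: is_derive_eq; rewrite /GRing.scale/= mulrN1 mulrNN mulrA mulVf ?mul1r//.
    by rewrite gt_eqF.
  + by move=> t _; rewrite powR_ge0.
  + by move=> t /andP[t0 t1]; exact: c1.
  + move=> x y x0 xy y1; rewrite -mulrBr mulNr -mulrN opprB.
    rewrite ler_wpM2l ?invr_ge0 ?(ltW e0)//.
    rewrite -[N]invrK -powR_inv1 ?invr_ge0 ?(ltW N0)// -powRrM mulrNN mul1r.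
    apply: (@le_trans _ _ ((1 - x) `^ e)); first by rewrite lerBlDr lerDl powR_ge0.
    apply: ge0_ler_powR; rewrite ?nnegrE ?invr_ge0 ?(ltW e0) ?(ltW N0)//; first lra.
    by move: x0; rewrite /b; lra.
Qed.

End KernelEstimates.

(** * Moments of Hardy functions *)

Section CoefficientBound.
Context {R : realType}.
Local Notation C := R[i].
Local Notation mu := (@lebesgue_measure R).

(** Where h vanishes x^p cannot be treated through its derivative; there h < e^(1/p) is turned into
    h^p < e directly. *)
Lemma continuous_powR_ge0 (h : R -> R) (p : R) : 0 < p -> (forall x, 0 <= h x) ->
  continuous h -> continuous (fun x => h x `^ p).
Proof.
move=> p0 h0 ch x; have := h0 x; rewrite le_eqVlt => /predU1P[hx|hx].
  apply/(@cvgrPdist_lt _ R^o) => e e0; rewrite -hx powR0 ?gt_eqF//.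
  have d0 : 0 < e `^ p^-1 by exact: powR_gt0.
  have := ch x => /(@cvgrPdist_lt _ R^o)/(_ _ d0); apply: filterS => y.
  rewrite -hx !sub0r !normrN !ger0_norm ?powR_ge0// => hy.
  have := @gt0_ltr_powR R p p0 (h y) (e `^ p^-1); rewrite !nnegrE (ltW d0) h0.
  by rewrite -powRrM mulVf ?gt_eqF// powRr1 ?(ltW e0)//; exact.
apply: (@continuous_comp _ _ _ h (fun x => x `^ p)); first exact: ch.
have [dp _] := is_derive1_powR p hx.
exact/differentiable_continuous/derivable1_diffP.
Qed.

Local Notation O := (`]0%R, (2 * pi)%R[%classic : set R).

Lemma circle_int_oo (h : R -> R) : continuous h ->
  (\int[mu]_(x in O) (h x)%:E = (circle_int h)%:E)%E.
Proof.
move=> ch; rewrite -circle_int_EFin//.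
have mh D : measurable D -> measurable_fun D (fun x => (h x)%:E).
  by move=> mD; apply/measurable_EFinP; apply: continuous_on_measurable => // x _; exact: ch.
rewrite -(@integral_itv_bndo_bndc R (BLeft 0) (2 * pi)); last exact: mh.
by rewrite -(@integral_itv_obnd_cbnd R 0 (BLeft (2 * pi))); last exact: mh.
Qed.

Section FixedFunction.
Variables (f f1 : C -> C) (p : R).
Hypothesis p2 : 2 < p.
Hypothesis fd : forall w, modulus w < 1 -> cderiv f w (f1 w) /\ ccontinuous_at f1 w.

Let p0 : 0 < p. Proof. by move: p2; lra. Qed.
Let tau := 1 - p^-1.
(** Half of 1/p. Since p > 2, tau - dl = 1 - 3 dl > 1/4 and tau + dl = 1 - dl < 1, as [kernel_le]
    and [beta_int_le] require. *)
Let dl := (2 * p)^-1.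
Let dl0 : 0 < dl. Proof. by rewrite invr_gt0 mulr_gt0. Qed.
Let pdl : p^-1 = 2 * dl. Proof. by rewrite /dl invfM mulrA divff ?mul1r. Qed.
Let dl4 : dl < 4^-1.
Proof. by rewrite /dl ltf_pV2 ?posrE ?mulr_gt0//; move: p2; lra. Qed.

Let F rho t := modulus (f (circle_point rho t)).
Let wt N t := omega N (cdist t) dl * cdist t `^ (- tau).
Let kap N a := N `^ (- dl) * a `^ (tau - dl - 1) + N `^ dl * a `^ (tau + dl - 1).
(** |f(t)| is controlled in two stages: [pointwise] bounds it by kap N (1 - t) times the weighted
    mean H, and [H_le] bounds H by the p-th root of A. The gain is that [omega] survives in A, so
    the values of A at lacunary N add up to a multiple of one p-mean. *)
Let H rho N := (\int[mu]_(t in O) (F rho t * wt N t)%:E)%E.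
Let A rho N := (\int[mu]_(t in O) (F rho t `^ p * omega N (cdist t) dl)%:E)%E.

Let F_cont rho : 0 < rho < 1 -> continuous (F rho).
Proof.
move=> r01; apply: rcontinuous_modulus => t.
by apply: (rcontinuous_circle (f1 := f1) (r0 := 1)) => // w /fd[].
Qed.

Let F_ge0 rho t : 0 <= F rho t. Proof. exact: modulus_ge0. Qed.

Let cpow_cont (e t : R) : 0 < t < 2 * pi -> {for t, continuous (fun t => cdist t `^ e)}.
Proof.
move=> /cdist_gt0 t0.
apply: (@continuous_comp _ _ _ (@cdist R) (fun x : R => x `^ e)).
  exact: cdist_continuous.
have [dp _] := is_derive1_powR e t0.
exact/differentiable_continuous/derivable1_diffP.
Qed.

Let om_cont N (t : R) : 0 < N -> 0 < t < 2 * pi ->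
  {for t, continuous (fun t => omega N (cdist t) dl)}.
Proof.
move=> N0 t0.
have c1 : {for t, continuous (fun t => (N * cdist t) `^ dl)}.
  have Nc : 0 < N * cdist t by rewrite mulr_gt0// cdist_gt0.
  apply: (@continuous_comp _ _ _ (fun t => N * cdist t) (fun x : R => x `^ dl)).
    by apply: cvgM; [exact: cvg_cst|exact: cdist_continuous].
  have [dp _] := is_derive1_powR dl Nc.
  exact/differentiable_continuous/derivable1_diffP.
apply: cvgM; first exact: c1.
apply: cvgV; first by rewrite gt_eqF// exprn_gt0// ltr_pwDl// powR_ge0.
by apply: cvgM; apply: cvgD; [exact: cvg_cst|exact: c1|exact: cvg_cst|exact: c1].
Qed.

Let mO (h : R -> R) : (forall t, 0 < t < 2 * pi -> {for t, continuous h}) ->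
  measurable_fun O (fun t => (h t)%:E).
Proof.
move=> ch; apply/measurable_EFinP; apply: continuous_on_measurable.
  exact: measurable_itv.
by move=> t /=; rewrite in_itv/=; exact: ch.
Qed.

Let Fp_cont rho : 0 < rho < 1 -> continuous (fun t => F rho t `^ p).
Proof. by move=> r01; apply: continuous_powR_ge0 => //; exact: F_cont. Qed.

Let wt_ge0 N t : 0 <= wt N t.
Proof. by rewrite mulr_ge0 ?omega_ge0 ?powR_ge0. Qed.

Let mFw rho N : 0 < rho < 1 -> 0 < N -> measurable_fun O (fun t => (F rho t * wt N t)%:E).
Proof.
move=> r01 N0; apply: mO => t t0; apply: cvgM; first exact: F_cont.
by apply: cvgM; [exact: om_cont|exact: cpow_cont].
Qed.

Let mFpw rho N : 0 < rho < 1 -> 0 < N ->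
  measurable_fun O (fun t => (F rho t `^ p * omega N (cdist t) dl)%:E).
Proof.
move=> r01 N0; apply: mO => t t0; apply: cvgM; first exact: Fp_cont.
exact: om_cont.
Qed.

Let kap_ge0 N a : 0 <= kap N a.
Proof. by rewrite addr_ge0// mulr_ge0// powR_ge0. Qed.

(** From t <= 2 rho - 1 follows rho - t >= (1 - t)/2, so 1 - t can replace the distance from t to
    the circle and [kap] does not depend on rho. The constant is 16 = 4 * 4, one factor from the
    lower bound for the distance and one from [kernel_le]. *)
Let pointwise rho N t : 2^-1 < rho < 1 -> 0 < N -> 0 <= t <= 2 * rho - 1 ->
  ((2 * pi * modulus (f t%:C%C))%:E <= (16 * kap N (1 - t))%:E * H rho N)%E.
Proof.
move=> /andP[r1 r2] N0 /andP[t0 t1].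
have rho0 : 0 < rho by lra.
have r01 : 0 < rho < 1 by rewrite rho0.
have a0 : 0 < 1 - t by lra.
have tr : modulus t%:C%C < rho by rewrite modulus_real ger0_norm//; lra.
have cb := cauchy_bound r01 tr fd.
have WE s : circle_point rho s - t%:C%C = rho%:C%C * (circle_point 1 s - (t / rho)%:C%C).
  by rewrite mulrBr -circle_pointE -rmorphM mulrC divfK// gt_eqF.
have ch : continuous (fun s => F rho s * (rho / modulus (circle_point rho s - t%:C%C))).
  move=> s; apply: cvgM; first exact: F_cont.
  apply: cvgM; first exact: cvg_cst.
  apply: cvgV; first by rewrite modulus_eq0 circle_point_neq.
  apply: (@rcontinuous_modulus _ (fun s => circle_point rho s - t%:C%C)) => u e e0.
  have [d [d0 dP]] := rderiv_continuous (@rderiv_circle R rho u) e0.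
  exists d; split=> // x /dP; apply: le_lt_trans.
  by rewrite opprB addrA subrK.
have k0 : 0 <= 16 * kap N (1 - t).
  by rewrite mulr_ge0// addr_ge0// mulr_ge0// powR_ge0.
apply: (@le_trans _ _ (circle_int (fun s =>
  F rho s * (rho / modulus (circle_point rho s - t%:C%C))))%:E).
  by rewrite lee_fin.
rewrite -circle_int_oo// /H -ge0_integralZl_EFin//; last 2 first.
- by move=> s _; rewrite lee_fin mulr_ge0.
- exact: mFw.
apply: ge0_le_integral => //.
- by move=> s _; rewrite lee_fin mulr_ge0// divr_ge0// ltW.
- by apply: mO => s _; exact: ch.
- by apply: measurable_funeM; exact: mFw.
move=> s /=; rewrite in_itv/= => s0; rewrite -EFinM lee_fin [leRHS]mulrCA ler_wpM2l//.
have cs := cdist_gt0 s0.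
have x01 : 0 <= t / rho <= 1.
  by rewrite divr_ge0 ?(ltW rho0)//= ler_pdivrMr// mul1r; lra.
have [m1 m2] := @circle_dist_lower R (t / rho) s x01
  ltac:(by case/andP: s0 => h1 h2; rewrite (ltW h1) (ltW h2)).
rewrite WE modulusM modulus_real (gtr0_norm rho0) invfM mulrA divff ?gt_eqF// mul1r.
have M0 : 0 < Num.max (1 - t) (cdist s) by rewrite lt_max a0.
have mM : Num.max (1 - t) (cdist s) / 4 <= modulus (circle_point 1 s - (t / rho)%:C%C).
  rewrite ler_pdivrMr// ge_max; apply/andP; split; last by lra.
  have : (1 - t) / 2 <= 1 - t / rho.
    rewrite (_ : 1 - t / rho = (rho - t) / rho); last by field; rewrite gt_eqF.
    by rewrite [leRHS]mulrC ler_pdivlMl// ; nra.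
  by lra.
apply: (@le_trans _ _ (Num.max (1 - t) (cdist s) / 4)^-1).
  by rewrite lef_pV2 ?posrE// ?divr_gt0// (lt_le_trans _ mM)// divr_gt0.
rewrite invfM invrK mulrC.
have := @kernel_le R N dl tau (1 - t) (cdist s) N0 a0 cs dl0 _ _.
rewrite /tau pdl => /(_ ltac:(move: dl4; lra) ltac:(move: dl0; lra)) kl.
apply: le_trans (ler_wpM2l (ler0n _ 4) kl) _.
by rewrite /kap /wt /tau pdl !mulrA -natrM.
Qed.

(** The two terms of [kap] contribute N^(-dl) N^(-(tau - dl)) and N^dl N^(-(tau + dl)), both equal
    to N^(-tau). The constant is 10 = 2 (1 + 4), because the inverses of tau - dl and tau + dl are
    at most 4. *)
Let kap_int (n : nat) : (0 < n)%N ->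
  (\int[mu]_(t in `]0%R, 1%R[) (t ^+ n.-1 * kap n%:R (1 - t))%:E <=
   (10 * n%:R `^ (- tau))%:E)%E.
Proof.
move=> n0; set N : R := n%:R; have N0 : 0 < N by rewrite ltr0n.
have mg (e : R) : measurable_fun (`]0%R, 1%R[%classic : set R) (fun t : R => (t ^+ n.-1 * (1 - t) `^ e)%:E).
  apply/measurable_EFinP; apply: continuous_on_measurable; first exact: measurable_itv.
  move=> t /=; rewrite in_itv/= => /andP[t0 t1]; apply: cvgM; first exact: exprn_continuous.
  apply: (@continuous_comp _ _ _ (fun t : R => 1 - t) (fun x : R => x `^ e)).
    by apply: cvgB; [exact: cvg_cst|exact: cvg_id].
  have t1' : 0 < 1 - t by rewrite subr_gt0.
  have [dp _] := is_derive1_powR e t1'.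
  exact/differentiable_continuous/derivable1_diffP.
have g0 (e t : R) : (`]0%R, 1%R[%classic : set R) t -> (0 <= (t ^+ n.-1 * (1 - t) `^ e)%:E)%E.
  rewrite /= in_itv/= => /andP[t0 t1].
  by rewrite lee_fin mulr_ge0 ?powR_ge0// exprn_ge0// ltW.
have -> : (fun t : R => (t ^+ n.-1 * kap N (1 - t))%:E) = (fun t : R =>
  ((N `^ (- dl))%:E * (t ^+ n.-1 * (1 - t) `^ (tau - dl - 1))%:E +
   (N `^ dl)%:E * (t ^+ n.-1 * (1 - t) `^ (tau + dl - 1))%:E)%E).
  by apply/funext => t; rewrite -!EFinM -EFinD /kap; congr EFin; ring.
rewrite ge0_integralD//; last 4 first.
- by move=> t t01; rewrite mule_ge0 ?g0// lee_fin powR_ge0.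
- by apply: measurable_funeM; exact: mg.
- by move=> t t01; rewrite mule_ge0 ?g0// lee_fin powR_ge0.
- by apply: measurable_funeM; exact: mg.
rewrite !ge0_integralZl_EFin ?powR_ge0//; try exact: mg; try exact: g0.
have t1 : 0 < tau - dl <= 1 by rewrite /tau pdl; move: dl0 dl4; lra.
have t2 : 0 < tau + dl <= 1 by rewrite /tau pdl; move: dl0 dl4; lra.
have b1 := beta_int_le n0 t1; have b2 := beta_int_le n0 t2.
apply: le_trans (leeD (lee_wpmul2l _ b1) (lee_wpmul2l _ b2)) _.
- by rewrite lee_fin powR_ge0.
- by rewrite lee_fin powR_ge0.
rewrite -!EFinM -EFinD lee_fin -/N.
have -> : N `^ (- dl) * ((1 + (tau - dl)^-1) * N `^ (- (tau - dl))) =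
  (1 + (tau - dl)^-1) * N `^ (- tau).
  rewrite mulrCA -powRDp//; congr (_ * powR _ _); ring.
have -> : N `^ dl * ((1 + (tau + dl)^-1) * N `^ (- (tau + dl))) =
  (1 + (tau + dl)^-1) * N `^ (- tau).
  rewrite mulrCA -powRDp//; congr (_ * powR _ _); ring.
rewrite -mulrDl ler_wpM2r ?powR_ge0//.
have i4 : 4 = (4^-1)^-1 :> R by rewrite invrK.
have h1 : (tau - dl)^-1 <= 4.
  rewrite i4 lef_pV2 ?posrE ?invr_gt0//; last by case/andP: t1.
  by rewrite /tau pdl; move: dl4; lra.
have h2 : (tau + dl)^-1 <= 4.
  rewrite i4 lef_pV2 ?posrE ?invr_gt0//; last by case/andP: t2.
  by rewrite /tau pdl; move: dl4; lra.
by lra.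
Qed.

Let A_le rho N : 0 < rho < 1 -> 0 < N ->
  (A rho N <= (circle_int (fun t => F rho t `^ p))%:E)%E.
Proof.
move=> r01 N0; rewrite -circle_int_oo; last exact: Fp_cont.
apply: ge0_le_integral => //.
- by move=> t _; rewrite lee_fin mulr_ge0 ?powR_ge0// omega_ge0.
- exact: mFpw.
- by apply: mO => t _; exact: Fp_cont.
- by move=> t _; rewrite lee_fin ler_piMr ?powR_ge0// omega_le1.
Qed.

Let A_ge0 rho N : (0 <= A rho N)%E.
Proof.
by apply: integral_ge0 => t _; rewrite lee_fin mulr_ge0 ?powR_ge0// omega_ge0.
Qed.

(** Hoelder's inequality by way of Young's with the weights c = a^(1/p - 1) and k = a^(1/p): as c a
    = k, the two integrals add up to (1 + 4 p) a^(1/p), where 4 p = 2/dl bounds the integral of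
    omega/d. A positive bound a stands in for A, which may be 0. *)
Let H_le rho N a : 0 < rho < 1 -> 0 < N -> 0 < a -> (A rho N <= a%:E)%E ->
  (H rho N <= ((1 + 4 * p) * a `^ p^-1)%:E)%E.
Proof.
move=> r01 N0 a0 Aa.
pose B := (\int[mu]_(t in O) (omega N (cdist t) dl / cdist t)%:E)%E.
have BB : (B <= (4 * p)%:E)%E.
  apply: le_trans (omega_cdist_int N0 dl0) _.
  by rewrite lee_fin /dl invrK mulrA -natrM.
pose c := a `^ (p^-1 - 1); have c0 : 0 < c by exact: powR_gt0.
pose k := a `^ p^-1; have k0 : 0 < k by exact: powR_gt0.
have ck : c * a = k.
  by rewrite /c /k -{2}[a](powRr1 (ltW a0)) -powRDp// subrK.
apply: (@le_trans _ _ (\int[mu]_(t in O)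
   (c%:E * (F rho t `^ p * omega N (cdist t) dl)%:E +
    k%:E * (omega N (cdist t) dl / cdist t)%:E)%E)%E).
  apply: ge0_le_integral => //.
  - by move=> t _; rewrite lee_fin mulr_ge0.
  - exact: mFw.
  - apply: emeasurable_funD; apply: measurable_funeM; first exact: mFpw.
    by apply: mO => t t0; exact: omega_cdist_continuous.
  - move=> t /=; rewrite in_itv/= => /cdist_gt0 t0.
    rewrite -!EFinM -EFinD lee_fin /wt.
    have om := omega_ge0 N (cdist t) dl.
    have -> : F rho t * (omega N (cdist t) dl * cdist t `^ (- tau)) =
      omega N (cdist t) dl * (F rho t * cdist t `^ (- tau)) by ring.
    have -> : c * (F rho t `^ p * omega N (cdist t) dl) +
        k * (omega N (cdist t) dl / cdist t) =
      omega N (cdist t) dl * (c * F rho t `^ p + k / cdist t) by ring.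
    rewrite ler_wpM2l//.
    (* Young's inequality for the exponent p, with weight s^p = c *)
    pose s := c `^ p^-1; have s0 : 0 < s by exact: powR_gt0.
    have q0 : 0 < p / (p - 1) by rewrite divr_gt0//; move: p2; lra.
    have pn : p != 0 by rewrite gt_eqF.
    have p1 : p - 1 != 0 by rewrite gt_eqF//; move: p2; lra.
    have pq : p^-1 + (p / (p - 1))^-1 = 1.
      by field; rewrite ?pn ?p1.
    have := @conjugate_powR R (s * F rho t) (s^-1 * cdist t `^ (- tau)) p _ 
      (mulr_ge0 (ltW s0) (F_ge0 _ _)) (mulr_ge0 _ (powR_ge0 _ _)) p0 q0 pq.
    rewrite invr_ge0 (ltW s0) => /(_ isT).
    rewrite mulrACA divff ?mul1r; last by rewrite gt_eqF.
    move=> /le_trans; apply.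
    have E1 : (s * F rho t) `^ p = c * F rho t `^ p.
      by rewrite powRM ?(ltW s0)// /s -powRrM mulVf ?gt_eqF// powRr1 ?(ltW c0).
    have E2 : (s^-1 * cdist t `^ (- tau)) `^ (p / (p - 1)) = k / cdist t.
      rewrite powRM ?invr_ge0 ?(ltW s0) ?powR_ge0//; congr (_ * _).
        rewrite -powR_inv1 ?(ltW s0)// /s /c /k -!powRrM; congr powR.
        by field; rewrite ?pn ?p1.
      rewrite -powRrM -(powR_inv1 (ltW t0)); congr powR.
      by rewrite /tau; field; rewrite ?pn ?p1.
    rewrite E1 E2 lerD//.
      rewrite ler_pdivrMr// ler_peMr ?mulr_ge0 ?powR_ge0 ?(ltW c0)//.
      by move: p2; lra.
    rewrite ler_pdivrMr// ler_peMr ?divr_ge0 ?(ltW k0) ?(ltW t0)//.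
    by rewrite ler_pdivlMr; move: p2; lra.
rewrite ge0_integralD//; last 4 first.
- move=> t _; rewrite mule_ge0 ?lee_fin ?(ltW c0)//.
  by rewrite mulr_ge0 ?powR_ge0// omega_ge0.
- by apply: measurable_funeM; exact: mFpw.
- move=> t /=; rewrite in_itv/= => /cdist_gt0 t0.
  by rewrite mule_ge0 ?lee_fin ?(ltW k0)// divr_ge0 ?omega_ge0// ltW.
- by apply: measurable_funeM; apply: mO => t t0; exact: omega_cdist_continuous.
rewrite ge0_integralZl_EFin//; last 3 first.
- by move=> t _; rewrite lee_fin mulr_ge0 ?powR_ge0// omega_ge0.
- exact: mFpw.
- exact: ltW.
rewrite ge0_integralZl_EFin//; last 3 first.
- move=> t /=; rewrite in_itv/= => /cdist_gt0 t0.
  by rewrite lee_fin divr_ge0 ?omega_ge0// ltW.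
- by apply: mO => t t0; exact: omega_cdist_continuous.
- exact: ltW.
apply: (@le_trans _ _ (c%:E * a%:E + k%:E * (4 * p)%:E)%E).
  by apply: leeD; apply: lee_wpmul2l; rewrite // lee_fin ltW.
by rewrite -!EFinM -EFinD lee_fin ck -/k le_eqVlt; apply/orP; left; apply/eqP; ring.
Qed.

(** 80 = 8 * 10: the 16 of [pointwise] halved by 2 <= 2 pi, times the constant of [kap_int]. The
    upper limit 2 rho - 1 is the range in which [pointwise] applies. *)
Let b_le rho n a : 2^-1 < rho < 1 -> (0 < n)%N -> 0 < a -> (A rho n%:R <= a%:E)%E ->
  (\int[mu]_(t in `]0%R, (2 * rho - 1)%R[) (t ^+ n.-1 * modulus (f t%:C%C))%:E <=
   (80 * (1 + 4 * p) * a `^ p^-1 * n%:R `^ (- tau))%:E)%E.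
Proof.
move=> rI n0 a0 Aa; set N : R := n%:R; have N0 : 0 < N by rewrite ltr0n.
have r01 : 0 < rho < 1 by move: rI; lra.
set K := (1 + 4 * p) * a `^ p^-1.
have HK : (H rho N <= K%:E)%E by exact: H_le.
have K0 : 0 <= K by rewrite mulr_ge0 ?powR_ge0// addr_ge0// mulr_ge0// ltW.
have ft t : 0 < t < 2 * rho - 1 -> modulus (f t%:C%C) <= 8 * K * kap N (1 - t).
  move=> /andP[t1 t2].
  have k0 : 0 <= kap N (1 - t) by rewrite addr_ge0// mulr_ge0// powR_ge0.
  have := @pointwise rho N t rI N0 ltac:(by rewrite (ltW t1) (ltW t2)).
  have : ((16 * kap N (1 - t))%:E * H rho N <= (16 * kap N (1 - t))%:E * K%:E)%E.
    by apply: lee_wpmul2l => //; rewrite lee_fin mulr_ge0.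
  move=> h1 /le_trans/(_ h1); rewrite -EFinM lee_fin => h2.
  have pi2 := @pi_ge2 R.
  have : 2 * modulus (f t%:C%C) <= 2 * pi * modulus (f t%:C%C).
    by rewrite ler_wpM2r//; lra.
  by lra.
have fc (t : R) : 0 <= t < 1 -> {for t, continuous (fun t : R => modulus (f t%:C%C))}.
  move=> /andP[t0 t1]; apply/(@cvgrPdist_lt _ R^o) => e e0.
  have mt : modulus t%:C%C < 1 by rewrite modulus_real ger0_norm.
  have [d [d0 dP]] := cderiv_continuous (fd mt).1 e0.
  exists d => //= y; rewrite /ball_/= => ty.
  have := dP (y - t)%:C%C; rewrite modulus_real distrC => /(_ ty).
  rewrite rmorphB subrKC; apply: le_lt_trans; rewrite distrC.
  rewrite ler_norml; apply/andP; split.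
    by rewrite lerNl opprB lerBlDr modulusBC (le_trans _ (modulusD _ _))// subrK.
  by rewrite lerBlDr (le_trans _ (modulusD _ _))// subrK.
have kc (t : R) : t < 1 -> {for t, continuous (fun t : R => 8 * K * (t ^+ n.-1 * kap N (1 - t)))}.
  move=> t1; have t1' : 0 < 1 - t by rewrite subr_gt0.
  have pc (e : R) : {for t, continuous (fun t : R => (1 - t) `^ e)}.
    apply: (@continuous_comp _ _ _ (fun t : R => 1 - t) (fun x : R => x `^ e)).
      by apply: cvgB; [exact: cvg_cst|exact: cvg_id].
    have [dp _] := is_derive1_powR e t1'.
    exact/differentiable_continuous/derivable1_diffP.
  apply: cvgM; first exact: cvg_cst.
  apply: cvgM; first exact: exprn_continuous.
  by apply: cvgD; apply: cvgM; [exact: cvg_cst|exact: pc|exact: cvg_cst|exact: pc].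
have r1 : 2 * rho - 1 < 1 by move: rI; lra.
have g0 t : 0 < t -> t < 1 -> (0 <= (8 * K * (t ^+ n.-1 * kap N (1 - t)))%:E)%E.
  move=> t0 t1; rewrite lee_fin mulr_ge0//; first by rewrite mulr_ge0.
  by rewrite mulr_ge0// exprn_ge0// ltW.
apply: (@le_trans _ _ (\int[mu]_(t in `]0%R, (2 * rho - 1)%R[)
    (8 * K * (t ^+ n.-1 * kap N (1 - t)))%:E)%E).
  apply: ge0_le_integral => //.
  - move=> t /=; rewrite in_itv/= => /andP[t0 t1].
    by rewrite lee_fin mulr_ge0// exprn_ge0// ltW.
  - apply/measurable_EFinP; apply: continuous_on_measurable; first exact: measurable_itv.
    move=> t /=; rewrite in_itv/= => /andP[t0 t1]; apply: cvgM.
      exact: exprn_continuous.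
    by apply: fc; lra.
  - apply/measurable_EFinP; apply: continuous_on_measurable; first exact: measurable_itv.
    by move=> t /=; rewrite in_itv/= => /andP[t0 t1]; apply: kc; lra.
  - move=> t /=; rewrite in_itv/= => /andP[t0 t1].
    rewrite lee_fin mulrCA ler_wpM2l ?exprn_ge0 ?(ltW t0)//.
    by apply: ft; rewrite t0.
have mk : measurable_fun (`]0%R, 1%R[%classic : set R)
    (fun t : R => (8 * K * (t ^+ n.-1 * kap N (1 - t)))%:E).
  apply/measurable_EFinP; apply: continuous_on_measurable; first exact: measurable_itv.
  by move=> t /=; rewrite in_itv/= => /andP[t0 t1]; exact: kc.
apply: (@le_trans _ _ (\int[mu]_(t in `]0%R, 1%R[)
    (8 * K * (t ^+ n.-1 * kap N (1 - t)))%:E)%E).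
  apply: ge0_subset_integral => //.
  - by move=> t /=; rewrite in_itv/= => /andP[t0 t1]; exact: g0.
  - by move=> t /=; rewrite !in_itv/= => /andP[-> t1]; lra.
under eq_integral do rewrite EFinM.
rewrite ge0_integralZl_EFin//; last 3 first.
- move=> t /=; rewrite in_itv/= => /andP[t0 t1].
  by rewrite lee_fin mulr_ge0 ?exprn_ge0 ?(ltW t0).
- apply/measurable_EFinP; apply: continuous_on_measurable; first exact: measurable_itv.
  move=> t /=; rewrite in_itv/= => /andP[t0 t1].
  have t1' : 0 < 1 - t by rewrite subr_gt0.
  have pc (e : R) : {for t, continuous (fun t : R => (1 - t) `^ e)}.
    apply: (@continuous_comp _ _ _ (fun t : R => 1 - t) (fun x : R => x `^ e)).
      by apply: cvgB; [exact: cvg_cst|exact: cvg_id].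
    have [dp _] := is_derive1_powR e t1'.
    exact/differentiable_continuous/derivable1_diffP.
  apply: cvgM; first exact: exprn_continuous.
  by apply: cvgD; apply: cvgM; [exact: cvg_cst|exact: pc|exact: cvg_cst|exact: pc].
- by rewrite mulr_ge0.
apply: le_trans (lee_wpmul2l _ (kap_int n0)) _; first by rewrite lee_fin mulr_ge0.
by rewrite -EFinM lee_fin /K -/N le_eqVlt; apply/orP; left; apply/eqP; ring.
Qed.

Lemma omega_scale (N x e : R) : omega N x e = omega (N * x) 1 e.
Proof. by rewrite /omega mulr1. Qed.

Section LacunarySum.
Variables (lam : R) (n : nat -> nat) (M : R).
Hypotheses (lam1 : 1 < lam) (n0 : (0 < n 0)%N) (M0 : 0 <= M).
Hypothesis nl : forall j, lam * (n j)%:R <= (n j.+1)%:R.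
Hypothesis fM : forall rho, 0 < rho < 1 ->
  circle_int (fun t => modulus (f (circle_point rho t)) `^ p) <= 2 * pi * M `^ p.

Let npos j : (0 < n j)%N.
Proof.
elim: j => // j ih; rewrite -(ltr_nat R) (lt_le_trans _ (nl j))//.
by rewrite mulr_gt0 ?ltr0n//; move: lam1; lra.
Qed.

Let Com := lam `^ dl / (lam `^ dl - 1).

Let Com_ge0 : 0 <= Com.
Proof.
have h := @omega_sum R lam dl (fun j => (n j)%:R) 0 lam1 dl0.
by move: h; rewrite big_nil; apply => // j; rewrite ltr0n.
Qed.

Let A_fin rho j : 0 < rho < 1 -> A rho (n j)%:R \is a fin_num.
Proof.
move=> r01; rewrite ge0_fin_numE//.
by apply: le_lt_trans (A_le r01 _) (ltry _); rewrite ltr0n.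
Qed.

(** For fixed t the numbers n_j d form a lacunary sequence, so [omega_sum] bounds the sum of the
    weights by [Com] whatever d is. *)
Let A_sum rho J : 0 < rho < 1 ->
  \sum_(0 <= j < J) fine (A rho (n j)%:R) <= Com * (2 * pi * M `^ p).
Proof.
move=> r01; have N0 j : 0 < (n j)%:R :> R by rewrite ltr0n.
rewrite -lee_fin -sumEFin.
under eq_bigr do rewrite fineK ?A_fin//.
rewrite -ge0_integral_sum//; last 2 first.
- by move=> j; exact: mFpw.
- by move=> j t _; rewrite lee_fin mulr_ge0 ?powR_ge0// omega_ge0.
apply: (@le_trans _ _ (\int[mu]_(t in O) (Com%:E * (F rho t `^ p)%:E))%E); last first.
  rewrite ge0_integralZl_EFin//; last 2 first.
  - by move=> t _; rewrite lee_fin powR_ge0.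
  - by apply: mO => t _; exact: Fp_cont.
  rewrite circle_int_oo; last exact: Fp_cont.
  by rewrite -EFinM lee_fin ler_wpM2l// fM.
apply: ge0_le_integral => //.
- move=> t _; apply: sume_ge0 => j _.
  by rewrite lee_fin mulr_ge0 ?powR_ge0// omega_ge0.
- by apply: emeasurable_sum => j; exact: mFpw.
- by apply: measurable_funeM; apply: mO => t _; exact: Fp_cont.
- move=> t /=; rewrite in_itv/= => /cdist_gt0 t0.
  rewrite sumEFin -EFinM lee_fin -mulr_sumr mulrC ler_wpM2r ?powR_ge0//.
  under eq_bigr do rewrite omega_scale.
  apply: omega_sum => // j; first by rewrite mulr_gt0.
  by rewrite mulrA ler_wpM2r ?(ltW t0).
Qed.

Let bint (u : R) j :=
  (\int[mu]_(t in `]0%R, u[) (t ^+ (n j).-1 * modulus (f t%:C%C))%:E)%E.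

Let K0 := 80 * (1 + 4 * p).
Let K0_ge0 : 0 <= K0. Proof. by rewrite mulr_ge0// addr_ge0// mulr_ge0// ltW. Qed.

Let bint_ge0 u j : (0 <= bint u j)%E.
Proof.
apply: integral_ge0 => t /=; rewrite in_itv/= => /andP[t0 _].
by rewrite lee_fin mulr_ge0// exprn_ge0// ltW.
Qed.

Let rho_sum rho J : 2^-1 < rho < 1 ->
  \sum_(0 <= j < J) ((n j)%:R `^ tau * fine (bint (2 * rho - 1) j)) `^ p <=
  K0 `^ p * (Com * (2 * pi * M `^ p)).
Proof.
move=> rI; have r01 : 0 < rho < 1 by move: rI; lra.
apply/ler_addgt0Pr => e e0.
(* eta keeps the argument of [b_le] positive when A vanishes, and is small enough for the J
   corrections to cost at most e. *)
pose eta := e / (1 + K0 `^ p * J%:R).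
have d0 : 0 < 1 + K0 `^ p * J%:R by rewrite ltr_pwDl// mulr_ge0 ?powR_ge0.
have eta0 : 0 < eta by rewrite divr_gt0.
apply: (@le_trans _ _ (\sum_(0 <= j < J) K0 `^ p * (fine (A rho (n j)%:R) + eta))).
  apply: ler_sum => j _.
  set a := fine _ + eta.
  have a0 : 0 < a by rewrite ltr_wpDl// fine_ge0.
  have Aa : (A rho (n j)%:R <= a%:E)%E.
    by rewrite EFinD fineK ?A_fin// leeDl// lee_fin ltW.
  have N0 : 0 < (n j)%:R :> R by rewrite ltr0n.
  have bl := b_le rI (npos j) a0 Aa; rewrite -/(bint _ _) in bl.
  have bf : fine (bint (2 * rho - 1) j) <= K0 * a `^ p^-1 * (n j)%:R `^ (- tau).
    rewrite -lee_fin fineK// ge0_fin_numE//.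
    exact: le_lt_trans bl (ltry _).
  have fb0 : 0 <= fine (bint (2 * rho - 1) j) by rewrite fine_ge0.
  apply: (@le_trans _ _ ((K0 * a `^ p^-1) `^ p)).
    apply: ge0_ler_powR; rewrite ?nnegrE.
    - exact: ltW.
    - by rewrite mulr_ge0 ?powR_ge0.
    - by apply: mulr_ge0; [exact: K0_ge0|exact: powR_ge0].
    apply: le_trans (ler_wpM2l (powR_ge0 _ _) bf) _.
    by move: (K0 * a `^ p^-1) => X; rewrite mulrCA [_ `^ tau * _]mulrC powRN_inv// mulr1.
  by rewrite powRM ?powR_ge0// -powRrM mulVf ?gt_eqF// powRr1// ltW.
rewrite -mulr_sumr big_split/= mulrDr lerD//.
  by rewrite ler_wpM2l ?powR_ge0// A_sum.
rewrite sumr_const_nat subn0 -mulr_natr /eta.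
have KJ : K0 `^ p * J%:R / (1 + K0 `^ p * J%:R) <= 1.
  by rewrite ler_pdivrMr// mul1r lerDr.
move: (K0 `^ p) (J%:R : R) d0 KJ => k j d0 kj.
rewrite (_ : k * _ = k * j / (1 + k * j) * e); last by field; rewrite gt_eqF.
by rewrite ler_piMl// ltW.
Qed.

(** As rho = rk k tends to 1, the integrals over ]0, 2 rho - 1[ increase to the full ones. Instead
    of passing to the limit in the p-th powers, one k is chosen at which the first J integrals have
    all reached half of their limits; this costs 2^p. *)
Lemma coefficient_bound J :
  (forall j, (bint 1 j < +oo)%E) /\
  \sum_(0 <= j < J) ((n j)%:R `^ tau * fine (bint 1 j)) `^ p <=
  2 `^ p * (K0 `^ p * (Com * (2 * pi))) * M `^ p.
Proof.
pose rk k : R := 1 - (2 * k.+2%:R)^-1.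
pose uk k : R := 1 - (k.+2%:R)^-1.
have rkI k : 2^-1 < rk k < 1.
  apply/andP; split; last by rewrite ltrBlDr ltrDl invr_gt0.
  rewrite /rk ltrBrDr -ltrBrDl (_ : 1 - 2^-1 = 2^-1); last by lra.
  by rewrite ltf_pV2 ?posrE ?mulr_gt0// -[ltLHS]mulr1 ltr_pM2l// ltr1n.
have ruk k : 2 * rk k - 1 = uk k.
  have : k.+2%:R != 0 :> R by rewrite pnatr_eq0.
  by rewrite /rk /uk; move: (k.+2%:R : R) => x x0; field.
have uk0 k : 0 < uk k < 1.
  by have := rkI k; rewrite -ruk; lra.
pose E k : set R := `]0, uk k[%classic.
have nE : nondecreasing_seq E.
  move=> i j ij; apply/subsetPset => x; rewrite /E/= !in_itv/= => /andP[-> xi] /=.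
  apply: lt_le_trans xi _; rewrite /uk lerD2l lerN2 lef_pV2 ?posrE//.
  by rewrite ler_nat.
have EU : `]0, 1[%classic = \bigcup_k E k :> set R.
  apply/seteqP; split => [x /=|x [k _]]; rewrite /E/= !in_itv/=; last first.
    by move=> /andP[-> xk]; have := uk0 k; lra.
  move=> /andP[x0 x1]; exists (Num.bound (1 - x)^-1) => //=; rewrite in_itv/= x0/=.
  have x1' : 0 < 1 - x by rewrite subr_gt0.
  have : (1 - x)^-1 < (Num.bound (1 - x)^-1)%:R by rewrite archi_boundP// invr_ge0 ltW.
  set m := Num.bound _ => mx; rewrite ltrBrDr -ltrBrDl.
  rewrite -[ltRHS]invrK ltf_pV2 ?posrE ?invr_gt0//.
  by rewrite (lt_trans mx)// ltr_nat.
have fc (t : R) : 0 <= t < 1 -> {for t, continuous (fun t : R => modulus (f t%:C%C))}.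
  move=> /andP[t0 t1]; apply/(@cvgrPdist_lt _ R^o) => e e0.
  have mt : modulus t%:C%C < 1 by rewrite modulus_real ger0_norm.
  have [d [d0 dP]] := cderiv_continuous (fd mt).1 e0.
  exists d => //= y; rewrite /ball_/= => ty.
  have := dP (y - t)%:C%C; rewrite modulus_real distrC => /(_ ty).
  rewrite rmorphB subrKC; apply: le_lt_trans; rewrite distrC.
  rewrite ler_norml; apply/andP; split.
    by rewrite lerNl opprB lerBlDr modulusBC (le_trans _ (modulusD _ _))// subrK.
  by rewrite lerBlDr (le_trans _ (modulusD _ _))// subrK.
have cvb j : bint (uk k) j @[k --> \oo] --> bint 1 j.
  rewrite /bint EU; apply: ge0_nondecreasing_set_cvg_integral => //.
  - move=> k; apply/measurable_EFinP; apply: continuous_on_measurable.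
      exact: measurable_itv.
    move=> t /=; rewrite in_itv/= => /andP[t0 t1]; apply: cvgM.
      exact: exprn_continuous.
    by apply: fc; have := uk0 k; lra.
  - move=> k t /=; rewrite in_itv/= => /andP[t0 t1].
    by rewrite lee_fin mulr_ge0// exprn_ge0// ltW.
have bfin j : (bint 1 j < +oo)%E.
  pose a := 2 * pi * M `^ p + 1.
  have a0 : 0 < a by rewrite ltr_wpDl// mulr_ge0 ?powR_ge0// ltW// two_pi_gt0.
  apply: (@le_lt_trans _ _ (K0 * a `^ p^-1 * (n j)%:R `^ (- tau))%:E); last exact: ltry.
  rewrite -(cvg_lim (@ereal_hausdorff R) (cvb j)).
  apply: lime_le; first by apply/cvg_ex; eexists; exact: cvb.
  apply: nearW => k; rewrite -ruk; apply: b_le => //.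
  have r01 : 0 < rk k < 1 by have := rkI k; lra.
  apply: le_trans (A_le r01 _) _; first by rewrite ltr0n.
  by rewrite lee_fin (le_trans (fM r01))// lerDl.
split=> //.
have half j : exists k0, forall k, (k0 <= k)%N ->
    fine (bint 1 j) <= 2 * fine (bint (uk k) j).
  have b0 : 0 <= fine (bint 1 j) by rewrite fine_ge0.
  have cv' : bint (uk k) j @[k --> \oo] --> (fine (bint 1 j))%:E.
    by rewrite fineK; [exact: cvb|rewrite ge0_fin_numE].
  have /cvgR_dist cv : (fun k => fine (bint (uk k) j)) @ \oo --> fine (bint 1 j).
    exact: fine_cvg cv'.
  move: b0; rewrite le_eqVlt => /predU1P[<-|b0].
    by exists 0%N => k _; rewrite mulr_ge0// fine_ge0.
  have [k0 k0P] := cv _ (divr_gt0 b0 (ltr0n _ 2)); exists k0 => k /k0P /=.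
  by rewrite ltr_norml => /andP[h1 h2]; lra.
have [k kP] : exists k0, forall k, (k0 <= k)%N -> forall j, (j < J)%N ->
    fine (bint 1 j) <= 2 * fine (bint (uk k) j).
  elim: J => [|J' [k1 h1]]; first by exists 0%N.
  have [k2 h2] := half J'; exists (maxn k1 k2) => k.
  rewrite geq_max => /andP[kk1 kk2] j; rewrite ltnS leq_eqVlt => /predU1P[->|jJ].
    exact: h2.
  exact: h1.
have {kP} := kP k (leqnn k) => kP.
rewrite -[leRHS]mulrA -[X in 2 `^ p * X]mulrA -[X in 2 `^ p * (_ * X)]mulrA.
have := rho_sum J (rkI k); rewrite ruk => rs.
apply: le_trans (ler_wpM2l (powR_ge0 _ _) rs).
rewrite mulr_sumr; apply: ler_sum_nat => j /andP[_ jJ].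
have N0 := powR_ge0 (n j)%:R tau.
have b1 : 0 <= fine (bint 1 j) by rewrite fine_ge0.
have b2 : 0 <= fine (bint (uk k) j) by rewrite fine_ge0.
rewrite -powRM// ?mulr_ge0//.
apply: ge0_ler_powR; rewrite ?nnegrE ?mulr_ge0// ?(ltW p0)//.
by rewrite mulrCA ler_wpM2l// kP.
Qed.

End LacunarySum.
End FixedFunction.
End CoefficientBound.

(** * Riesz products *)

Section TrigonometricSums.
Context {R : realType}.
Local Notation C := R[i].
Local Notation mu := (@lebesgue_measure R).

Lemma polar_form (c : C) : exists phi, c = circle_point (modulus c) phi.
Proof.
have [c0|c0] := eqVneq (modulus c) 0.
  by exists 0; move/eqP: (c0); rewrite modulus_eq0 c0 => /eqP ->; rewrite /circle_point !mul0r.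
have cp : 0 < modulus c by rewrite lt_def c0 modulus_ge0.
pose x := complex.Re c / modulus c.
have x1 : -1 <= x <= 1.
  rewrite -ler_norml normrM normfV (gtr0_norm cp) ler_pdivrMr// mul1r.
  exact: normr_Re_le.
have cx : modulus c * x = complex.Re c by rewrite mulrC divfK// gt_eqF.
have sx : modulus c * Num.sqrt (1 - x ^+ 2) = `|complex.Im c|.
  rewrite -[modulus c in LHS](gtr0_norm cp) -sqrtr_sqr -sqrtrM ?sqr_ge0//.
  rewrite mulrBr mulr1 -exprMn cx modulus_sqr addrAC subrr add0r sqrtr_sqr//.
have cK : cos (acos x) = x by rewrite acosK// in_itv/=.
have [i0|i0] := leP 0 (complex.Im c).
  exists (acos x); rewrite /circle_point cK cx sin_acos// sx ger0_norm//.
  by case: c {c0 cp x x1 cx sx cK} i0.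
exists (- acos x); rewrite /circle_point cosN sinN cK cx sin_acos// mulrN sx.
rewrite ltr0_norm// opprK.
by case: c {c0 cp x x1 cx sx cK} i0.
Qed.

(** Cosines with free phases rather than exponentials: products of two such terms are again sums of
    such terms, and all integrals stay real. *)
Definition trig_poly (s : seq (R * nat * R)) (x : R) :=
  \sum_(q <- s) q.1.1 * cos (q.1.2%:R * x + q.2).

Definition trig_deg_lt N (h : R -> R) := exists s : seq (R * nat * R),
  all (fun q => q.1.2 < N)%N s /\ h = trig_poly s.

Lemma trig_poly_continuous s : continuous (trig_poly s).
Proof.
apply: continuous_sum_fun => q x; apply: cvgM; first exact: cvg_cst.
exact: continuous_cos_affine.
Qed.

Lemma trig_deg_continuous N h : trig_deg_lt N h -> continuous h.
Proof. by move=> [s [_ ->]]; exact: trig_poly_continuous. Qed.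

Lemma trig_deg_mono N N' h : (N <= N')%N -> trig_deg_lt N h -> trig_deg_lt N' h.
Proof.
move=> NN [s [sN ->]]; exists s; split=> //; apply: sub_all sN => q /leq_trans; exact.
Qed.

Lemma trig_degD N h k : trig_deg_lt N h -> trig_deg_lt N k ->
  trig_deg_lt N (fun x => h x + k x).
Proof.
move=> [s [sN ->]] [t [tN ->]]; exists (s ++ t); rewrite all_cat sN tN; split=> //.
by apply/funext => x; rewrite /trig_poly big_cat.
Qed.

Lemma cosM_cos (A B : R) : cos A * cos B = 2^-1 * cos (A + B) + 2^-1 * cos (A - B).
Proof. by rewrite cosD cosB; field. Qed.

Lemma trig_deg_mulcos N n a phi h : trig_deg_lt N h ->
  trig_deg_lt (N + n) (fun x => h x * (a * cos (n%:R * x + phi))).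
Proof.
move=> [s [+ ->]]; elim: s => [|[[b k] psi] s ih].
  move=> _; exists [::]; split=> //; apply/funext => x.
  by rewrite /trig_poly big_nil mul0r.
move=> /= /andP[kN /ih{}ih].
rewrite (_ : (fun x => _) = (fun x => b * cos (k%:R * x + psi) * (a * cos (n%:R * x + phi)) +
   trig_poly s x * (a * cos (n%:R * x + phi)))); last first.
  by apply/funext => x; rewrite /trig_poly big_cons mulrDl.
apply: trig_degD => //.
have [nk|kn] := leqP n k.
  exists [:: (a * b / 2, (k + n)%N, psi + phi); (a * b / 2, (k - n)%N, psi - phi)].
  split=> /=; first by rewrite ltn_add2r kN/= andbT (leq_ltn_trans (leq_subr _ _))// ltn_addr.
  apply/funext => x; rewrite /trig_poly !big_cons big_nil addr0/=.
  rewrite mulrACA cosM_cos natrD natrB// [b * a]mulrC.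
  rewrite (_ : _ + _ + (_ + _) = (k%:R + n%:R) * x + (psi + phi)); last by ring.
  rewrite (_ : k%:R * x + psi - _ = (k%:R - n%:R) * x + (psi - phi)); last by ring.
  by ring.
exists [:: (a * b / 2, (k + n)%N, psi + phi); (a * b / 2, (n - k)%N, phi - psi)].
split=> /=.
  rewrite ltn_add2r kN/= andbT (leq_ltn_trans (leq_subr _ _))// -[X in (X < _)%N]add0n.
  by rewrite ltn_add2r (leq_ltn_trans _ kN).
apply/funext => x; rewrite /trig_poly !big_cons big_nil addr0/=.
rewrite mulrACA [cos _ * _]mulrC cosM_cos natrD natrB ?(ltnW kn)// [b * a]mulrC.
rewrite (_ : _ + _ + (_ + _) = (k%:R + n%:R) * x + (psi + phi)); last by ring.
rewrite (_ : n%:R * x + phi - _ = (n%:R - k%:R) * x + (phi - psi)); last by ring.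
by ring.
Qed.

(** The frequencies n + k and n - k of the product are positive when k < N <= n, so every term
    integrates to 0. *)
Lemma trig_deg_int0 N n a phi h : trig_deg_lt N h -> (N <= n)%N -> (0 < n)%N ->
  circle_int (fun x => h x * (a * cos (n%:R * x + phi))) = 0.
Proof.
move=> [s [sN ->]] Nn n0.
rewrite (eq_circle_int (k := fun x => \sum_(q <- s) (2^-1 * (a * q.1.1)) *
   (cos ((n + q.1.2)%:R * x + (phi + q.2)) + cos ((n%:R - q.1.2%:R) * x + (phi - q.2))))).
  rewrite circle_int_sum; last first.
    move=> q x; apply: cvgM; first exact: cvg_cst.
    by apply: cvgD; exact: continuous_cos_affine.
  rewrite big_seq big1// => q qs; have qn := leq_trans (allP sN _ qs) Nn.
  rewrite circle_intZ; last first.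
    by move=> x; apply: cvgD; exact: continuous_cos_affine.
  rewrite circle_intD; try exact: continuous_cos_affine.
  rewrite circle_int_cos ?ltn_addr// -natrB ?(ltnW qn)//.
  by rewrite circle_int_cos ?subn_gt0// addr0 mulr0.
move=> x; rewrite /trig_poly mulr_suml; apply: eq_bigr => -[[b k] psi] _ /=.
rewrite mulrACA [cos _ * _]mulrC cosM_cos natrD.
rewrite (_ : _ + _ + (_ + _) = (n%:R + k%:R) * x + (phi + psi)); last by ring.
rewrite (_ : n%:R * x + phi - _ = (n%:R - k%:R) * x + (phi - psi)); last by ring.
by ring.
Qed.

Section Riesz.
Variables (n : nat -> nat) (x phi : nat -> R).
Hypotheses (n0 : (0 < n 0)%N) (n2 : forall j, (2 * n j <= n j.+1)%N).
Hypothesis xle : forall j, `|x j| <= 2^-1.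

Let npos j : (0 < n j)%N.
Proof. by elim: j => // j ih; rewrite (leq_trans _ (n2 j))// muln_gt0. Qed.

Let y j t := x j * cos ((n j)%:R * t + phi j).
Let riesz J t := \prod_(0 <= j < J) (1 + y j t).

(** Multiplication by the factor of frequency n_J keeps all frequencies below n_J + n_J <= n_(J+1).
    Hence each new factor is orthogonal to the previous product and leaves the mean unchanged. *)
Let riesz_deg J : trig_deg_lt (n J) (riesz J).
Proof.
elim: J => [|J ih].
  exists [:: (1, 0%N, 0)]; split; first by rewrite /= n0.
  apply/funext => t; rewrite /riesz big_nil /trig_poly big_cons big_nil/=.
  by rewrite mul0r add0r cos0 mulr1 addr0.
rewrite (_ : riesz J.+1 = (fun t => riesz J t + riesz J t * (x J * cos ((n J)%:R * t + phi J)))).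
  apply: trig_degD.
    by apply: trig_deg_mono ih; rewrite (leq_trans _ (n2 J))// leq_pmull.
  by apply: trig_deg_mono (trig_deg_mulcos _ _ _ ih); rewrite addnn -mul2n.
by apply/funext => t; rewrite /riesz big_nat_recr//= mulrDr mulr1.
Qed.

Let riesz_int J : circle_int (riesz J) = 2 * pi.
Proof.
elim: J => [|J ih].
  rewrite (eq_circle_int (k := fun=> 1)) ?circle_int_cst ?mul1r//.
  by move=> t; rewrite /riesz big_nil.
rewrite (eq_circle_int (k := fun t => riesz J t + riesz J t * (x J * cos ((n J)%:R * t + phi J)))).
  have cJ := trig_deg_continuous (riesz_deg J).
  rewrite circle_intD ?ih ?(trig_deg_int0 _ _ (riesz_deg J))// ?addr0//.
  exact: trig_deg_continuous (trig_deg_mulcos _ _ _ (riesz_deg J)).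
by move=> t; rewrite /riesz big_nat_recr//= mulrDr mulr1.
Qed.

(** With v = u - 2 u^2, exp v <= 1/(1 - v), and (1 - v)(1 + u) = 1 + u^2 (1 + 2 u) >= 1. *)
Lemma expR_le_quadratic (u : R) : `|u| <= 2^-1 -> expR u <= (1 + u) * expR (2 * u ^+ 2).
Proof.
rewrite ler_norml => /andP[u1 u2].
rewrite -ler_pdivrMr ?expR_gt0// -expRN -expRD.
pose v := u - 2 * u ^+ 2; rewrite -/v.
have ev : 1 - v <= expR (- v) by have := expR_ge1Dx (- v).
have v1 : 0 < 1 - v by rewrite /v; nra.
have -> : expR v = (expR (- v))^-1 by rewrite expRN invrK.
apply: (@le_trans _ _ (1 - v)^-1).
  by rewrite lef_pV2 ?posrE ?expR_gt0.
by rewrite -[_^-1]mul1r ler_pdivrMr// /v; nra.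
Qed.

(** Factor by factor, exp(y_j) <= (1 + y_j) exp(2 x_j^2). The first factors multiply to the Riesz
    product, of integral 2 pi. *)
Lemma lacunary_expR_int J :
  circle_int (fun t => expR (\sum_(0 <= j < J) x j * cos ((n j)%:R * t + phi j))) <=
  2 * pi * expR (2 * \sum_(0 <= j < J) x j ^+ 2).
Proof.
rewrite -(riesz_int J) mulrC.
have cJ := trig_deg_continuous (riesz_deg J).
rewrite -circle_intZ//; apply: le_circle_int.
- move=> t; apply: continuous_comp; last exact: continuous_expR.
  apply: (@continuous_sum_fun _ _ _ (fun j t => x j * cos ((n j)%:R * t + phi j))).
  by move=> j s; apply: cvgM; [exact: cvg_cst|exact: continuous_cos_affine].
- by move=> t; apply: cvgM; [exact: cvg_cst|exact: cJ].
move=> t _; rewrite -/(y _ t).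
have yx j : y j t ^+ 2 <= x j ^+ 2.
  by rewrite /y exprMn ler_piMr ?sqr_ge0// -real_normK ?num_real// exprn_ile1// cos_max.
have yle j : `|y j t| <= 2^-1.
  rewrite /y normrM (le_trans _ (xle j))// ler_piMr// cos_max//.
rewrite mulr_sumr expR_sum [leRHS]mulrC expR_sum /riesz -big_split/=.
apply: ler_prod => j _; rewrite expR_ge0/=.
apply: le_trans (expR_le_quadratic (yle j)) _.
have := yle j; rewrite ler_norml => /andP[y1 y2].
rewrite ler_wpM2l//; first lra.
by rewrite ler_expR ler_wpM2l.
Qed.

End Riesz.

Lemma powR_le_expR (u p : R) : 0 <= u -> 0 < p -> u `^ p <= p `^ p * expR u.
Proof.
move=> u0 p0.
have -> : expR u = expR (u / p) `^ p by rewrite -expRM divfK// gt_eqF.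
rewrite -powRM ?(ltW p0) ?expR_ge0//.
apply: ge0_ler_powR; rewrite ?nnegrE ?mulr_ge0 ?expR_ge0 ?(ltW p0)//.
rewrite -ler_pdivrMl// mulrC (le_trans _ (expR_ge1Dx _))// lerDr//.
Qed.

(** Division by 2 s makes the sum of the x_j^2 at most 1/4, which gives both |x_j| <= 1/2 and an
    exponent 2 * 1/4 <= 1 in [lacunary_expR_int]. Then |S|^p <= p^p exp|S| <= p^p (exp S + exp(-S)),
    and each exponential has integral at most 2 pi e. *)
Lemma lacunary2_real (n : nat -> nat) (a phi : nat -> R) (p s : R) J :
  (0 < n 0)%N -> (forall j, (2 * n j <= n j.+1)%N) -> 0 < p -> 0 < s ->
  (forall J, \sum_(0 <= j < J) a j ^+ 2 <= s ^+ 2) ->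
  circle_int (fun t => `|\sum_(0 <= j < J) a j * cos ((n j)%:R * t + phi j)| `^ p) <=
  (2 * s) `^ p * p `^ p * (4 * pi * expR 1).
Proof.
move=> n0 n2 p0 s0 as2.
pose x j := a j / (2 * s).
have s20 : 0 < 2 * s by rewrite mulr_gt0.
have xs J' : \sum_(0 <= j < J') x j ^+ 2 <= 4^-1.
  under eq_bigr do rewrite expr_div_n.
  rewrite -mulr_suml ler_pdivrMr ?exprn_gt0//.
  by rewrite exprMn mulrA (_ : 4^-1 * 2 ^+ 2 = 1) ?mul1r//; field.
have xle j : `|x j| <= 2^-1.
  have : x j ^+ 2 <= 2^-1 ^+ 2.
    apply: le_trans (le_trans (xs j.+1) _); last by rewrite expr2; lra.
    by rewrite big_nat_recr//= lerDr sumr_ge0// => i _; exact: sqr_ge0.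
  by rewrite -[X in X <= _]real_normK ?num_real// ler_pXn2r// nnegrE.
pose S t := \sum_(0 <= j < J) x j * cos ((n j)%:R * t + phi j).
have cS (u : nat -> R) : continuous (fun t : R => \sum_(0 <= j < J) u j * cos ((n j)%:R * t + phi j)).
  apply: (@continuous_sum_fun _ _ _ (fun j t => u j * cos ((n j)%:R * t + phi j))).
  by move=> j t; apply: cvgM; [exact: cvg_cst|exact: continuous_cos_affine].
have cE (u : nat -> R) : continuous (fun t : R => expR (\sum_(0 <= j < J) u j * cos ((n j)%:R * t + phi j))).
  by move=> t; apply: continuous_comp; [exact: cS|exact: continuous_expR].
have e1 : circle_int (fun t => expR (S t)) <= 2 * pi * expR 1.
  apply: le_trans (lacunary_expR_int phi n0 n2 xle J) _.
  rewrite ler_wpM2l ?mulr_ge0 ?pi_ge0// ler_expR; have := xs J; lra.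
have xle' j : `|- x j| <= 2^-1 by rewrite normrN.
have e2 : circle_int (fun t => expR (\sum_(0 <= j < J) (- x j) * cos ((n j)%:R * t + phi j))) <= 2 * pi * expR 1.
  apply: le_trans (lacunary_expR_int phi n0 n2 xle' J) _.
  rewrite ler_wpM2l ?mulr_ge0 ?pi_ge0// ler_expR.
  by under eq_bigr do rewrite sqrrN; have := xs J; lra.
apply: (@le_trans _ _ (circle_int (fun t => (2 * s) `^ p * p `^ p *
   (expR (S t) + expR (\sum_(0 <= j < J) (- x j) * cos ((n j)%:R * t + phi j)))))).
  apply: le_circle_int.
  - apply: continuous_powR_ge0 => //= t; apply: cvg_norm; exact: cS.
  - by move=> t; apply: cvgM; [exact: cvg_cst|apply: cvgD; exact: cE].
  move=> t _.
  have aS : \sum_(0 <= j < J) a j * cos ((n j)%:R * t + phi j) = 2 * s * S t.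
    rewrite /S mulr_sumr; apply: eq_bigr => j _.
    by rewrite /x mulrA [2 * s * _]mulrC divfK// gt_eqF.
  have nS : \sum_(0 <= j < J) (- x j) * cos ((n j)%:R * t + phi j) = - S t.
    by rewrite /S -sumrN; apply: eq_bigr => j _; rewrite mulNr.
  rewrite aS nS normrM (gtr0_norm s20) (powRM p (ltW s20) (normr_ge0 _)).
  rewrite -[leRHS]mulrA ler_wpM2l ?powR_ge0//.
  apply: le_trans (powR_le_expR (normr_ge0 _) p0) _.
  rewrite ler_wpM2l ?powR_ge0//; have [S0|S0] := ger0P (S t).
    by rewrite lerDl expR_ge0.
  by rewrite lerDr expR_ge0.
rewrite circle_intZ; last by move=> t; apply: cvgD; exact: cE.
rewrite ler_wpM2l ?mulr_ge0 ?powR_ge0// circle_intD; try exact: cE.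
apply: le_trans (lerD e1 e2) _; rewrite le_eqVlt; apply/orP; left; apply/eqP; ring.
Qed.

Lemma powR_sum_le (p : R) (K : nat) (u : nat -> R) : 1 <= p -> (forall j, 0 <= u j) ->
  (\sum_(0 <= j < K) u j) `^ p <= K%:R `^ (p - 1) * \sum_(0 <= j < K) u j `^ p.
Proof.
move=> p1 u0.
have := @powR_jensen R nat (index_iota 0 K) u (fun=> 1) p p1 u0 (fun=> ler01).
under eq_bigr do rewrite mulr1; move=> /le_trans; apply.
under eq_bigr do rewrite mulr1; rewrite mulrC ler_wpM2r//.
  by apply: sumr_ge0 => i _; exact: powR_ge0.
by rewrite sumr_const_nat subn0.
Qed.

Lemma circle_term (c : C) (phi t : R) k : c = circle_point (modulus c) phi ->
  c * circle_point 1 t ^+ k =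
  Complex (modulus c * cos (k%:R * t + phi)) (modulus c * sin (k%:R * t + phi)).
Proof.
move=> ->; rewrite circle_pointX expr1n modulus_circle_point ger0_norm//.
by rewrite /circle_point; simpc; rewrite cosD sinD; congr Complex; ring.
Qed.

Lemma rcontinuousD (u v : R -> C) s : rcontinuous_at u s -> rcontinuous_at v s ->
  rcontinuous_at (fun x => u x + v x) s.
Proof.
move=> cu cv e e0.
have [d1 [d10 h1]] := cu _ (divr_gt0 e0 (ltr0n _ 2)).
have [d2 [d20 h2]] := cv _ (divr_gt0 e0 (ltr0n _ 2)).
exists (Num.min d1 d2); split; first by rewrite lt_min d10.
move=> x; rewrite lt_min => /andP[/h1 x1 /h2 x2].
rewrite opprD addrACA (le_lt_trans (modulusD _ _))//.
by rewrite [ltRHS](splitr e) ltrD.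
Qed.

Lemma rcontinuous_trig (c : nat -> C) (n : nat -> nat) (r : R) J t :
  rcontinuous_at (fun t => \sum_(0 <= j < J) c j * circle_point r t ^+ n j) t.
Proof.
have cX k : rcontinuous_at (fun t => circle_point r t ^+ k) t.
  elim: k => [|k ih]; first exact: rcontinuous_cst.
  rewrite (_ : (fun t => _) = (fun t => circle_point r t * circle_point r t ^+ k)).
    by apply: rcontinuousM => //; exact: rderiv_continuous (@rderiv_circle _ _ _).
  by apply/funext => u; rewrite exprS.
elim: J => [|J ih].
  rewrite (_ : (fun t => _) = (fun=> 0)); first exact: rcontinuous_cst.
  by apply/funext => u; rewrite big_nil.
rewrite (_ : (fun t => _) = (fun t => \sum_(0 <= j < J) c j * circle_point r t ^+ n j +
   c J * circle_point r t ^+ n J)).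
  by apply: rcontinuousD => //; apply: rcontinuousM => //; exact: rcontinuous_cst.
by apply/funext => u; rewrite big_nat_recr.
Qed.

Lemma lacunary2_Lp (n : nat -> nat) (c : nat -> C) (p s : R) J :
  (0 < n 0)%N -> (forall j, (2 * n j <= n j.+1)%N) -> 1 <= p -> 0 < s ->
  (forall J, \sum_(0 <= j < J) modulus (c j) ^+ 2 <= s ^+ 2) ->
  circle_int (fun t => modulus (\sum_(0 <= j < J) c j * circle_point 1 t ^+ n j) `^ p) <=
  2 `^ p * (2 * s) `^ p * p `^ p * (4 * pi * expR 1).
Proof.
move=> n0 n2 p1 s0 cs.
have p0 : 0 < p by lra.
have /choice[phi phiE] : forall j, exists a, c j = circle_point (modulus (c j)) a.
  by move=> j; exact: polar_form.
pose X t := `|\sum_(0 <= j < J) modulus (c j) * cos ((n j)%:R * t + phi j)|.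
(* The imaginary part is again a sum of cosines, its phases shifted by pi/2. *)
pose Y t := `|\sum_(0 <= j < J) modulus (c j) * cos ((n j)%:R * t + (phi j - pi / 2))|.
have X0 t : 0 <= X t by exact: normr_ge0.
have Y0 t : 0 <= Y t by exact: normr_ge0.
have cX (psi : nat -> R) : continuous (fun t : R => `|\sum_(0 <= j < J) modulus (c j) * cos ((n j)%:R * t + psi j)|).
  move=> t; apply: cvg_norm.
  apply: (@continuous_sum_fun _ _ _ (fun j t => modulus (c j) * cos ((n j)%:R * t + psi j))).
  by move=> j u; apply: cvgM; [exact: cvg_cst|exact: continuous_cos_affine].
have cXp : continuous (fun t => X t `^ p) by apply: continuous_powR_ge0 => //; exact: cX.
have cYp : continuous (fun t => Y t `^ p) by apply: continuous_powR_ge0 => //; exact: cX.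
have e1 := lacunary2_real phi J n0 n2 p0 s0 cs.
have e2 := lacunary2_real (fun j => phi j - pi / 2) J n0 n2 p0 s0 cs.
apply: (@le_trans _ _ (circle_int (fun t => 2 `^ (p - 1) * (X t `^ p + Y t `^ p)))).
  apply: le_circle_int.
  - apply: continuous_powR_ge0 => //.
    by apply: rcontinuous_modulus => t; exact: rcontinuous_trig.
  - by move=> t; apply: cvgM; [exact: cvg_cst|apply: cvgD; [exact: cXp|exact: cYp]].
  move=> t _.
  have le2 : modulus (\sum_(0 <= j < J) c j * circle_point 1 t ^+ n j) <=
     \sum_(0 <= i < 2) (if i == 0%N then X t else Y t).
    rewrite big_nat_recr//= big_nat1/= (le_trans (modulus_le_ReIm _))//.
    rewrite Re_sum Im_sum /X /Y lerD//.
      by rewrite le_eqVlt; apply/orP; left; apply/eqP; congr `|_|; apply: eq_bigr => j _;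
        rewrite (circle_term _ _ (phiE j)).
    rewrite le_eqVlt; apply/orP; left; apply/eqP; congr `|_|; apply: eq_bigr => j _.
    by rewrite (circle_term _ _ (phiE j))/= addrA cosBpihalf.
  have := @powR_sum_le p 2 (fun i => if i == 0%N then X t else Y t) p1.
  move=> H; have {}H := H (fun i => match i with 0 => X0 t | _.+1 => Y0 t end).
  apply: le_trans (le_trans _ H) _.
    apply: ge0_ler_powR; rewrite ?nnegrE ?(ltW p0)//.
    by apply: sumr_ge0 => i _; case: ifP.
  by rewrite big_nat_recr//= big_nat1/=.
rewrite circle_intZ; last first.
  by move=> t; apply: cvgD; [exact: cXp|exact: cYp].
rewrite circle_intD//.
have -> : 2 `^ p = 2 `^ (p - 1) * 2 :> R.
  by rewrite -[X in _ * X](@powRr1 R 2)// -powRDp// subrK.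
rewrite -!mulrA ler_wpM2l ?powR_ge0//.
by apply: le_trans (lerD e1 e2) _; rewrite -mulr2n -[_ *+ 2]mulr_natl -!mulrA.
Qed.

End TrigonometricSums.

(** * Lacunary trigonometric series *)

Section LacunarySeries.
Context {R : realType}.
Local Notation C := R[i].
Local Notation mu := (@lebesgue_measure R).

Lemma big_nat_mul_swap (V : nmodType) (s0 K : nat) (F : nat -> V) :
  \sum_(0 <= j < K * s0) F j = \sum_(0 <= r < s0) \sum_(0 <= i < K) F (s0 * i + r)%N.
Proof.
rewrite big_nat_mul exchange_big/=; apply: eq_bigr => i _.
rewrite -[X in index_iota X _]add0n big_addn mulSn addnK.
by apply: eq_bigr => r _; rewrite addnC mulnC.
Qed.

Lemma expr_ge1D (lam : R) N : 1 < lam -> 1 + N%:R * (lam - 1) <= lam ^+ N.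
Proof.
move=> l1; elim: N => [|N ih]; first by rewrite mul0r addr0 expr0.
rewrite exprS -natr1 mulrDl mul1r.
have N0 : 0 <= N%:R * (lam - 1) by rewrite mulr_ge0//; lra.
apply: (@le_trans _ _ (lam * (1 + N%:R * (lam - 1)))); last by rewrite ler_wpM2l//; lra.
move: N0; set x := _ * _ => x0; have : x <= lam * x by rewrite ler_peMl//; lra.
lra.
Qed.

Lemma exists_expr_ge2 (lam : R) : 1 < lam -> exists s0 : nat, (0 < s0)%N /\ 2 <= lam ^+ s0.
Proof.
move=> l1; have l0 : 0 < lam - 1 by rewrite subr_gt0.
have := archi_boundP (ltW (divr_gt0 ltr01 l0)); set N := Num.bound _ => NP.
have N1 : 1 < N%:R * (lam - 1) by move: NP; rewrite ltr_pdivrMr.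
exists N; split; first by case: (N) N1 => //; rewrite mul0r; lra.
by apply: le_trans (expr_ge1D N l1); lra.
Qed.

Lemma lacunary_gt0 (lam : R) (n : nat -> nat) : 1 < lam -> (0 < n 0)%N ->
  (forall j, lam * (n j)%:R <= (n j.+1)%:R) -> forall j, (0 < n j)%N.
Proof.
move=> l1 n0 ln; elim=> // j ih; rewrite -(ltr0n R) (lt_le_trans _ (ln j))//.
by rewrite mulr_gt0 ?ltr0n//; lra.
Qed.

Lemma lacunary_expr (lam : R) (n : nat -> nat) k j : 1 < lam ->
  (forall j, lam * (n j)%:R <= (n j.+1)%:R) -> lam ^+ k * (n j)%:R <= (n (j + k)%N)%:R.
Proof.
move=> l1 ln; elim: k => [|k ih]; first by rewrite expr0 mul1r addn0.
rewrite addnS exprS -mulrA (le_trans _ (ln _))// ler_wpM2l//; lra.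
Qed.

(** Riesz products require ratio at least 2. With lam^s0 >= 2, each residue class of indices modulo
    s0 gives a subsequence with this property; the s0 partial sums are recombined by convexity. *)
Lemma lacunary_Lp (lam p : R) : 1 < lam -> 1 <= p -> exists2 K, 0 < K &
  forall (n : nat -> nat) (c : nat -> C) (s : R) J, (0 < n 0)%N ->
    (forall j, lam * (n j)%:R <= (n j.+1)%:R) -> 0 <= s ->
    (forall J, \sum_(0 <= j < J) modulus (c j) ^+ 2 <= s ^+ 2) ->
    circle_int (fun t => modulus (\sum_(0 <= j < J) c j * circle_point 1 t ^+ n j) `^ p)
      <= K * s `^ p.
Proof.
move=> l1 p1; have p0 : 0 < p by lra.
have [s0 [s00 ls0]] := exists_expr_ge2 l1.
pose K0 := 2 `^ p * 2 `^ p * p `^ p * (4 * pi * expR 1) : R.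
have K00 : 0 < K0.
  by rewrite !mulr_gt0 ?powR_gt0 ?pi_gt0 ?expR_gt0.
have s0R : 0 < s0%:R :> R by rewrite ltr0n.
pose K := s0%:R `^ (p - 1) * (s0%:R * K0) : R.
exists K; first by rewrite /K mulr_gt0 ?powR_gt0// mulr_gt0.
move=> n c s J n0 ln s_ge0 cs.
have [s_eq0|s_neq0] := eqVneq s 0.
  have c0 j : c j = 0.
    apply/eqP; rewrite -modulus_eq0 -sqrf_eq0 eq_le sqr_ge0 andbT.
    apply: le_trans (le_trans (cs j.+1) _); last by rewrite s_eq0 expr0n.
    by rewrite big_nat_recr//= lerDr sumr_ge0// => i _; exact: sqr_ge0.
  rewrite s_eq0 powR0 ?(gt_eqF p0)// mulr0.
  rewrite (eq_circle_int (k := fun=> 0)) ?circle_int_cst ?mul0r//.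
  move=> t; rewrite big1 ?modulus0 ?powR0 ?(gt_eqF p0)// => j _.
  by rewrite c0 mul0r.
have s_gt0 : 0 < s by rewrite lt_def s_neq0.
(* Extension by 0 allows J to be replaced by J * s0, which splits evenly into the residue
   classes. *)
pose c' j := if (j < J)%N then c j else 0.
pose P r t := \sum_(0 <= i < J) c' (s0 * i + r)%N * circle_point 1 t ^+ n (s0 * i + r)%N.
have cP (r : nat) : continuous (fun t : R => modulus (P r t)).
  apply: rcontinuous_modulus => t.
  exact: (@rcontinuous_trig _ (fun i => c' (s0 * i + r)%N) (fun i => n (s0 * i + r)%N)).
have cPp r : continuous (fun t : R => modulus (P r t) `^ p).
  by apply: continuous_powR_ge0 => // t; exact: modulus_ge0.
have sumE (V : nmodType) (F : C -> nat -> V) : (forall j, F 0 j = 0) ->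
    \sum_(0 <= j < J) F (c j) j = \sum_(0 <= j < J * s0) F (c' j) j.
  move=> F0; have JJ : (J <= J * s0)%N by rewrite leq_pmulr.
  rewrite (big_cat_nat (leq0n J) JJ)/=.
  have -> : \sum_(J <= i < J * s0) F (c' i) i = 0.
    rewrite big_nat_cond big1// => i /andP[/andP[Ji _] _].
    by rewrite /c' ltnNge Ji/=.
  by rewrite addr0 !big_mkord; apply: eq_bigr => j _; rewrite /c' ltn_ord.
have sumP t : \sum_(0 <= j < J) c j * circle_point 1 t ^+ n j = \sum_(0 <= r < s0) P r t.
  rewrite (sumE _ (fun c j => c * circle_point 1 t ^+ n j)) => [|j]; last by rewrite mul0r.
  exact: big_nat_mul_swap.
have c's r I : (r < s0)%N -> \sum_(0 <= i < I) modulus (c' (s0 * i + r)%N) ^+ 2 <= s ^+ 2.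
  move=> rs0.
  apply: (@le_trans _ _ (\sum_(0 <= j < I * s0) modulus (c' j) ^+ 2)).
    rewrite big_nat_mul_swap [leRHS](bigD1_seq r)/= ?iota_uniq ?mem_index_iota//.
    by rewrite lerDl sumr_ge0// => i _; apply: sumr_ge0 => k _; exact: sqr_ge0.
  apply: le_trans (cs (I * s0)%N); apply: ler_sum => j _; rewrite /c'; case: ifP => // _.
  by rewrite modulus0 expr0n sqr_ge0.
have Pint r : (r < s0)%N -> circle_int (fun t => modulus (P r t) `^ p) <= K0 * s `^ p.
  move=> rs0.
  apply: le_trans (@lacunary2_Lp _ (fun i => n (s0 * i + r)%N) (fun i => c' (s0 * i + r)%N)
    p s J _ _ p1 s_gt0 (fun I => c's r I rs0)) _.
  - exact: lacunary_gt0 ln _.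
  - move=> i; rewrite -(ler_nat R) natrM mulnS [(s0 + _)%N]addnC addnAC.
    apply: le_trans (lacunary_expr s0 _ l1 ln).
    by rewrite ler_wpM2r.
  rewrite (@powRM _ 2 s p) ?ler0n ?(ltW s_gt0)// /K0 le_eqVlt; apply/orP; left; apply/eqP; ring.
apply: (@le_trans _ _ (circle_int (fun t => s0%:R `^ (p - 1) *
   \sum_(0 <= r < s0) modulus (P r t) `^ p))).
  apply: le_circle_int.
  - apply: continuous_powR_ge0 => //.
    by apply: rcontinuous_modulus => t; exact: rcontinuous_trig.
  - move=> t; apply: cvgM; first exact: cvg_cst.
    by apply: (@continuous_sum_fun _ _ _ (fun r t => modulus (P r t) `^ p)) => r; exact: cPp.
  move=> t _; rewrite sumP.
  apply: le_trans (powR_sum_le _ p1 (fun r => modulus_ge0 (P r t))).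
  apply: ge0_ler_powR; rewrite ?nnegrE ?(ltW p0)// ?modulus_sum ?modulus_ge0//.
  by apply: sumr_ge0 => i _; exact: modulus_ge0.
rewrite circle_intZ; last first.
  by apply: (@continuous_sum_fun _ _ _ (fun r t => modulus (P r t) `^ p)) => r; exact: cPp.
rewrite /K -[leRHS]mulrA ler_wpM2l ?powR_ge0// circle_int_sum//.
rewrite -mulrA -[s0 in leRHS]subn0 mulr_natl -sumr_const_nat.
rewrite big_seq [leRHS]big_seq; apply: ler_sum => r; rewrite mem_index_iota => /andP[_ rs0].
exact: Pint.
Qed.

(** In the induction, the cross terms of the new summand with the old ones are cosines of positive
    frequency m_J - m_j, hence of mean 0. *)
Lemma trig_orthogonality (c : nat -> C) (m : nat -> nat) J :
  (forall j, (m j < m j.+1)%N) ->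
  circle_int (fun t => modulus (\sum_(0 <= j < J) c j * circle_point 1 t ^+ m j) ^+ 2) =
  2 * pi * \sum_(0 <= j < J) modulus (c j) ^+ 2.
Proof.
move=> mS; have mlt : forall i j, (i < j)%N -> (m i < m j)%N by exact: (homo_ltn ltn_trans).
have /choice[phi phiE] : forall j, exists a, c j = circle_point (modulus (c j)) a.
  by move=> j; exact: polar_form.
elim: J => [|J ih].
  rewrite big_nil mulr0 (eq_circle_int (k := fun=> 0)) ?circle_int_cst ?mul0r//.
  by move=> t; rewrite big_nil modulus0 expr0n.
pose D (j : nat) (t : R) := 2 * modulus (c J) * modulus (c j) *
   cos ((m J - m j)%N%:R * t + (phi J - phi j)).
have cD j : continuous (D j).
  by move=> t; apply: cvgM; [exact: cvg_cst|exact: continuous_cos_affine].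
have cS : continuous (fun t => modulus (\sum_(0 <= j < J) c j * circle_point 1 t ^+ m j) ^+ 2).
  have c1 : continuous (fun t => modulus (\sum_(0 <= j < J) c j * circle_point 1 t ^+ m j)).
    by apply: rcontinuous_modulus => t; exact: rcontinuous_trig.
  by move=> t; apply: (@cvgM _ R); exact: c1.
rewrite (eq_circle_int (k := fun t => modulus (\sum_(0 <= j < J) c j * circle_point 1 t ^+ m j) ^+ 2 +
   (\sum_(0 <= j < J) D j t + modulus (c J) ^+ 2))).
  have cDs : continuous (fun t => \sum_(0 <= j < J) D j t) by exact: continuous_sum_fun.
  rewrite circle_intD//; last by move=> t; apply: cvgD; [exact: cDs|exact: cvg_cst].
  rewrite circle_intD//; last by move=> t; exact: cvg_cst.
  rewrite ih circle_int_sum// circle_int_cst.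
  have -> : \sum_(0 <= j < J) circle_int (D j) = 0; last first.
    by rewrite add0r big_nat_recr//=; move: (2 * pi) => w; rewrite mulrDr [w * modulus _ ^+ 2]mulrC.
  rewrite big_seq big1// => j; rewrite mem_index_iota => /andP[_ jJ].
  rewrite circle_intZ; last exact: continuous_cos_affine.
  by rewrite circle_int_cos ?mulr0// subn_gt0 mlt.
move=> t; rewrite big_nat_recr//=; set S := \sum_(0 <= j < J) _.
rewrite (modulus_sqr S) (modulus_sqr (_ + _)) ReD ImD /D.
have -> : \sum_(0 <= j < J) 2 * modulus (c J) * modulus (c j) *
   cos ((m J - m j)%N%:R * t + (phi J - phi j)) =
   2 * (complex.Re S * (modulus (c J) * cos ((m J)%:R * t + phi J)) +
        complex.Im S * (modulus (c J) * sin ((m J)%:R * t + phi J))).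
  rewrite /S Re_sum Im_sum !mulr_suml -big_split mulr_sumr/=.
  rewrite big_seq [RHS]big_seq; apply: eq_bigr => j; rewrite mem_index_iota => /andP[_ jJ].
  rewrite (circle_term t (m j) (phiE j))/= natrB ?(ltnW (mlt _ _ jJ))//.
  rewrite (_ : ((m J)%:R - (m j)%:R) * t + (phi J - phi j) =
    ((m J)%:R * t + phi J) - ((m j)%:R * t + phi j)); last by ring.
  by rewrite cosB; ring.
rewrite (circle_term t (m J) (phiE J))/=.
have := cos2Dsin2 ((m J)%:R * t + phi J).
set cc := cos _; set ss := sin _; move=> css.
have -> : modulus (c J) ^+ 2 = modulus (c J) ^+ 2 * (cc ^+ 2 + ss ^+ 2) by rewrite css mulr1.
ring.
Qed.

Lemma circle_int_dominated (f_ : nat -> R -> R) (f : R -> R) (B : R) :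
  (forall J, continuous (f_ J)) -> continuous f -> (forall J t, `|f_ J t| <= B) ->
  (forall t, f_ J t @[J --> \oo] --> f t) ->
  circle_int (f_ J) @[J --> \oo] --> circle_int f.
Proof.
move=> cf_ cf fB ff.
have Tm : measurable (`[0%R, (2 * pi)%R]%classic : set R) by exact: measurable_itv.
have /= := @dominated_cvg _ _ R mu _ Tm (fun J t => (f_ J t)%:E) (EFin \o f) (fun=> B%:E).
have h1 : forall J, measurable_fun (`[0%R, (2 * pi)%R]%classic : set R) (fun t => (f_ J t)%:E).
  move=> J; apply/measurable_EFinP; apply: measurable_funTS.
  exact: continuous_measurable_fun.
move=> /(_ h1){h1}.
have h2 : forall x : R, x \in `[0%R, 2 * pi] -> (f_ J x)%:E @[J --> \oo] --> (EFin \o f) x.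
  by move=> x _; apply: cvg_EFin; [exact: nearW|exact: ff].
move=> /(_ h2){h2}.
have h3 : mu.-integrable (`[0%R, (2 * pi)%R]%classic : set R) (fun=> B%:E).
  by apply: continuous_integrable_circle (fun=> B) _ => t; exact: cvg_cst.
move=> /(_ (fun _ _ => erefl) h3) h4.
apply: fine_cvg.
have {}h4 := h4 (fun J x _ => fB J x).
move: h4; rewrite (circle_int_EFin cf).
by [].
Qed.

(** At a fixed radius r < 1 the sum of |a_j| r^(n_j) is a uniform bound for the partial sums, so
    dominated convergence applies. All integral estimates can then be made on finite sums. *)
Lemma circle_int_series_cvg (a : nat -> C) (n : nat -> nat) m g (q r : R) : 0 < q ->
  (forall j, (j <= n j + m)%N) ->
  (forall z, modulus z < 1 -> series (fun j => a j * z ^+ n j) @ \oo --> g z) ->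
  (forall t, rcontinuous_at (fun t => g (circle_point r t)) t) ->
  0 <= r < 1 ->
  circle_int (fun t => modulus (\sum_(0 <= j < J) a j * circle_point r t ^+ n j) `^ q) @[J --> \oo]
    --> circle_int (fun t => modulus (g (circle_point r t)) `^ q).
Proof.
move=> q0 jn ag cg r1.
have [B BP] := psradius_sum jn (cvg_psradius ag) r1.
have B0 : 0 <= B by have := BP 0%N; rewrite big_nil.
have /andP[r0 r1'] := r1.
apply: (@circle_int_dominated _ _ (B `^ q)).
- move=> J; apply: continuous_powR_ge0 => //.
  by apply: rcontinuous_modulus => t; exact: rcontinuous_trig.
- apply: continuous_powR_ge0 => //.
  exact: rcontinuous_modulus.
- move=> J t; rewrite ger0_norm ?powR_ge0//.
  apply: ge0_ler_powR; rewrite ?nnegrE ?(ltW q0) ?modulus_ge0//.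
  rewrite (le_trans (modulus_sum _ _ _))// (le_trans _ (BP J))//.
  by apply: ler_sum => j _; rewrite modulusM modulusX modulus_circle_point ger0_norm.
move=> t.
have cq : continuous (fun x : R => `|x| `^ q).
  by apply: continuous_powR_ge0 => // x; apply: cvg_norm; exact: cvg_id.
have := ag (circle_point r t); rewrite modulus_circle_point ger0_norm// => /(_ r1').
move=> /cvgC_modulus_to h.
have := cvg_comp _ _ h (cq (modulus (g (circle_point r t)))).
rewrite /= (ger0_norm (modulus_ge0 _)); apply: cvg_trans; apply: near_eq_cvg.
by apply: nearW => J /=; rewrite (ger0_norm (modulus_ge0 _)).
Qed.

Lemma circle_scale_term (a : nat -> C) (n : nat -> nat) (r t : R) J :
  \sum_(0 <= j < J) a j * circle_point r t ^+ n j =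
  \sum_(0 <= j < J) (a j * (r ^+ n j)%:C%C) * circle_point 1 t ^+ n j.
Proof.
by apply: eq_bigr => j _; rewrite circle_pointE exprMn -rmorphXn mulrA.
Qed.

End LacunarySeries.

(** * The mixed norm of a lacunary series *)

Section MixedIntegral.
Context {R : realType}.
Local Notation mu := (@lebesgue_measure R).
Local Notation I01 := (`[0%R, 1%R[%classic : set R).

Lemma powR_superadd (I : Type) (s : seq I) (x : I -> R) (e : R) : 1 <= e ->
  (forall i, 0 <= x i) -> \sum_(i <- s) x i `^ e <= (\sum_(i <- s) x i) `^ e.
Proof.
move=> e1 x0; have e0 : 0 < e by lra.
have two (a b : R) : 0 <= a -> 0 <= b -> a `^ e + b `^ e <= (a + b) `^ e.
  move=> a0 b0; have ab0 := addr_ge0 a0 b0.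
  rewrite -(mulr_powRB1 a0 e0) -(mulr_powRB1 b0 e0) -(mulr_powRB1 ab0 e0) mulrDl.
  by rewrite lerD// ler_wpM2l//; apply: ge0_ler_powR;
    rewrite ?nnegrE ?subr_ge0 ?lerDl ?lerDr.
elim: s => [|i s ih]; first by rewrite !big_nil powR_ge0.
rewrite !big_cons (le_trans _ (two _ _ (x0 i) (sumr_ge0 _ _)))// ?lerD2l//.
Qed.

Lemma expr_ge_bernoulli (r x : R) k : 0 <= x <= 1 -> 1 - x <= r -> 1 - k%:R * x <= r ^+ k.
Proof.
move=> /andP[x0 x1] xr; elim: k => [|k ih]; first by rewrite mul0r subr0 expr0.
have r0 : 0 <= r by lra.
have [h|h] := leP 0 (1 - k%:R * x); last first.
  by rewrite (le_trans _ (exprn_ge0 _ r0))// -natr1 mulrDl mul1r; lra.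
apply: (@le_trans _ _ ((1 - x) * (1 - k%:R * x))).
  rewrite -natr1 mulrDl mul1r.
  have : 0 <= x * (k%:R * x) by rewrite !mulr_ge0.
  set y := k%:R * x => ?; rewrite mulrBl mul1r; lra.
by rewrite exprS ler_pM//; lra.
Qed.

Variables (A : nat -> R) (n : nat -> nat) (phi : R -> R) (p q : R).
Hypotheses (p2 : 2 < p) (qE : q^-1 = 2^-1 - p^-1) (A0 : forall j, 0 <= A j).
Hypotheses (n_gt0 : forall j, (0 < n j)%N).

Let partial J r := \sum_(0 <= j < J) (A j * (n j)%:R * r ^+ (n j).-1) ^+ 2.
Hypothesis phi_lim : forall r, 0 <= r < 1 -> partial J r @[J --> \oo] --> phi r.

Let W r := (q / 2 + 1) * (1 - r ^+ 2) `^ (q / 2).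
Let S J := \sum_(0 <= j < J) ((n j)%:R `^ p^-1 * A j) `^ q.

Lemma conj_exponent_gt2 : 2 < q.
Proof.
have q0 : 0 < q.
  by rewrite -invr_gt0 qE subr_gt0 ltf_pV2 ?posrE//; move: p2; lra.
have : q^-1 < 2^-1 by rewrite qE ltrBlDr ltrDl invr_gt0; move: p2; lra.
by rewrite ltf_pV2 ?posrE.
Qed.

Let q2 := conj_exponent_gt2.

Lemma conj_exponentE : q / p = q / 2 - 1.
Proof.
have q0 : q != 0 by rewrite gt_eqF// (lt_trans _ q2).
have -> : p^-1 = 2^-1 - q^-1 by rewrite qE; ring.
by rewrite mulrBr divff.
Qed.

Let partial_ge0 J r : 0 <= partial J r.
Proof. by apply: sumr_ge0 => j _; exact: sqr_ge0. Qed.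

Let partial_mono r : {homo partial^~ r : J K / (J <= K)%N >-> J <= K}.
Proof. by apply: nondecreasing_series => j _ _; exact: sqr_ge0. Qed.

Let partial_le J r : 0 <= r < 1 -> partial J r <= phi r.
Proof.
move=> r01; have h := phi_lim r01.
rewrite -(cvg_lim (@Rhausdorff R) h); apply: nondecreasing_cvgn_le; first exact: partial_mono.
by apply/cvg_ex; eexists; exact: h.
Qed.

Let W_ge0 r : 0 <= W r.
Proof. by rewrite /W mulr_ge0 ?powR_ge0//; move: q2; lra. Qed.

Let mI01 : measurable I01. Proof. exact: measurable_itv. Qed.

Let partial_measurable J : measurable_fun I01 (partial J).
Proof.
apply: measurable_sum => j; apply: measurable_funX; apply: measurable_funM; first exact: measurable_cst.
exact: exprn_measurable.
Qed.

Let W_measurable : measurable_fun I01 W.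
Proof.
apply: measurable_funM; first exact: measurable_cst.
apply: (@measurableT_comp _ _ _ _ _ _ (fun x : R => x `^ (q / 2))); first exact: measurable_powR.
by apply: measurable_funB; [exact: measurable_cst|exact: exprn_measurable].
Qed.

Let f J r := partial J r `^ (q / 2) * W r.

Let f_measurable J : measurable_fun I01 (f J).
Proof.
apply: measurable_funM => //.
by apply: (@measurableT_comp _ _ _ _ _ _ (fun x : R => x `^ (q / 2))); [exact: measurable_powR|].
Qed.

Let phi_measurable : measurable_fun I01 (fun r => phi r `^ (q / 2) * W r).
Proof.
apply: measurable_funM => //.
apply: (@measurableT_comp _ _ _ _ _ _ (fun x : R => x `^ (q / 2))); first exact: measurable_powR.
apply: (measurable_fun_cvg partial_measurable) => r /=; rewrite in_itv/=; exact: phi_lim.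
Qed.

Let inv_powR (x s : R) : 0 < x -> x^-1 `^ s = x `^ (- s).
Proof. by move=> x0; rewrite -(powR_inv1 (ltW x0)) -powRrM mulN1r. Qed.

(** On E j, where 1 - r is of order 1/n_j, r^(n_j - 1) >= 1/2 and the weight is at least (4
    n_j)^(-q/2), while E j has length 1/(4 n_j). The powers of n_j total q - q/2 - 1 = q/p. Overlaps
    between the E j cost nothing, since superadditivity adds the terms at the same r. *)
Lemma mixed_int_lower J : ((S J)%:E <= (8 `^ q)%:E *
  \int[mu]_(r in I01) (phi r `^ (q / 2) * W r)%:E)%E.
Proof.
have q0 : 0 < q by rewrite (lt_trans _ q2).
have q20 : 0 <= q / 2 by lra.
pose c j := (A j * (n j)%:R / 2) `^ q * (4 * (n j)%:R) `^ (- (q / 2)).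
pose E j := `[1 - (2 * (n j)%:R)^-1, 1 - (4 * (n j)%:R)^-1]%classic : set R.
have nR j : 0 < (n j)%:R :> R by rewrite ltr0n.
have x2 j : 0 < ((2 * (n j)%:R)^-1 : R) <= 1.
  rewrite invr_gt0 mulr_gt0//= invf_le1 ?mulr_gt0//.
  by have : 1 <= (n j)%:R :> R; [rewrite ler1n|lra].
have x4 j : (4 * (n j)%:R)^-1 = (2 * (n j)%:R)^-1 / 2 :> R.
  by field; rewrite gt_eqF.
have x40 j : (0 : R) < (4 * (n j)%:R)^-1 by rewrite invr_gt0 mulr_gt0.
have EI j : E j `<=` I01.
  by move=> r; rewrite /E/= !in_itv/=; have := x2 j; have := x40 j; lra.
have c0 j : 0 <= c j by rewrite mulr_ge0 ?powR_ge0.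
have mE j : measurable (E j) by exact: measurable_itv.
have pw r : I01 r -> \sum_(0 <= j < J) c j * \1_(E j) r <= phi r `^ (q / 2) * W r.
  move=> /= r01; have {}r01 : 0 <= r < 1 by move: r01; rewrite in_itv.
  apply: (@le_trans _ _ (partial J r `^ (q / 2) * W r)); last first.
    rewrite ler_wpM2r//; apply: ge0_ler_powR; rewrite ?nnegrE//.
      exact: le_trans (partial_ge0 0 r) (partial_le 0 r01).
    exact: partial_le.
  apply: (@le_trans _ _ ((\sum_(0 <= j < J) ((A j * (n j)%:R * r ^+ (n j).-1) ^+ 2) `^ (q / 2)) * W r)); last first.
    rewrite ler_wpM2r//; apply: powR_superadd => [|j]; first by move: q2; lra.
    exact: sqr_ge0.
  rewrite mulr_suml; apply: ler_sum => j _; rewrite indicE.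
  have [rE|rE] := boolP (r \in E j); last by rewrite mulr0 mulr_ge0 ?powR_ge0.
  rewrite mulr1 /c ler_pM ?powR_ge0//.
    rewrite -powR_mulrn; last by rewrite !mulr_ge0 ?exprn_ge0//; case/andP: r01.
    rewrite -powRrM (_ : 2%:R * (q / 2) = q); last by field.
    have rh : 2^-1 <= r ^+ (n j).-1.
      move: rE; rewrite inE/E/= in_itv/= => /andP[rE _].
      apply: le_trans (expr_ge_bernoulli _ _ rE); last by have := x2 j; lra.
      have : (n j).-1%:R * (2 * (n j)%:R)^-1 <= (2^-1 : R).
        rewrite invfM mulrCA ler_piMr ?invr_ge0// ler_pdivrMr// mul1r ler_nat leq_pred//.
      lra.
    have An : 0 <= A j * (n j)%:R by rewrite mulr_ge0.
    apply: ge0_ler_powR; rewrite ?nnegrE ?(ltW q0)//.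
    - by rewrite mulr_ge0// invr_ge0.
    - by rewrite mulr_ge0// (le_trans _ rh)// invr_ge0.
    - by rewrite ler_wpM2l.
  rewrite /W -[leLHS]mul1r ler_pM ?powR_ge0//.
    by move: q2; lra.
  have /andP[r0 r1] := r01.
  rewrite -inv_powR ?mulr_gt0//; apply: ge0_ler_powR; rewrite ?nnegrE ?(ltW (x40 j))//.
    by rewrite subr_ge0 exprn_ile1// ltW.
  move: rE; rewrite inE/E/= in_itv/= => /andP[_ rE].
  have : r ^+ 2 <= r by rewrite expr2 ler_piMr// ltW.
  lra.
have cS : S J <= 8 `^ q * \sum_(0 <= j < J) c j * (4 * (n j)%:R)^-1.
  rewrite mulr_sumr; apply: ler_sum => j _; rewrite /c.
  set x : R := 4 * (n j)%:R; have x0 : 0 < x by rewrite mulr_gt0.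
  rewrite !mulrA -powRM ?ler0n ?mulr_ge0 ?invr_ge0//.
  have -> : 8 * (A j * (n j)%:R / 2) = A j * x by rewrite /x; field.
  rewrite (powRM _ (A0 j) (ltW x0)) -!mulrA -(powR_inv1 (ltW x0)) -!powRDp//.
  rewrite powRM ?powR_ge0// mulrC ler_wpM2l ?powR_ge0// -powRrM.
  have -> : q + (- (q / 2) - 1) = q / p by rewrite conj_exponentE; field.
  rewrite [_^-1 * _]mulrC; apply: ge0_ler_powR; rewrite ?nnegrE ?(ltW x0)//.
    by rewrite divr_ge0//; [exact: ltW|move: p2; lra].
  by rewrite /x ler_peMl//; lra.
apply: (@le_trans _ _ (8 `^ q * \sum_(0 <= j < J) c j * (4 * (n j)%:R)^-1)%:E).
  by rewrite lee_fin.
rewrite EFinM lee_pmul2l// ?lte_fin ?powR_gt0//.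
apply: (@le_trans _ _ (\int[mu]_(r in I01) (\sum_(0 <= j < J) c j * \1_(E j) r)%:E)%E); last first.
  apply: ge0_le_integral => //.
  - by move=> r _; rewrite lee_fin; apply: sumr_ge0 => j _; rewrite mulr_ge0// indicE.
  - apply/measurable_EFinP; apply: measurable_sum => j; apply: measurable_funM; first exact: measurable_cst.
    exact: (measurable_indic (mE j)).
  - exact/measurable_EFinP.
under eq_integral do rewrite -sumEFin.
rewrite ge0_integral_sum//; last 2 first.
- move=> j; apply/measurable_EFinP; apply: measurable_funM; first exact: measurable_cst.
  exact: (measurable_indic (mE j)).
- by move=> j r _; rewrite lee_fin mulr_ge0// indicE.
rewrite -sumEFin; apply: lee_sum => j _.
under eq_integral do rewrite EFinM.
rewrite ge0_integralZl_EFin//; last first.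
  by apply/measurable_EFinP; exact: (measurable_indic (mE j)).
have -> : (\int[mu]_(x in I01) (\1_(E j) x)%:E = mu (E j))%E.
  by rewrite (integral_indic mu mI01 (mE j)); congr (mu _); exact: setIidl (EI j).
rewrite lebesgue_measure_itv/= lte_fin.
have -> : (1 : R) - (2 * (n j)%:R)^-1 < 1 - (4 * (n j)%:R)^-1 by have := x2 j; rewrite x4; lra.
rewrite -EFinB -EFinM lee_fin ler_wpM2l//; rewrite x4; lra.
Qed.

Let int_expr_diff (k : nat) (c : R) : 0 <= c -> (0 < k)%N ->
  (\int[mu]_(r in I01) (c * (r ^+ k.-1 - r ^+ k))%:E <= (c * k%:R `^ (-2))%:E)%E.
Proof.
move=> c0 k0; have kR : 0 < k%:R :> R by rewrite ltr0n.
pose F r := c * (k%:R^-1 * r ^+ k - (k.+1)%:R^-1 * r ^+ k.+1).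
pose h r := c * (r ^+ k.-1 - r ^+ k).
have dF (r : R) : is_derive r 1 F (h r).
  have d1 := is_derive_expr k r; have d2 := is_derive_expr k.+1 r.
  apply: is_derive_eq; rewrite /GRing.scale/= /h.
  have k1R : k.+1%:R != 0 :> R by rewrite pnatr_eq0.
  rewrite !mulrA mulVf ?(gt_eqF kR)// mulVf// !mul1r//.
have ch : continuous h.
  move=> r; apply: cvgM; first exact: cvg_cst.
  by apply: cvgB; exact: exprn_continuous.
have h0 (r : R) : 0 <= r <= 1 -> 0 <= h r.
  move=> /andP[r0 r1]; rewrite mulr_ge0// subr_ge0 -[X in _ ^+ X <= _](prednK k0) exprS.
  by rewrite ler_piMl// exprn_ge0.
apply: (@le_trans _ _ (\int[mu]_(r in `[0%R, 1%R]) (h r)%:E)%E).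
  apply: ge0_subset_integral => //.
  - by apply/measurable_EFinP/measurable_funTS; exact: continuous_measurable_fun.
  - by move=> r /=; rewrite !in_itv/= => /andP[-> /ltW].
rewrite (FTC2_itv ler01 dF ch) lee_fin /F !expr1n !expr0n/= (gtn_eqF k0) !mulr0 subr0 mulr0 subr0 !mulr1.
rewrite ler_wpM2l// powRN (powR_mulrn 2)//.
rewrite -[leRHS]mul1r ler_pdivlMr ?exprn_gt0// -natr1.
have -> : (k%:R^-1 - (k%:R + 1)^-1) * k%:R ^+ 2 = k%:R / (k%:R + 1) :> R.
  by field; rewrite !gt_eqF// addr_gt0.
by rewrite ler_pdivrMr ?addr_gt0// mul1r lerDl.
Qed.

(** In Jensen's inequality the total weight contributes (L / (1 - r))^(q/2 - 1), which the weight (1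
    - r)^(q/2) cancels up to one factor 1 - r. Integrated against r^(n_j - 1), that factor gives
    n_j^(-2), and A_j^q n_j^(q/2 + 1 - 2) is the j-th term of S because q/2 - 1 = q/p. *)
Lemma mixed_int_upper (lam B : R) : 1 < lam -> (forall j, lam * (n j)%:R <= (n j.+1)%:R) ->
  (forall J, S J <= B) ->
  (\int[mu]_(r in I01) (phi r `^ (q / 2) * W r)%:E <=
    ((q / 2 + 1) * 2 `^ (q / 2) * (lam / (lam - 1)) `^ (q / 2 - 1) * B)%:E)%E.
Proof.
move=> l1 ln SB; set L := lam / (lam - 1); set K := (q / 2 + 1) * _ * _.
have q21 : 1 <= q / 2 by move: q2; lra.
have q0 : 0 < q / 2 by lra.
have K0 : 0 <= K by rewrite !mulr_ge0 ?powR_ge0//; lra.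
have L0 : 0 <= L by rewrite divr_ge0//; lra.
have fJ J : (\int[mu]_(r in I01) (f J r)%:E <= (K * B)%:E)%E.
  pose a j := A j `^ q * (n j)%:R `^ (q / 2 + 1).
  have a0 j : 0 <= a j by rewrite mulr_ge0 ?powR_ge0.
  pose h (j : nat) r := K * a j * (r ^+ (n j).-1 - r ^+ n j).
  have h0 j r : 0 <= r < 1 -> 0 <= h j r.
    move=> /andP[r0 r1]; rewrite mulr_ge0 ?(mulr_ge0 K0)// subr_ge0.
    by rewrite -[X in _ ^+ X <= _](prednK (n_gt0 j)) exprS ler_piMl ?exprn_ge0// ltW.
  have mh j : measurable_fun I01 (h j).
    apply: measurable_funM; first exact: measurable_cst.
    by apply: measurable_funB; exact: exprn_measurable.
  have fh r : 0 <= r < 1 -> f J r <= \sum_(0 <= j < J) h j r.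
    move=> /andP[r0 r1]; have r1' : 0 < 1 - r by rewrite subr_gt0.
    pose y j := A j ^+ 2 * (n j)%:R * r ^+ (n j).-1.
    pose w j := (n j)%:R * r ^+ (n j).-1.
    have y0 j : 0 <= y j by rewrite !mulr_ge0 ?sqr_ge0 ?exprn_ge0.
    have w0 j : 0 <= w j by rewrite mulr_ge0 ?exprn_ge0.
    have := powR_jensen (index_iota 0 J) q21 y0 w0.
    have -> : \sum_(j <- index_iota 0 J) y j * w j = partial J r.
      by apply: eq_bigr => j _; rewrite /y /w !exprMn; ring.
    set SY := \sum_(_ <- _) _; set SW := \sum_(_ <- _) w _ => jen.
    have SW0 : 0 <= SW by exact: sumr_ge0.
    (* 1 - r^2 <= 2 (1 - r); one factor 1 - r is split off for the final integration. *)
    have Wle : W r <= (q / 2 + 1) * 2 `^ (q / 2) * ((1 - r) `^ (q / 2 - 1) * (1 - r)).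
      rewrite /W -mulrA ler_wpM2l//; first lra.
      rewrite [_ * (1 - r)]mulrC (mulr_powRB1 (ltW r1') q0) -powRM ?(ltW r1')//.
      apply: ge0_ler_powR; rewrite ?nnegrE ?(ltW q0)//.
      - by rewrite subr_ge0 exprn_ile1// ltW.
      - by rewrite mulr_ge0// ltW.
      - rewrite expr2; have : 0 <= (1 - r) ^+ 2 by exact: sqr_ge0.
        by rewrite expr2; lra.
    have SWle : SW `^ (q / 2 - 1) * (1 - r) `^ (q / 2 - 1) <= L `^ (q / 2 - 1).
      rewrite -powRM ?(ltW r1')//; apply: ge0_ler_powR; rewrite ?nnegrE ?subr_ge0//.
        by rewrite mulr_ge0// ltW.
      rewrite -ler_pdivlMr//; apply: lacunary_geom_sum => //.
      by rewrite r0.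
    have SY0 : 0 <= SY by apply: sumr_ge0 => j _; rewrite mulr_ge0 ?powR_ge0.
    apply: (@le_trans _ _ (K * (SY * (1 - r)))).
      apply: le_trans (ler_pM (powR_ge0 _ _) (W_ge0 r) jen Wle) _.
      set k := (q / 2 + 1) * 2 `^ (q / 2).
      have -> : SY * SW `^ (q / 2 - 1) * (k * ((1 - r) `^ (q / 2 - 1) * (1 - r))) =
        (k * (SY * (1 - r))) * (SW `^ (q / 2 - 1) * (1 - r) `^ (q / 2 - 1)) by ring.
      have -> : K * (SY * (1 - r)) = (k * (SY * (1 - r))) * L `^ (q / 2 - 1) by rewrite /K -/k; ring.
      rewrite ler_wpM2l// mulr_ge0 ?mulr_ge0 ?powR_ge0 ?(ltW r1')//; lra.
    rewrite /h mulr_suml mulr_sumr; apply: ler_sum => j _.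
    rewrite -[leRHS]mulrA ler_wpM2l// /a /y /w.
    have -> : r ^+ (n j).-1 - r ^+ n j = r ^+ (n j).-1 * (1 - r).
      by rewrite mulrBr mulr1 -exprSr prednK.
    have nR : 0 < (n j)%:R :> R by rewrite ltr0n.
    rewrite !mulrA ler_wpM2r ?(ltW r1')// ler_wpM2r ?exprn_ge0//.
    rewrite powRDp// powRr1 ?ler0n// !mulrA ler_wpM2r//.
    rewrite powRM ?mulr_ge0 ?sqr_ge0 ?exprn_ge0// powRM ?sqr_ge0//.
    rewrite -powR_mulrn// -powRrM (_ : 2%:R * (q / 2) = q); last by field.
    rewrite -[leRHS]mulr1 ler_wpM2l ?mulr_ge0 ?powR_ge0//.
    have one : 1 `^ (q / 2) = 1 :> R by rewrite powR1.
    rewrite -[leRHS]one; apply: ge0_ler_powR; rewrite ?nnegrE ?(ltW q0) ?exprn_ge0//.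
    by rewrite exprn_ile1// ltW.
  apply: (@le_trans _ _ (\int[mu]_(r in I01) (\sum_(0 <= j < J) h j r)%:E)%E).
    apply: ge0_le_integral => //.
    - by move=> r _; rewrite lee_fin mulr_ge0 ?powR_ge0.
    - by apply/measurable_EFinP; exact: f_measurable.
    - by apply/measurable_EFinP; exact: measurable_sum.
  under eq_integral do rewrite -sumEFin.
  rewrite ge0_integral_sum//; last first.
    by move=> j; apply/measurable_EFinP; exact: mh.
  apply: (@le_trans _ _ (K * S J)%:E); last by rewrite lee_fin ler_wpM2l.
  rewrite mulr_sumr -sumEFin; apply: lee_sum => j _.
  apply: le_trans (int_expr_diff (mulr_ge0 K0 (a0 j)) (n_gt0 j)) _.
  have nR : 0 < (n j)%:R :> R by rewrite ltr0n.
  rewrite lee_fin -mulrA ler_wpM2l// /a -mulrA -powRDp//.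
  rewrite powRM ?powR_ge0// mulrC -powRrM.
  by rewrite (_ : q / 2 + 1 + -2 = p^-1 * q)// [p^-1 * q]mulrC conj_exponentE; field.
have mf J : measurable_fun I01 (fun r => (f J r)%:E).
  by apply/measurable_EFinP; exact: f_measurable.
have f0 J r : I01 r -> (0 <= (f J r)%:E)%E by move=> _; rewrite lee_fin mulr_ge0 ?powR_ge0.
have fmono r : I01 r -> {homo (fun J => (f J r)%:E) : J J' / (J <= J')%N >-> (J <= J')%E}.
  move=> _ J J' JJ'; rewrite lee_fin ler_wpM2r//.
  by apply: ge0_ler_powR; rewrite ?nnegrE ?(ltW q0)//; exact: partial_mono.
have cv := cvg_monotone_convergence mI01 mf f0 fmono (mu := mu).
have cq : continuous (fun x : R => `|x| `^ (q / 2)).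
  by apply: continuous_powR_ge0 => // x; apply: cvg_norm; exact: cvg_id.
have -> : (\int[mu]_(r in I01) (phi r `^ (q / 2) * W r)%:E =
    \int[mu]_(r in I01) limn (fun J => (f J r)%:E))%E.
  apply: eq_integral => r; rewrite inE/= in_itv/= => r01; apply/esym/cvg_lim => //.
  apply: cvg_EFin; first exact: nearW.
  apply: cvgM; last exact: cvg_cst.
  have := cvg_comp _ _ (phi_lim r01) (cq (phi r)).
  rewrite /= (ger0_norm (le_trans (partial_ge0 0 r) (partial_le 0 r01))).
  apply: cvg_trans; apply: near_eq_cvg; apply: nearW => J /=.
  by rewrite ger0_norm.
rewrite -(cvg_lim (@ereal_hausdorff R) cv).
apply: lime_le; first by apply/cvg_ex; eexists; exact: cv.
exact: nearW.
Qed.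

End MixedIntegral.

(** * Test functions *)

Section TestFunction.
Context {R : realType}.
Local Notation C := R[i].
Local Notation mu := (@lebesgue_measure R).
Local Notation O := (`]0%R, (2 * pi)%R[%classic : set R).
Local Notation I01 := (`[0%R, 1%R[%classic : set R).

(** For |w| = 1 and a real, |a - rho w| = |a w - rho|; taking out the factor a leaves the case x =
    rho/a of [circle_dist_lower]. *)
Lemma circle_dist_lower_scaled (a rho t : R) : 1 <= a -> 0 < rho < 1 -> 0 <= t <= 2 * pi ->
  a - rho <= modulus (a%:C%C - circle_point rho t) /\
  cdist t / 4 <= modulus (a%:C%C - circle_point rho t).
Proof.
move=> a1 /andP[r0 r1] t2; have a0 : 0 < a by lra.
pose x := rho / a.
have x01 : 0 <= x <= 1 by rewrite divr_ge0 ?(ltW r0) ?(ltW a0)//= ler_pdivrMr// mul1r; lra.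
have -> : modulus (a%:C%C - circle_point rho t) = a * modulus (circle_point 1 t - x%:C%C).
  rewrite -[a in RHS](gtr0_norm a0) -modulus_real -modulusM !modulusE.
  rewrite /circle_point /x; simpc => /=; congr Num.sqrt.
  have := cos2Dsin2 t; set c := cos t; set s := sin t => cs.
  have -> : (a - rho * c) ^+ 2 + (- (rho * s)) ^+ 2 =
    a ^+ 2 - 2 * a * rho * c + rho ^+ 2 * (c ^+ 2 + s ^+ 2) by ring.
  have -> : (a * (c - rho / a)) ^+ 2 + (a * s) ^+ 2 =
    a ^+ 2 * (c ^+ 2 + s ^+ 2) - 2 * a * rho * c + rho ^+ 2.
    by field; rewrite gt_eqF.
  by rewrite cs !mulr1.
have [h1 h2] := circle_dist_lower x01 t2; split.
  have -> : a - rho = a * (1 - x) by rewrite /x; field; rewrite gt_eqF.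
  by rewrite ler_wpM2l// ltW.
by rewrite (le_trans h2)// ler_peMl.
Qed.

(** With y = N d, the left side times d^(2 dl) is the smaller of y^(2 dl) and y^(2 dl - 1). Since dl
    <= 1/3, it is below both y^dl and y^(-dl), hence below 4 omega. *)
Lemma inv_max_le_omega (N d dl : R) : 0 < N -> 0 < d -> 0 < dl -> dl <= 3^-1 ->
  N `^ (2 * dl - 1) / Num.max N^-1 d <= 4 * (omega N d dl * d `^ (- (2 * dl))).
Proof.
move=> N0 d0 dl0 dl3; set M := Num.max _ _.
have M0 : 0 < M by rewrite lt_max d0 orbT.
have Nd0 : 0 < N * d by rewrite mulr_gt0.
have MN : M^-1 <= N by rewrite -[leRHS]invrK lef_pV2 ?posrE ?invr_gt0// le_max lexx.
have Md : M^-1 <= d^-1 by rewrite lef_pV2 ?posrE// le_max lexx orbT.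
suff h e : e = dl \/ e = - dl -> N `^ (2 * dl - 1) / M * d `^ (2 * dl) <= (N * d) `^ e.
  rewrite mulrA powRN ler_pdivlMr ?powR_gt0//.
  have [H|H] := omega_ge_min dl N0 d0; apply: le_trans H; apply: h; [by left|by right].
move=> ee.
have [x1|x1] := leP (N * d) 1.
  apply: (@le_trans _ _ ((N * d) `^ (2 * dl))).
    rewrite powRM ?(ltW N0) ?(ltW d0)// ler_wpM2r ?powR_ge0//.
    apply: le_trans (ler_wpM2l (powR_ge0 _ _) MN) _.
    rewrite -[X in _ * X](powRr1 (ltW N0)) -powRDp// subrK//.
  by apply: ger_powR; [rewrite Nd0 x1|case: ee => ->; lra].
apply: (@le_trans _ _ ((N * d) `^ (2 * dl - 1))).
  rewrite powRM ?(ltW N0) ?(ltW d0)// -mulrA ler_wpM2l ?powR_ge0//.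
  rewrite (powRDp (2 * dl) _ d0) mulrC ler_wpM2l ?powR_ge0//.
  by rewrite (powR_inv1 (ltW d0)).
by apply: ler_powR; [exact: ltW|case: ee => ->; lra].
Qed.

(** The tangent of 1/y at y = 2/N; it turns the lower bound for the moment into the integral of a
    polynomial. *)
Lemma affine_le_inv (N y : R) : 0 < y -> N - N ^+ 2 / 4 * y <= y^-1.
Proof.
move=> y0; rewrite -subr_ge0.
have -> : y^-1 - (N - N ^+ 2 / 4 * y) = (1 - N * y / 2) ^+ 2 / y by field; rewrite gt_eqF.
by rewrite divr_ge0 ?sqr_ge0 ?ltW.
Qed.

(** t^(k-1) lives where 1 - t is about 1/k, that is where 1 + 1/k - t is about 2/k, the point of
    tangency of [affine_le_inv]. The polynomial that results has integral e/2 + e/(4 (k + 1)). *)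
Lemma kernel_moment_lower (k : nat) (e : R) (h : R -> R) : (0 < k)%N -> 0 <= e ->
  mu.-integrable I01 (EFin \o (fun t => t ^+ k.-1 * h t)) ->
  (forall t, 0 <= t < 1 -> e / (1 + k%:R^-1 - t) <= h t) ->
  e / 2 <= \int[mu]_(t in I01) (t ^+ k.-1 * h t).
Proof.
move=> k0 e0 ih hl; have kR : 0 < k%:R :> R by rewrite ltr0n.
set N : R := k%:R in kR hl *.
pose u t := e * (N - N ^+ 2 / 4 * (1 + N^-1)) * t ^+ k.-1 + e * N ^+ 2 / 4 * t ^+ k.
have cu : continuous u.
  by move=> t; apply: cvgD; apply: cvgM; try exact: cvg_cst; exact: exprn_continuous.
have iu : mu.-integrable I01 (EFin \o u).
  apply: integrableS (continuous_integrable_itv 0 1 cu) => //.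
  by move=> t /=; rewrite !in_itv/= => /andP[-> /ltW].
pose F t := e * (N - N ^+ 2 / 4 * (1 + N^-1)) / N * t ^+ k + e * N ^+ 2 / 4 / (k.+1)%:R * t ^+ k.+1.
have dF (t : R) : is_derive t 1 F (u t).
  have d1 := is_derive_expr k t; have d2 := is_derive_expr k.+1 t.
  apply: is_derive_eq; rewrite /GRing.scale/= /u -/N.
  have k1R : k.+1%:R != 0 :> R by rewrite pnatr_eq0.
  by rewrite !mulrA divfK ?(gt_eqF kR)// divfK.
have uint : \int[mu]_(t in I01) u t = F 1 - F 0.
  rewrite Rintegral_itv_bndo_bndc//.
  by rewrite /Rintegral (FTC2_itv ler01 dF cu).
have k1E : k.+1%:R = N + 1 :> R by rewrite -natr1.
have Fge : e / 2 <= F 1 - F 0.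
  rewrite /F !expr1n !expr0n/= (gtn_eqF k0) !mulr0 addr0 subr0 !mulr1 k1E.
  have -> : e * (N - N ^+ 2 / 4 * (1 + N^-1)) / N + e * N ^+ 2 / 4 / (N + 1) =
    e / 2 + e / (4 * (N + 1)).
    by field; rewrite !gt_eqF// addr_gt0.
  by rewrite lerDl divr_ge0// mulr_ge0// addr_ge0// ltW.
apply: le_trans Fge _; rewrite -uint; apply: le_Rintegral => //.
move=> t /=; rewrite in_itv/= => t01; have /andP[t0 t1] := t01.
have -> : u t = t ^+ k.-1 * (e * (N - N ^+ 2 / 4 * (1 + N^-1 - t))).
  have tk : t ^+ k = t ^+ k.-1 * t by rewrite -exprSr prednK.
  by rewrite /u tk; ring.
rewrite ler_wpM2l ?exprn_ge0//; apply: le_trans (hl _ t01); rewrite ler_wpM2l//.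
by apply: affine_le_inv; have : 0 < N^-1; [rewrite invr_gt0|lra].
Qed.

Variables (p lam : R) (n : nat -> nat) (b : nat -> R) (J : nat).
Hypotheses (p2 : 2 < p) (lam1 : 1 < lam) (n_gt0 : forall j, (0 < n j)%N).
Hypotheses (nl : forall j, lam * (n j)%:R <= (n j.+1)%:R) (b0 : forall j, 0 <= b j).

Let e j := b j * (n j)%:R `^ (p^-1 - 1).
Let a j : R := 1 + (n j)%:R^-1.

Definition test_fun (z : C) := \sum_(0 <= j < J) (e j)%:C%C * ((a j)%:C%C - z)^-1.

Let e0 j : 0 <= e j. Proof. by rewrite mulr_ge0 ?powR_ge0. Qed.

Let nR j : 0 < (n j)%:R :> R. Proof. by rewrite ltr0n. Qed.

Let a1 j : 1 < a j. Proof. by rewrite /a ltrDl invr_gt0. Qed.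

Lemma geometric_cvg (x : R) (z : C) : 1 < x -> modulus z < 1 ->
  (fun K => \sum_(0 <= k < K) z ^+ k * (x%:C%C)^-1 ^+ k.+1) @ \oo --> (x%:C%C - z)^-1.
Proof.
move=> x1 z1; have x0 : 0 < x by lra.
have xC : x%:C%C != 0 :> C by rewrite -modulus_eq0 modulus_real gt_eqF ?normr_gt0 ?gt_eqF.
have dn : x%:C%C - z != 0.
  rewrite subr_eq0; apply: contraTneq z1 => <-.
  by rewrite modulus_real gtr0_norm// -leNgt ltW.
have sE K : \sum_(0 <= k < K) z ^+ k * (x%:C%C)^-1 ^+ k.+1 - (x%:C%C - z)^-1 =
    - (z ^+ K * (x%:C%C^-1 ^+ K * (x%:C%C - z)^-1)).
  elim: K => [|K ih]; first by rewrite big_nil !expr0 !mul1r sub0r.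
  rewrite big_nat_recr//= addrAC ih !exprS.
  move: (z ^+ K) (x%:C%C^-1 ^+ K) => u v.
  by field; rewrite dn xC.
apply/cvgC_modulus => eps eps0.
have m0 : 0 < modulus (x%:C%C - z) by rewrite modulus_gt0.
have := archi_boundP (ltW (divr_gt0 (ltr01 : 0 < 1 :> R) (mulr_gt0 eps0 m0))).
set B := Num.bound _ => BP.
have : (fun K => modulus z ^+ K) @ \oo --> (0 : R).
  by apply: cvg_expr; rewrite ger0_norm ?modulus_ge0.
move=> /cvgR_dist /(_ _ (mulr_gt0 eps0 m0))[N NP].
exists N => K /NP; rewrite subr0 sE modulusN !modulusM !modulusV !modulusX modulusV modulus_real.
rewrite ger0_norm ?exprn_ge0 ?modulus_ge0// (gtr0_norm x0) mulrA => H.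
rewrite ltr_pdivrMr//; apply: le_lt_trans H.
rewrite ler_piMr ?exprn_ge0 ?modulus_ge0// exprn_ile1 ?invr_ge0 ?(ltW x0)// invf_le1// ltW//.
Qed.

(** Each pole a_j lies outside the closed disc, so the geometric series gives the coefficients as
    sums of e_j a_j^(-(k+1)). *)
Lemma test_fun_analytic : analytic_disc test_fun.
Proof.
apply: (@ps_analytic _ (fun k => \sum_(0 <= j < J) (e j)%:C%C * ((a j)%:C%C)^-1 ^+ k.+1) id 0%N).
  by move=> j; rewrite addn0.
move=> z z1.
rewrite (_ : series _ = fun K => \sum_(0 <= j < J)
    (\sum_(0 <= k < K) z ^+ k * ((a j)%:C%C)^-1 ^+ k.+1) * (e j)%:C%C); last first.
  apply/funext => K; rewrite /series/=.
  under eq_bigr do rewrite mulr_suml.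
  rewrite exchange_big/=; apply: eq_bigr => j _; rewrite mulr_suml.
  by apply: eq_bigr => k _; rewrite -[LHS]mulrA [LHS]mulrC; congr (_ * _); exact: mulrC.
rewrite /test_fun; under [X in _ --> X]eq_bigr do rewrite mulrC.
apply: cvgC_sum => j; apply: cvgC_mulr; exact: geometric_cvg.
Qed.

Lemma test_fun_Re (t : R) j : 0 <= t < 1 -> (j < J)%N ->
  e j / (1 + (n j)%:R^-1 - t) <= complex.Re (test_fun t%:C%C).
Proof.
move=> /andP[t0 t1] jJ; rewrite /test_fun Re_sum.
have reE i : complex.Re ((e i)%:C%C * ((a i)%:C%C - t%:C%C)^-1) = e i / (a i - t).
  by rewrite -rmorphB -fmorphV -rmorphM.
under eq_bigr do rewrite reE.
rewrite (bigD1_seq j) ?iota_uniq ?mem_index_iota//= lerDl; apply: sumr_ge0 => i _.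
by rewrite divr_ge0// subr_ge0; have := a1 i; lra.
Qed.

Let dl := (2 * p)^-1.
Let Com := lam `^ dl / (lam `^ dl - 1).

(** Pointwise, |f| <= 16 d^(-1/p) sum_j b_j omega_j, where 16 = 4 * 4 as in [pointwise]. Jensen's
    inequality with the weights omega_j, of sum at most [Com], moves the power p onto the b_j; then
    omega_j / d is integrated by [omega_cdist_int], with 2/dl = 4 p. *)
Lemma test_fun_norm rho : 0 < rho < 1 ->
  circle_int (fun t => modulus (test_fun (circle_point rho t)) `^ p) <=
  16 `^ p * Com `^ (p - 1) * (4 * p) * \sum_(0 <= j < J) b j `^ p.
Proof.
move=> r01; have p0 : 0 < p by move: p2; lra.
have dl0 : 0 < dl by rewrite invr_gt0 mulr_gt0.
have pdl : p^-1 = 2 * dl by rewrite /dl invfM mulrA divff ?mul1r.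
have dl3 : dl <= 3^-1 by rewrite /dl lef_pV2 ?posrE ?mulr_gt0//; move: p2; lra.
have /andP[r0 r1] := r01.
have Com0 : 0 <= Com.
  rewrite divr_ge0 ?powR_ge0// subr_ge0.
  have : 1 `^ dl <= lam `^ dl.
    by apply: ge0_ler_powR; rewrite ?nnegrE ?(ltW dl0) ?(ltW lam1)// (le_trans ler01 (ltW lam1)).
  by rewrite powR1.
have ct : continuous (fun t => modulus (test_fun (circle_point rho t)) `^ p).
  apply: continuous_powR_ge0 => //; apply: rcontinuous_modulus => t.
  apply: (rcontinuous_circle (f1 := derive1 test_fun) (r0 := 1)) => // w w1.
  by have [] := analytic_cderiv test_fun_analytic w1.
have pw t : 0 < t < 2 * pi -> modulus (test_fun (circle_point rho t)) `^ p <=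
    16 `^ p * Com `^ (p - 1) *
      \sum_(0 <= j < J) b j `^ p * (omega (n j)%:R (cdist t) dl / cdist t).
  move=> t2; have d0 := cdist_gt0 t2; set d := cdist t in d0 *.
  pose om j := omega (n j)%:R d dl.
  have om0 j : 0 <= om j by apply: omega_ge0; rewrite ?(ltW (nR j)) ?(ltW d0).
  have m1 : modulus (test_fun (circle_point rho t)) <=
      16 * d `^ (- p^-1) * \sum_(0 <= j < J) b j * om j.
    rewrite (le_trans (modulus_sum _ _ _))// mulr_sumr; apply: ler_sum => j _.
    rewrite modulusM modulusV modulus_real ger0_norm//.
    have [|h1 h2] := @circle_dist_lower_scaled (a j) rho t (ltW (a1 j)) r01.
      by case/andP: t2 => /ltW -> /ltW ->.
    set D := modulus _ in h1 h2 *.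
    have DM : Num.max (n j)%:R^-1 d / 4 <= D.
      rewrite ler_pdivrMr// ge_max; apply/andP; split; last by rewrite -ler_pdivrMr.
      have : (n j)%:R^-1 <= D by apply: le_trans h1; rewrite /a; lra.
      have : 0 <= D by exact: modulus_ge0.
      lra.
    have M0 : 0 < Num.max (n j)%:R^-1 d by rewrite lt_max d0 orbT.
    have D0 : 0 < D by apply: lt_le_trans DM; rewrite divr_gt0.
    have DV : D^-1 <= 4 / Num.max (n j)%:R^-1 d.
      by rewrite -invf_div lef_pV2 ?posrE ?divr_gt0.
    apply: le_trans (ler_wpM2l (e0 j) DV) _.
    have := inv_max_le_omega (nR j) d0 dl0 dl3; rewrite -pdl => H.
    rewrite /e.
    have -> : b j * (n j)%:R `^ (p^-1 - 1) * (4 / Num.max (n j)%:R^-1 d) =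
      4 * b j * ((n j)%:R `^ (p^-1 - 1) / Num.max (n j)%:R^-1 d) by ring.
    have -> : 16 * d `^ (- p^-1) * (b j * om j) = 4 * b j * (4 * (om j * d `^ (- p^-1))) by ring.
    by rewrite ler_wpM2l// mulr_ge0.
  have S0 : 0 <= \sum_(0 <= j < J) b j * om j by apply: sumr_ge0 => j _; rewrite mulr_ge0.
  have dp : (d `^ (- p^-1)) `^ p = d^-1.
    by rewrite -powRrM mulNr mulVf ?gt_eqF// powR_inv1// ltW.
  apply: (@le_trans _ _ (16 `^ p * d^-1 * (\sum_(0 <= j < J) b j * om j) `^ p)).
    rewrite -dp -!powRM ?powR_ge0 ?mulr_ge0 ?powR_ge0//.
    by apply: ge0_ler_powR; rewrite ?nnegrE ?(ltW p0) ?modulus_ge0 ?mulr_ge0 ?powR_ge0.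
  have p1 : 1 <= p by move: p2; lra.
  have jen := powR_jensen (index_iota 0 J) p1 b0 om0.
  have omS : \sum_(0 <= j < J) om j <= Com.
    have omE j : om j = omega ((n j)%:R * d) 1 dl by rewrite /om omega_scale.
    under eq_bigr do rewrite omE.
    apply: omega_sum => // j; first by rewrite mulr_gt0.
    by rewrite mulrA ler_wpM2r// ltW.
  have jen2 : (\sum_(0 <= j < J) b j * om j) `^ p <= (\sum_(0 <= j < J) b j `^ p * om j) * Com `^ (p - 1).
    apply: le_trans jen _; rewrite ler_wpM2l//.
      by apply: sumr_ge0 => j _; rewrite mulr_ge0 ?powR_ge0.
    apply: ge0_ler_powR; rewrite ?nnegrE ?subr_ge0//.
    by apply: sumr_ge0.
  have d160 : 0 <= 16 `^ p * d^-1 by rewrite mulr_ge0 ?powR_ge0// invr_ge0 ltW.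
  apply: le_trans (ler_wpM2l d160 jen2) _.
  rewrite le_eqVlt; apply/orP; left; apply/eqP.
  under [in RHS]eq_bigr do rewrite mulrA.
  rewrite -mulr_suml -/d; move: (16 `^ p) => c16; rewrite /om; ring.
rewrite -lee_fin -(circle_int_oo ct).
have mO (h : R -> R) : (forall t, 0 < t < 2 * pi -> {for t, continuous h}) ->
    measurable_fun O (fun t => (h t)%:E).
  move=> ch; apply/measurable_EFinP; apply: continuous_on_measurable.
    exact: measurable_itv.
  by move=> t /=; rewrite in_itv/=; exact: ch.
have K0 : 0 <= 16 `^ p * Com `^ (p - 1) by rewrite mulr_ge0 ?powR_ge0.
pose v j t := b j `^ p * (omega (n j)%:R (cdist t) dl / cdist t).
have v0 j t : 0 < t < 2 * pi -> 0 <= v j t.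
  move=> /cdist_gt0 d0; rewrite mulr_ge0 ?powR_ge0// divr_ge0 ?(ltW d0)//.
  by apply: omega_ge0; rewrite ?(ltW (nR j)) ?(ltW d0).
have cv j t : 0 < t < 2 * pi -> {for t, continuous (v j)}.
  move=> t2; apply: cvgM; first exact: cvg_cst.
  exact: omega_cdist_continuous.
have mOO : measurable O by exact: measurable_itv.
apply: (@le_trans _ _ (\int[mu]_(t in O) ((16 `^ p * Com `^ (p - 1))%:E *
    \sum_(0 <= j < J) (v j t)%:E))%E).
  apply: ge0_le_integral => //.
  - by move=> t _; rewrite lee_fin powR_ge0.
  - by apply: mO => t _; exact: ct.
  - apply: emeasurable_funM; first exact: measurable_cst.
    by apply: emeasurable_sum => j; apply: mO; exact: cv.
  - by move=> t /=; rewrite in_itv/= => /pw; rewrite sumEFin -EFinM lee_fin.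
rewrite ge0_integralZl_EFin//; last 2 first.
- move=> t /=; rewrite in_itv/= => t2; rewrite sumEFin lee_fin.
  by apply: sumr_ge0 => j _; exact: v0.
- by apply: emeasurable_sum => j; apply: mO; exact: cv.
rewrite ge0_integral_sum//; last first.
  by move=> j; apply: mO; exact: cv.
rewrite -[_ * (4 * p) * _]mulrA [leRHS]EFinM lee_wpmul2l ?lee_fin//.
rewrite mulr_sumr -sumEFin; apply: lee_sum => j _.
rewrite /v; under eq_integral do rewrite EFinM.
rewrite ge0_integralZl_EFin ?powR_ge0//; last 2 first.
- move=> t /=; rewrite in_itv/= lee_fin => /cdist_gt0 d0; rewrite divr_ge0 ?(ltW d0)//.
  by apply: omega_ge0; rewrite ?(ltW (nR j)) ?(ltW d0).
- by apply: mO => t t2; exact: omega_cdist_continuous.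
have H := omega_cdist_int (nR j) dl0.
apply: le_trans (lee_wpmul2l _ H) _; first by rewrite lee_fin powR_ge0.
rewrite -EFinM lee_fin mulrC ler_wpM2r ?powR_ge0// /dl invrK; lra.
Qed.

End TestFunction.

(** * The series of the Hilbert operator *)

Section HilbertSeries.
Context {R : realType}.
Local Notation C := R[i].
Local Notation mu := (@lebesgue_measure R).
Local Notation I01 := (`[0%R, 1%R[%classic : set R).

Let mI01 : measurable I01. Proof. exact: measurable_itv. Qed.

Let eq_int (h k : R -> R) : (forall t, h t = k t) ->
  mu.-integrable I01 (EFin \o h) -> mu.-integrable I01 (EFin \o k).
Proof. by move=> /funext ->. Qed.

Let intD (h k : R -> R) : mu.-integrable I01 (EFin \o h) ->
  mu.-integrable I01 (EFin \o k) -> mu.-integrable I01 (EFin \o (fun t => h t + k t)).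
Proof. by move=> ih ik; exact: (@integrableD _ _ R mu I01 mI01 (EFin \o h) (EFin \o k) ih ik). Qed.

Let intZ (a : R) (h : R -> R) : mu.-integrable I01 (EFin \o h) ->
  mu.-integrable I01 (EFin \o (fun t => a * h t)).
Proof. by move=> ih; exact: (@integrableZl _ _ R mu I01 mI01 a (EFin \o h) ih). Qed.

Definition cintegrable (u : R -> C) :=
  mu.-integrable I01 (EFin \o (fun t => complex.Re (u t))) /\
  mu.-integrable I01 (EFin \o (fun t => complex.Im (u t))).

Lemma cintegrableD u v : cintegrable u -> cintegrable v ->
  cintegrable (fun t => u t + v t).
Proof.
move=> [u1 u2] [v1 v2]; split.
  by apply: eq_int (intD u1 v1) => t; rewrite ReD.
by apply: eq_int (intD u2 v2) => t; rewrite ImD.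
Qed.

Lemma cintegral01D u v : cintegrable u -> cintegrable v ->
  cintegral01 (fun t => u t + v t) = cintegral01 u + cintegral01 v.
Proof.
move=> [u1 u2] [v1 v2]; rewrite /cintegral01; simpc; rewrite -!RintegralD//.
by congr Complex; apply: eq_Rintegral => t _; rewrite ?ReD ?ImD.
Qed.

Let scaleE (a b : R) (u v : R -> R) : mu.-integrable I01 (EFin \o u) ->
  mu.-integrable I01 (EFin \o v) ->
  mu.-integrable I01 (EFin \o (fun t => a * u t + b * v t)) /\
  \int[mu]_(t in I01) (a * u t + b * v t) =
    a * \int[mu]_(t in I01) u t + b * \int[mu]_(t in I01) v t.
Proof.
move=> iu iv.
have iau : mu.-integrable I01 (EFin \o (fun t => a * u t)).
  exact: intZ.
have ibv : mu.-integrable I01 (EFin \o (fun t => b * v t)).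
  exact: intZ.
split; first exact: intD.
by rewrite RintegralD// !RintegralZl.
Qed.

Lemma cintegrableZ c u : cintegrable u -> cintegrable (fun t => c * u t).
Proof.
case: c => a b [u1 u2]; split.
  have [h _] := scaleE a (- b) u1 u2; apply: eq_int h => t /=.
  by case: (u t) => x y; simpc; rewrite /= ?mulNr.
have [h _] := scaleE a b u2 u1; apply: eq_int h => t /=.
by case: (u t) => x y; simpc.
Qed.

Lemma cintegral01Z c u : cintegrable u ->
  cintegral01 (fun t => c * u t) = c * cintegral01 u.
Proof.
case: c => a b [u1 u2]; rewrite /cintegral01; simpc; congr Complex.
  have [_] := scaleE a (- b) u1 u2; rewrite mulNr => <-; apply: eq_Rintegral => t _.
  by case: (u t) => x y; simpc; rewrite /= ?mulNr.
have [_ <-] := scaleE a b u2 u1; apply: eq_Rintegral => t _.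
by case: (u t) => x y; simpc.
Qed.

Lemma cintegral01_sum (c : nat -> C) (u : nat -> R -> C) J : (forall j, cintegrable (u j)) ->
  cintegrable (fun t => \sum_(0 <= j < J) c j * u j t) /\
  cintegral01 (fun t => \sum_(0 <= j < J) c j * u j t) =
    \sum_(0 <= j < J) c j * cintegral01 (u j).
Proof.
move=> iu; elim: J => [|J [ih1 ih2]].
  rewrite (_ : (fun t => _) = (fun=> 0)); last by apply/funext => t; rewrite big_nil.
  split; first by split; exact: integrable0.
  by rewrite big_nil /cintegral01 /= /Rintegral !integral0.
rewrite (_ : (fun t => _) = (fun t => \sum_(0 <= j < J) c j * u j t + c J * u J t)); last first.
  by apply/funext => t; rewrite big_nat_recr.
have iJ := cintegrableZ (c J) (iu J).
split; first exact: cintegrableD.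
by rewrite cintegral01D// cintegral01Z// ih2 big_nat_recr.
Qed.

Lemma cintegral01_dominated (u_ : nat -> R -> C) (u : R -> C) (g : R -> R) :
  (forall J, cintegrable (u_ J)) ->
  mu.-integrable I01 (EFin \o g) ->
  (forall J t, 0 <= t < 1 -> modulus (u_ J t) <= g t) ->
  (forall t, 0 <= t < 1 -> (fun J => u_ J t) @ \oo --> u t) ->
  (fun J => cintegral01 (u_ J)) @ \oo --> cintegral01 u.
Proof.
move=> iu ig ug uu.
have real (v_ : nat -> R -> R) (v : R -> R) :
    (forall J, mu.-integrable I01 (EFin \o v_ J)) ->
    (forall J t, 0 <= t < 1 -> `|v_ J t| <= g t) ->
    (forall t, 0 <= t < 1 -> v_ J t @[J --> \oo] --> v t) ->
    (fun J => \int[mu]_(t in I01) v_ J t) @ \oo --> \int[mu]_(t in I01) v t.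
  move=> iv vg vv.
  have mv J : measurable_fun I01 (EFin \o v_ J) by exact: measurable_int (iv J).
  have mvl : measurable_fun I01 (EFin \o v).
    apply/measurable_EFinP; apply: (@measurable_fun_cvg _ _ _ _ v_).
      by move=> J; apply/measurable_EFinP; exact: mv.
    by move=> t /=; rewrite in_itv/=; exact: vv.
  have vvE : {ae mu, forall t, I01 t -> (EFin \o v_ J) t @[J --> \oo] --> (EFin \o v) t}.
    apply: aeW => t /=; rewrite in_itv/= => t01; apply: cvg_EFin; first exact: nearW.
    exact: vv.
  have vgE : {ae mu, forall t, forall J, I01 t -> (`|(EFin \o v_ J) t| <= (EFin \o g) t)%E}.
    by apply: aeW => t J /=; rewrite in_itv/= lee_fin; exact: vg.
  have [ivl _ cv] := @dominated_convergence _ _ R mu I01 mI01 _ _ _ mv mvl vvE ig vgE.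
  apply: fine_cvg; rewrite -/(Rintegral mu I01 v) /Rintegral fineK//.
  exact: integrable_fin_num ivl.
apply: cvgC_ReIm => /=.
- apply: real => [J|J t t01|t t01]; first by case: (iu J).
    exact: le_trans (normr_Re_le _) (ug J t t01).
  exact: cvgC_Re (uu t t01).
- apply: real => [J|J t t01|t t01]; first by case: (iu J).
    exact: le_trans (normr_Im_le _) (ug J t t01).
  exact: cvgC_Im (uu t t01).
Qed.

(** The factor 2 comes from treating real and imaginary parts separately; the division by 2 in
    [moment_sum_le] matches it. *)
Lemma modulus_cintegral01_le (u : R -> C) (g : R -> R) : cintegrable u ->
  mu.-integrable I01 (EFin \o g) -> (forall t, 0 <= t < 1 -> modulus (u t) <= g t) ->
  modulus (cintegral01 u) <= 2 * \int[mu]_(t in I01) g t.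
Proof.
move=> [u1 u2] ig ug; apply: le_trans (modulus_le_ReIm _) _.
rewrite mulr_natl mulr2n /=; apply: lerD.
  apply: le_trans (@le_normr_Rintegral _ _ R mu I01 (fun t => complex.Re (u t)) mI01 u1) _; apply: le_Rintegral => //.
    exact: integrable_norm u1.
  by move=> t /=; rewrite in_itv/= => /ug; apply: le_trans; exact: normr_Re_le.
apply: le_trans (@le_normr_Rintegral _ _ R mu I01 (fun t => complex.Im (u t)) mI01 u2) _; apply: le_Rintegral => //.
  exact: integrable_norm u2.
by move=> t /=; rewrite in_itv/= => /ug; apply: le_trans; exact: normr_Im_le.
Qed.

Variables (f f1 G : C -> C) (d : nat -> C) (m : nat -> nat) (s : nat).
Hypothesis fd : forall w, modulus w < 1 -> cderiv f w (f1 w).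
Hypotheses (jm : forall j, (j <= m j + s)%N) (m0 : forall j, (m 0 <= m j)%N).
Hypothesis dG : forall z, modulus z < 1 ->
  series (fun j => d j * z ^+ m j) @ \oo --> G z.
Hypothesis fm : forall j,
  (\int[mu]_(t in `]0%R, 1%R[) (t ^+ m j * modulus (f t%:C%C))%:E < +oo)%E.

Definition moment j := cintegral01 (fun t => f t%:C%C * t%:C%C ^+ m j).

Let rcont_real (t : R) : rcontinuous_at (fun t => t%:C%C) t.
Proof.
move=> e e0; exists e; split=> // x xe.
by rewrite -rmorphB modulus_real addrAC subrr add0r.
Qed.

Let rcont_f (t : R) : 0 <= t < 1 -> rcontinuous_at (fun t => f t%:C%C) t.
Proof.
move=> /andP[t0 t1]; apply: rcontinuous_comp; last exact: rcont_real.
by apply: cderiv_continuous; apply: fd; rewrite modulus_real ger0_norm.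
Qed.

Let rcont_u j (t : R) : 0 <= t < 1 -> rcontinuous_at (fun t => f t%:C%C * t%:C%C ^+ m j) t.
Proof.
move=> t01; apply: rcontinuousM; first exact: rcont_f.
elim: (m j) => [|k ih]; first exact: rcontinuous_cst.
rewrite (_ : (fun t => _) = (fun t => t%:C%C * t%:C%C ^+ k)).
  by apply: rcontinuousM => //; exact: rcont_real.
by apply/funext => u; rewrite exprS.
Qed.

Lemma modulus_moment_integrand j t : 0 <= t < 1 ->
  modulus (f t%:C%C * t%:C%C ^+ m j) = t ^+ m j * modulus (f t%:C%C).
Proof.
by move=> /andP[t0 t1]; rewrite modulusM modulusX modulus_real ger0_norm// mulrC.
Qed.

Let m01 (h : R -> R) : (forall t, 0 <= t < 1 -> {for t, continuous h}) ->
  measurable_fun I01 (EFin \o h).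
Proof.
move=> ch; apply/measurable_EFinP; apply: continuous_on_measurable => //.
Qed.

Let mod_int j :
  mu.-integrable I01 (EFin \o (fun t => modulus (f t%:C%C * t%:C%C ^+ m j))) /\
  \int[mu]_(t in I01) modulus (f t%:C%C * t%:C%C ^+ m j) =
  fine (\int[mu]_(t in `]0%R, 1%R[) (t ^+ m j * modulus (f t%:C%C))%:E).
Proof.
have mM : measurable_fun I01 (EFin \o (fun t => modulus (f t%:C%C * t%:C%C ^+ m j))).
  apply: m01 => t t01; apply: (rcontinuous_real_at modulus_lipschitz); exact: rcont_u.
(* The moment bounds live on ]0, 1[ and [cintegral01] on [0, 1[; the two differ by a single
   point. *)
have E : (\int[mu]_(t in I01) (modulus (f t%:C%C * t%:C%C ^+ m j))%:E =
    \int[mu]_(t in `]0%R, 1%R[) (t ^+ m j * modulus (f t%:C%C))%:E)%E.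
  rewrite -(@integral_itv_obnd_cbnd R 0 (BLeft 1)); last first.
    apply: measurable_funS mM => // t /=; rewrite !in_itv/= => /andP[/ltW -> ->]//.
  apply: eq_integral => t; rewrite inE/= in_itv/= => /andP[/ltW t0 t1].
  by rewrite modulus_moment_integrand// t0.
split; last by rewrite /Rintegral E.
apply/integrableP; split=> //.
under eq_integral do rewrite /= ger0_norm ?modulus_ge0//.
by rewrite E.
Qed.

Lemma moment_integrable j : cintegrable (fun t => f t%:C%C * t%:C%C ^+ m j).
Proof.
have [im _] := mod_int j.
split; apply: le_integrable im => //.
- apply: m01 => t t01; apply: (rcontinuous_real_at Re_lipschitz); exact: rcont_u.
- by move=> t _ /=; rewrite lee_fin [leRHS]ger0_norm ?modulus_ge0// normr_Re_le.
- apply: m01 => t t01; apply: (rcontinuous_real_at Im_lipschitz); exact: rcont_u.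
- by move=> t _ /=; rewrite lee_fin [leRHS]ger0_norm ?modulus_ge0// normr_Im_le.
Qed.

Lemma modulus_moment_le j : modulus (moment j) <=
  2 * fine (\int[mu]_(t in `]0%R, 1%R[) (t ^+ m j * modulus (f t%:C%C))%:E).
Proof.
have [im <-] := mod_int j.
by apply: modulus_cintegral01_le => //; exact: moment_integrable.
Qed.

(** Termwise integration by dominated convergence. As m 0 is the least exponent, B t^(m 0) |f(t)| is
    a common majorant, where B bounds the sums of |d_j| |z|^(m j). *)
Lemma hilbert_series z : modulus z < 1 ->
  series (fun j => (d j * moment j) * z ^+ m j) @ \oo -->
  cintegral01 (fun t => f t%:C%C * G (t%:C%C * z)).
Proof.
move=> z1.
have [|B BP] := psradius_sum (r := modulus z) jm (cvg_psradius dG); first by rewrite modulus_ge0.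
have seriesE : series (fun j => (d j * moment j) * z ^+ m j) = fun J =>
    cintegral01 (fun t => \sum_(0 <= j < J) (d j * z ^+ m j) * (f t%:C%C * t%:C%C ^+ m j)).
  apply/funext => J; have [_ ->] := cintegral01_sum (fun j => d j * z ^+ m j) J moment_integrable.
  by rewrite /series/=; apply: eq_bigr => j _; rewrite -/(moment j) mulrAC.
rewrite seriesE.
have [im _] := mod_int 0.
apply: (@cintegral01_dominated _ _ (fun t => B * modulus (f t%:C%C * t%:C%C ^+ m 0))).
- by move=> J; have [] := cintegral01_sum (fun j => d j * z ^+ m j) J moment_integrable.
- exact: intZ.
- move=> J t t01; rewrite modulus_moment_integrand//; have /andP[t0 t1] := t01.
  apply: le_trans (modulus_sum _ _ _) _.
  have f0 : 0 <= t ^+ m 0 * modulus (f t%:C%C) by rewrite mulr_ge0 ?exprn_ge0 ?modulus_ge0.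
  apply: le_trans (ler_wpM2r f0 (BP J)); rewrite mulr_suml; apply: ler_sum => j _.
  rewrite modulusM modulus_moment_integrand// modulusM modulusX.
  rewrite ler_wpM2l ?mulr_ge0 ?exprn_ge0 ?modulus_ge0// ler_wpM2r ?modulus_ge0//.
  by rewrite ler_wiXn2l// ltW.
- move=> t /andP[t0 t1].
  have tz : modulus (t%:C%C * z) < 1.
    rewrite modulusM modulus_real ger0_norm//.
    by rewrite (le_lt_trans _ z1)// ler_piMl ?modulus_ge0// ltW.
  rewrite [X in _ --> X]mulrC.
  rewrite (_ : (fun J => _) = fun J => series (fun j => d j * (t%:C%C * z) ^+ m j) J * f t%:C%C).
    by apply: cvgC_mulr; exact: dG.
  apply/funext => J; rewrite /series/= mulr_suml; apply: eq_bigr => j _.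
  by rewrite exprMn; ring.
Qed.

End HilbertSeries.

(** * Hardy norms and means over circles *)

Section Norms.
Context {R : realType}.
Local Notation C := R[i].
Local Notation mu := (@lebesgue_measure R).

Lemma analytic_rcontinuous (f : C -> C) (r t : R) : analytic_disc f -> 0 <= r < 1 ->
  rcontinuous_at (fun t => f (circle_point r t)) t.
Proof.
move=> fa /andP[]; rewrite le_eqVlt => /predU1P[<- _|r0 r1].
  rewrite (_ : (fun t => _) = fun=> f 0); first exact: rcontinuous_cst.
  by apply/funext => u; rewrite /circle_point !mul0r.
apply: (rcontinuous_circle (f1 := derive1 f) (r0 := 1)); first by rewrite r0.
by move=> w w1; have [] := analytic_cderiv fa w1.
Qed.

Lemma analytic_powR_continuous (f : C -> C) (p r : R) : analytic_disc f -> 0 < p -> 0 <= r < 1 ->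
  continuous (fun t => modulus (f (circle_point r t)) `^ p).
Proof.
move=> fa p0 r01; apply: continuous_powR_ge0 => //.
by apply: rcontinuous_modulus => t; exact: analytic_rcontinuous.
Qed.

Lemma integral_meanE (f : C -> C) (p r : R) : analytic_disc f -> 0 < p -> 0 <= r < 1 ->
  integral_mean p r f =
  (((2 * pi)^-1 * circle_int (fun t => modulus (f (circle_point r t)) `^ p)) `^ p^-1)%:E.
Proof.
move=> fa p0 r01; rewrite /integral_mean circle_int_EFin ?poweR_EFin//.
exact: analytic_powR_continuous.
Qed.

Lemma hardy_norm_ge0 (p : R) (f : C -> C) : (0 <= hardy_norm p f)%E.
Proof.
apply: (@le_trans _ _ (integral_mean p 2^-1 f)); first exact: poweR_ge0.
apply: ereal_sup_ubound; exists 2^-1 => //=.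
by rewrite in_itv/= invr_gt0 ltr0n/= invf_lt1// ltr1n.
Qed.

Lemma hardy_circle_int_le (p : R) (f : C -> C) : hardy p f -> 0 < p ->
  forall rho, 0 < rho < 1 ->
  circle_int (fun t => modulus (f (circle_point rho t)) `^ p) <=
  2 * pi * fine (hardy_norm p f) `^ p.
Proof.
move=> [fa fn] p0 rho /andP[r0 r1]; have r01 : 0 <= rho < 1 by rewrite ltW.
have le1 : (integral_mean p rho f <= hardy_norm p f)%E.
  by apply: ereal_sup_ubound; exists rho => //=; rewrite in_itv/= r0.
have fin : hardy_norm p f \is a fin_num by rewrite ge0_fin_numE ?hardy_norm_ge0.
set I := circle_int _.
have {}le1 : ((2 * pi)^-1 * I) `^ p^-1 <= fine (hardy_norm p f).
  by move: le1; rewrite integral_meanE// -{1}(fineK fin) lee_fin.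
have I0 : 0 <= I by apply: circle_int_ge0 => t; exact: powR_ge0.
have pi0 : 0 < 2 * pi :> R := @two_pi_gt0 R.
have J0 : 0 <= (2 * pi)^-1 * I by rewrite mulr_ge0// invr_ge0 ltW.
rewrite -ler_pdivrMl//.
have -> : (2 * pi)^-1 * I = (((2 * pi)^-1 * I) `^ p^-1) `^ p.
  by rewrite -powRrM mulVf ?gt_eqF// powRr1.
by apply: ge0_ler_powR; rewrite ?nnegrE ?powR_ge0 ?(ltW p0)// fine_ge0 ?hardy_norm_ge0.
Qed.

Lemma hardy_norm_le (p M : R) (f : C -> C) : analytic_disc f -> 0 < p -> 0 <= M ->
  (forall rho, 0 < rho < 1 ->
    circle_int (fun t => modulus (f (circle_point rho t)) `^ p) <= 2 * pi * M `^ p) ->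
  (hardy_norm p f <= M%:E)%E.
Proof.
move=> fa p0 M0 fM; apply: ge_ereal_sup => x /= [r]; rewrite in_itv/= => r01 <-.
rewrite integral_meanE//; last by case/andP: r01 => /ltW -> ->.
have pi0 : 0 < 2 * pi :> R := @two_pi_gt0 R.
set I := circle_int _.
have I0 : 0 <= I by apply: circle_int_ge0 => t; exact: powR_ge0.
have -> : M = (M `^ p) `^ p^-1 by rewrite -powRrM mulfV ?gt_eqF// powRr1.
rewrite lee_fin; apply: ge0_ler_powR; rewrite ?nnegrE ?powR_ge0 ?invr_ge0 ?(ltW p0)//.
  by rewrite mulr_ge0// invr_ge0 ltW.
by rewrite ler_pdivrMl//; exact: fM.
Qed.

(** Comparison of the L^2 and L^p means: [bernoulli_powR] for (u/c)^2 with exponent p/2 bounds u^2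
    by a combination of u^p and a constant, with equality at u = c. *)
Lemma circle_int_sqr_le (p c : R) (u : R -> R) : 2 < p -> 0 < c -> (forall t, 0 <= u t) ->
  continuous u -> circle_int (fun t => u t `^ p) <= 2 * pi * c `^ p ->
  circle_int (fun t => u t ^+ 2) <= 2 * pi * c ^+ 2.
Proof.
move=> p2 c0 u0 cu up; have p0 : 0 < p by lra.
have p21 : 1 <= p / 2 by lra.
have cp0 : 0 < c `^ p by exact: powR_gt0.
have c20 : 0 < c ^+ 2 by rewrite exprn_gt0.
have cup : continuous (fun t => u t `^ p) by exact: continuous_powR_ge0.
have cu2 : continuous (fun t => u t ^+ 2) by move=> t; apply: (@cvgM _ R); exact: cu.
pose k := c ^+ 2 * (2 / p) / c `^ p.
apply: (@le_trans _ _ (circle_int (fun t => k * u t `^ p + c ^+ 2 * (1 - 2 / p)))).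
  apply: le_circle_int => //.
    move=> t; apply: cvgD; last exact: cvg_cst.
    by apply: cvgM; [exact: cvg_cst|exact: cup].
  move=> t _.
  have v0 : 0 <= (u t / c) ^+ 2 by exact: sqr_ge0.
  have := bernoulli_powR v0 p21.
  rewrite -(powR_mulrn 2) ?divr_ge0 ?(ltW c0)// -powRrM (_ : 2%:R * (p / 2) = p); last by field.
  rewrite (powR_mulrn 2) ?divr_ge0 ?(ltW c0)//.
  rewrite (powRM _ (u0 t)) ?invr_ge0 ?(ltW c0)//.
  have -> : c^-1 `^ p = (c `^ p)^-1.
    by rewrite -(powR_inv1 (ltW c0)) -powRrM mulN1r powRN.
  rewrite exprMn exprVn /k; set U := u t `^ p; set V := u t ^+ 2 => H.
  have -> : V = c ^+ 2 * (2 / p) * (1 + p / 2 * (V / c ^+ 2 - 1)) + c ^+ 2 * (1 - 2 / p).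
    by field; rewrite !gt_eqF.
  have kk : 0 <= c ^+ 2 * (2 / p) by rewrite mulr_ge0 ?(ltW c20)// divr_ge0 ?(ltW p0).
  rewrite lerD2r; apply: le_trans (ler_wpM2l kk H) _.
  by rewrite mulrA mulrAC.
rewrite circle_intD; last 2 first.
- by move=> t; apply: cvgM; [exact: cvg_cst|exact: cup].
- by move=> t; exact: cvg_cst.
rewrite circle_intZ// circle_int_cst.
have k0 : 0 <= k by rewrite divr_ge0 ?(ltW cp0)// mulr_ge0 ?(ltW c20)// divr_ge0 ?(ltW p0).
apply: (@le_trans _ _ (k * (2 * pi * c `^ p) + c ^+ 2 * (1 - 2 / p) * (2 * pi))).
  by rewrite lerD2r ler_wpM2l.
rewrite le_eqVlt; apply/orP; left; apply/eqP; rewrite /k.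
move: (2 * pi) => w; by field; rewrite !gt_eqF.
Qed.

(** Orthogonality holds for the partial sums; at radius r < 1 [circle_int_series_cvg] carries it
    over to the whole series. *)
Lemma parseval_cvg (d : nat -> C) (m : nat -> nat) (s : nat) (G : C -> C) (r : R) :
  (forall j, (m j < m j.+1)%N) -> (forall j, (j <= m j + s)%N) ->
  (forall z, modulus z < 1 -> series (fun j => d j * z ^+ m j) @ \oo --> G z) ->
  0 <= r < 1 ->
  \sum_(0 <= j < J) (modulus (d j) * r ^+ m j) ^+ 2 @[J --> \oo] -->
  (2 * pi)^-1 * circle_int (fun t => modulus (G (circle_point r t)) `^ 2).
Proof.
move=> mS jm dG r01; have /andP[r0 r1] := r01.
have Ga : analytic_disc G by exact: ps_analytic jm dG.
have pi0 : 0 < 2 * pi :> R := @two_pi_gt0 R.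
have h := circle_int_series_cvg (ltr0n R 2) jm dG (fun t => analytic_rcontinuous t Ga r01) r01.
have E J : (2 * pi)^-1 * circle_int (fun t =>
    modulus (\sum_(0 <= j < J) d j * circle_point r t ^+ m j) `^ 2) =
    \sum_(0 <= j < J) (modulus (d j) * r ^+ m j) ^+ 2.
  rewrite (eq_circle_int (k := fun t => modulus (\sum_(0 <= j < J)
     (d j * (r ^+ m j)%:C%C) * circle_point 1 t ^+ m j) ^+ 2)); last first.
    by move=> t; rewrite circle_scale_term (powR_mulrn 2)// modulus_ge0.
  rewrite trig_orthogonality// mulrA mulVf ?gt_eqF// mul1r; apply: eq_bigr => j _.
  by rewrite modulusM modulus_real ger0_norm ?exprn_ge0.
under eq_fun do rewrite -E.
by apply: cvgM; [exact: cvg_cst|exact: h].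
Qed.

(** Positivity of every n_j is part of the data, so that n_j - 1 is a genuine predecessor and
    negative powers of n_j make sense. *)
Definition lacunary_derivative (lam : R) (g : C -> C) (a : nat -> C) (n : nat -> nat) :=
  [/\ (forall j, (0 < n j)%N), (forall j, (n j < n j.+1)%N),
      (forall j, lam * (n j)%:R <= (n j.+1)%:R) &
      forall z : C, modulus z < 1 ->
        series (fun j => a j * (n j)%:R * z ^+ (n j).-1) @ \oo --> derive1 g z].

Lemma lacunary_derive1 (lam : R) (g : C -> C) : 1 < lam -> lacunary lam g ->
  exists (a : nat -> C) (n : nat -> nat), lacunary_derivative lam g a n.
Proof.
move=> l1 [a [n [nS nl ag]]].
have jn j : (j <= n j + 0)%N.
  by rewrite addn0; elim: j => // j ih; exact: leq_ltn_trans ih (nS j).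
have jn1 j : (j <= (n j).-1 + 1)%N.
  by rewrite addn1; apply: leq_trans (leqSpred _); rewrite -[n j]addn0.
have dg z : modulus z < 1 ->
    series (fun j => a j * (n j)%:R * z ^+ (n j).-1) @ \oo --> derive1 g z.
  move=> z1; have [l hl] := psradius_cvg jn1 (psradius_deriv (cvg_psradius ag)) z1.
  by rewrite (cderiv_derive1 (ps_cderiv jn ag hl z1)).
have npos j : (0 < n j.+1)%N by exact: leq_ltn_trans (leq0n _) (nS j).
(* A constant term of g disappears from g'; shifting both sequences removes it. *)
have [n0|n0] := posnP (n 0); last first.
  exists a, n; split; [by case|exact: nS|exact: nl|exact: dg].
exists (fun j => a j.+1), (fun j => n j.+1); split;
  [exact: npos|by move=> j; exact: nS|by move=> j; exact: nl|move=> z z1].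
have /cvgC_modulus h := dg z z1; apply/cvgC_modulus => e /h[N NP].
exists N => J NJ; have := NP J.+1 (leqW NJ).
by rewrite /series/= big_nat_recl// n0 mulr0 mul0r add0r.
Qed.

End Norms.

(** * Bounds for the Hilbert operator *)

Section HilbertBounds.
Context {R : realType}.
Local Notation C := R[i].
Local Notation mu := (@lebesgue_measure R).
Variables (p q lam : R).
Hypotheses (p2 : 2 < p) (qE : q^-1 = 2^-1 - p^-1) (lam1 : 1 < lam).

Let p0 : 0 < p. Proof. by move: p2; lra. Qed.
Let q2 : 2 < q. Proof. exact: conj_exponent_gt2 p2 qE. Qed.
Let q0 : 0 < q. Proof. exact: lt_trans q2. Qed.
Let qpE : q / p = q / 2 - 1. Proof. exact: conj_exponentE p2 qE. Qed.

Definition weighted_sum (a : nat -> C) (n : nat -> nat) J :=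
  \sum_(0 <= j < J) ((n j)%:R `^ p^-1 * modulus (a j)) `^ q.

Let limr_le' (u : nat -> R) (l M : R) : u @ \oo --> l -> (forall J, u J <= M) -> l <= M.
Proof.
move=> ul uM; rewrite -(cvg_lim (@Rhausdorff R) ul); apply: limr_le.
  by apply/cvg_ex; eexists; exact: ul.
exact: nearW.
Qed.

Let powR_sqr (x e : R) : 0 <= x -> (x `^ e) ^+ 2 = x `^ (2 * e).
Proof. by move=> x0; rewrite -(powR_mulrn 2) ?powR_ge0// -powRrM mulrC. Qed.

Let two_pi_ge1 : 1 <= 2 * pi :> R.
Proof. by have := @pi_ge2 R; lra. Qed.

Section Lacunary.
Variables (g : C -> C) (a : nat -> C) (n : nat -> nat).
Hypothesis ga : lacunary_derivative lam g a n.

Let n_gt0 j : (0 < n j)%N. Proof. by case: ga. Qed.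
Let nS j : (n j < n j.+1)%N. Proof. by case: ga. Qed.
Let nl j : lam * (n j)%:R <= (n j.+1)%:R. Proof. by case: ga. Qed.
Let nlt i j : (i < j)%N -> (n i < n j)%N. Proof. exact: (homo_ltn ltn_trans nS). Qed.
Let mS j : ((n j).-1 < (n j.+1).-1)%N.
Proof. by rewrite -ltnS !prednK. Qed.
Let m0 j : ((n 0).-1 <= (n j).-1)%N.
Proof. by case: j => // j; rewrite -!subn1 leq_sub2r// ltnW// nlt. Qed.

Lemma lacunary_exponent_ge j : (j <= (n j).-1 + 1)%N.
Proof.
rewrite addn1 prednK//; elim: j => // j ih.
exact: leq_ltn_trans ih (nS j).
Qed.

Let dG (z : C) : modulus z < 1 ->
  series (fun j => a j * (n j)%:R * z ^+ (n j).-1) @ \oo --> derive1 g z.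
Proof. by case: ga => _ _ _; exact. Qed.

Section FixedFunction.
Variable (f : C -> C).
Hypothesis fH : hardy p f.

Let M := fine (hardy_norm p f).

Let M0 : 0 <= M. Proof. by rewrite fine_ge0// hardy_norm_ge0. Qed.

Let fd w : modulus w < 1 -> cderiv f w (derive1 f w) /\ ccontinuous_at (derive1 f) w.
Proof. by case: fH => fa _; exact: analytic_cderiv. Qed.

Let coef J := coefficient_bound p2 fd lam1 (n_gt0 0) nl (hardy_circle_int_le fH p0) J.

Let fm j : (\int[mu]_(t in `]0%R, 1%R[) (t ^+ (n j).-1 * modulus (f t%:C%C))%:E < +oo)%E.
Proof. by have [h _] := coef 0; exact: h. Qed.

Let fd1 w : modulus w < 1 -> cderiv f w (derive1 f w).
Proof. by case/fd. Qed.

Lemma hilbert_op_series z : modulus z < 1 ->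
  series (fun j => (a j * (n j)%:R * moment f (fun j => (n j).-1) j) * z ^+ (n j).-1) @ \oo -->
  hilbert_op g f z.
Proof. exact: (hilbert_series fd1 lacunary_exponent_ge m0 dG fm). Qed.

Lemma hilbert_op_analytic : analytic_disc (hilbert_op g f).
Proof. exact: ps_analytic lacunary_exponent_ge hilbert_op_series. Qed.

Lemma moment_integrable_hardy j :
  cintegrable (fun t => f t%:C%C * t%:C%C ^+ (n j).-1).
Proof. exact: (moment_integrable fd1 fm). Qed.

Lemma moment_sum_le J :
  \sum_(0 <= j < J) ((n j)%:R `^ (1 - p^-1) * (modulus (moment f (fun j => (n j).-1) j) / 2)) `^ p <=
  2 `^ p * ((80 * (1 + 4 * p)) `^ p * (lam `^ (2 * p)^-1 / (lam `^ (2 * p)^-1 - 1) * (2 * pi))) *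
  M `^ p.
Proof.
have [_ h] := coef J; apply: le_trans h; apply: ler_sum => j _.
apply: ge0_ler_powR; rewrite ?nnegrE ?(ltW p0) ?mulr_ge0 ?powR_ge0 ?invr_ge0 ?modulus_ge0//.
  by apply: fine_ge0; apply: integral_ge0 => t /=; rewrite in_itv/= => /andP[/ltW t0 _];
    rewrite lee_fin mulr_ge0 ?exprn_ge0 ?modulus_ge0.
rewrite ler_wpM2l ?powR_ge0// ler_pdivrMr// mulrC.
exact: (modulus_moment_le fd1 fm).
Qed.

End FixedFunction.
End Lacunary.

Let K1 := 2 `^ p * ((80 * (1 + 4 * p)) `^ p *
  (lam `^ (2 * p)^-1 / (lam `^ (2 * p)^-1 - 1) * (2 * pi))).

Let lamdl : 0 < lam `^ (2 * p)^-1 - 1.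
Proof.
have dl0 : 0 < (2 * p)^-1 by rewrite invr_gt0 mulr_gt0.
have l0 : 0 < lam by move: lam1; lra.
have := @gt0_ltr_powR R _ dl0 1 lam; rewrite !nnegrE (ltW l0) ler01 powR1 subr_gt0.
by apply.
Qed.

Let Com0 : 0 < lam `^ (2 * p)^-1 / (lam `^ (2 * p)^-1 - 1).
Proof. by rewrite divr_gt0// powR_gt0//; move: lam1; lra. Qed.

Let K10 : 0 < K1.
Proof.
rewrite mulr_gt0 ?powR_gt0// mulr_gt0 ?powR_gt0//.
  by rewrite mulr_gt0// addr_gt0// mulr_gt0.
by rewrite mulr_gt0 ?two_pi_gt0.
Qed.

(** The factor n_j in the coefficient a_j n_j beta_j is divided as n_j^(1/p) n_j^(1-1/p), the first
    power going to a_j and the second to the moment. [powR_hoelder_sum] then puts the coefficients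
    in l^2, and [lacunary_Lp] returns from l^2 to L^p. *)
Lemma hilbert_op_upper : exists2 K, 0 < K &
  forall g a n B, lacunary_derivative lam g a n -> 0 <= B ->
    (forall J, weighted_sum a n J <= B) ->
    op_bound (hilbert_op g) p p (K * B `^ q^-1).
Proof.
have p1 : 1 <= p by move: p2; lra.
have [K2 K20 lac] := @lacunary_Lp R lam p lam1 p1.
pose K := K2 `^ p^-1 * (4 * K1 `^ p^-1).
exists K; first by rewrite mulr_gt0 ?powR_gt0// mulr_gt0 ?powR_gt0.
move=> g a n B ga B0 SB; have [n_gt0 nS nl dG] := ga.
have KB : 0 <= K * B `^ q^-1 by rewrite mulr_ge0 ?powR_ge0// mulr_ge0 ?powR_ge0// mulr_ge0 ?powR_ge0.
split; first exact: KB.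
move=> f fH; have Ha := hilbert_op_analytic ga fH.
set M := fine (hardy_norm p f).
have M0 : 0 <= M by rewrite fine_ge0// hardy_norm_ge0.
have fin : hardy_norm p f \is a fin_num.
  by rewrite ge0_fin_numE ?hardy_norm_ge0//; case: fH.
suff HM : (hardy_norm p (hilbert_op g f) <= (K * B `^ q^-1 * M)%:E)%E.
  split; first by split=> //; exact: le_lt_trans HM (ltry _).
  by rewrite -(fineK fin) -EFinM.
apply: hardy_norm_le => // [|rho r01]; first by rewrite mulr_ge0.
have /andP[r0 r1] := r01.
pose beta j := moment f (fun j => (n j).-1) j.
pose c j := a j * (n j)%:R * beta j.
(* The modulus of c j is 2 x_j y_j, so the squares sum to at most 4 times the square of the
   remaining factor; 4 leaves a margin. *)
pose s := 4 * (B `^ q^-1 * (K1 `^ p^-1 * M)).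
have s0 : 0 <= s by rewrite mulr_ge0// mulr_ge0 ?powR_ge0// mulr_ge0 ?powR_ge0.
have cs J : \sum_(0 <= j < J) modulus (c j) ^+ 2 <= s ^+ 2.
  pose x j := (n j)%:R `^ p^-1 * modulus (a j).
  pose y j := (n j)%:R `^ (1 - p^-1) * (modulus (beta j) / 2).
  have x0 j : 0 <= x j by rewrite mulr_ge0 ?powR_ge0 ?modulus_ge0.
  have y0 j : 0 <= y j by rewrite mulr_ge0 ?powR_ge0// divr_ge0 ?modulus_ge0.
  have xy j : modulus (c j) = 2 * (x j * y j).
    have nR : 0 < (n j)%:R :> R by rewrite ltr0n.
    have nn : (n j)%:R = (n j)%:R `^ p^-1 * (n j)%:R `^ (1 - p^-1) :> R.
      by rewrite -powRDp// addrC subrK powRr1// ltW.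
    have nm : modulus (n j)%:R = (n j)%:R :> R.
      by rewrite -(rmorph_nat (@real_complex R)) modulus_real ger0_norm.
    by rewrite /c !modulusM nm {1}nn /x /y; field.
  have H := powR_hoelder_sum (index_iota 0 J) p2 qE x0 y0.
  set X := \sum_(i <- _) (x i ^+ 2 * y i ^+ 2) in H.
  have X0 : 0 <= X by apply: sumr_ge0 => j _; rewrite mulr_ge0 ?sqr_ge0.
  have H2 : X `^ (q / 2) <= (B `^ q^-1 * (K1 `^ p^-1 * M)) `^ q.
    apply: le_trans H _; rewrite [leRHS]powRM ?powR_ge0 ?mulr_ge0 ?powR_ge0//.
    rewrite -(powRrM B) mulVf ?(gt_eqF q0)// powRr1//.
    apply: ler_pM; rewrite ?powR_ge0//; first by apply: sumr_ge0 => j _; exact: powR_ge0.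
      exact: SB.
    rewrite -qpE.
    have -> : (K1 `^ p^-1 * M) `^ q = (K1 * M `^ p) `^ (q / p).
      rewrite (powRM _ (ltW K10) (powR_ge0 _ _)) powRM ?powR_ge0//.
      rewrite -!powRrM [p^-1 * q]mulrC [p * (q / p)]mulrC divfK ?gt_eqF//.
    apply: ge0_ler_powR; rewrite ?nnegrE ?divr_ge0 ?(ltW p0) ?(ltW q0)//.
    - by apply: sumr_ge0 => j _; exact: powR_ge0.
    - by rewrite mulr_ge0 ?(ltW K10) ?powR_ge0.
    - exact: (moment_sum_le ga fH).
  have XE : X = (X `^ (q / 2)) `^ (2 / q).
    by rewrite -powRrM (_ : q / 2 * (2 / q) = 1) ?powRr1//; field; rewrite gt_eqF.
  have X2 : X <= (B `^ q^-1 * (K1 `^ p^-1 * M)) ^+ 2.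
    set T := B `^ q^-1 * _ in H2 *.
    have T0 : 0 <= T by rewrite mulr_ge0 ?powR_ge0// mulr_ge0 ?powR_ge0.
    have -> : T ^+ 2 = (T `^ q) `^ (2 / q).
      by rewrite -powRrM (_ : q * (2 / q) = 2%:R) ?powR_mulrn//; field; rewrite gt_eqF.
    rewrite XE; apply: ge0_ler_powR; rewrite ?nnegrE ?powR_ge0// divr_ge0// ltW//.
  apply: (@le_trans _ _ (4 * X)).
    rewrite mulr_sumr le_eqVlt; apply/orP; left; apply/eqP; apply: eq_bigr => j _.
    by rewrite xy; ring.
  rewrite /s; set T := B `^ q^-1 * _ in X2 *; rewrite exprMn.
  have : 0 <= T ^+ 2 by exact: sqr_ge0.
  by move: X2; move: (T ^+ 2) => w; rewrite expr2; lra.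
have hs := hilbert_op_series ga fH.
have jm := lacunary_exponent_ge ga.
have r01' : 0 <= rho < 1 by rewrite ltW.
have cv := circle_int_series_cvg p0 jm hs (fun t => analytic_rcontinuous t Ha r01') r01'.
apply: (@le_trans _ _ (K2 * s `^ p)).
  apply: limr_le' cv _ => J.
  pose c' j := c j * (rho ^+ (n j).-1)%:C%C.
  (* [lacunary_Lp] asks for a positive first exponent, while n_0 - 1 may be 0. Multiplication by a
     point of modulus 1 raises every exponent to n_j. *)
  rewrite (eq_circle_int (k := fun t => modulus (\sum_(0 <= j < J) c' j * circle_point 1 t ^+ n j) `^ p)).
    apply: lac => // J'; apply: le_trans (cs J'); apply: ler_sum => j _.
    rewrite /c' modulusM modulus_real ger0_norm ?exprn_ge0 ?(ltW r0)// ler_pXn2r ?nnegrE ?modulus_ge0//; last first.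
      by rewrite mulr_ge0 ?modulus_ge0// exprn_ge0 ?(ltW r0).
    by rewrite ler_piMr ?modulus_ge0// exprn_ile1 ?ltW.
  move=> t; congr (_ `^ p); rewrite circle_scale_term.
  have mc : modulus (circle_point 1 t) = 1 by rewrite modulus_circle_point normr1.
  rewrite -[LHS]mul1r -{1}mc -modulusM mulr_sumr; congr modulus; apply: eq_bigr => j _.
  by rewrite mulrCA -exprS prednK.
have -> : K * B `^ q^-1 * M = K2 `^ p^-1 * s by rewrite /K /s; ring.
rewrite (powRM _ (powR_ge0 _ _) s0) -powRrM mulVf ?(gt_eqF p0)// powRr1 ?(ltW K20)//.
by rewrite ler_peMl// mulr_ge0 ?powR_ge0// ltW.
Qed.

Let K3 := 16 `^ p * (lam `^ (2 * p)^-1 / (lam `^ (2 * p)^-1 - 1)) `^ (p - 1) * (4 * p).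

Let K30 : 0 < K3. Proof. by rewrite mulr_gt0 ?mulr_gt0 ?powR_gt0. Qed.

(** b_j = x_j^(q/p) is the extremal choice in Hoelder's inequality: both the sum of b_j^p and that
    of (x_j b_j)^2 equal S. Hence S/16 <= (k M)^2 with M^p = K3 S, so S^(1 - 2/p) is at most a
    multiple of k^2, and 1 - 2/p = 2/q. Truncation at J keeps S finite before any bound is known. *)
Lemma hilbert_op_lower : exists2 K, 0 < K &
  forall g a n k, lacunary_derivative lam g a n -> op_bound (hilbert_op g) p p k ->
    forall J, weighted_sum a n J <= K * k `^ q.
Proof.
exists (4 `^ q * K3 `^ (q / p)); first by rewrite mulr_gt0 ?powR_gt0.
move=> g a n k ga [k0 gk] J; have [n_gt0 nS nl dG] := ga.
pose x j := (n j)%:R `^ p^-1 * modulus (a j).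
have x0 j : 0 <= x j by rewrite mulr_ge0 ?powR_ge0 ?modulus_ge0.
pose b j := x j `^ (q / p).
have b0 j : 0 <= b j by exact: powR_ge0.
set S := weighted_sum a n J.
have S0 : 0 <= S by apply: sumr_ge0 => j _; exact: powR_ge0.
have Sb : \sum_(0 <= j < J) b j `^ p = S.
  by apply: eq_bigr => j _; rewrite /b -powRrM divfK ?gt_eqF.
pose f := test_fun p n b J.
have fa : analytic_disc f by exact: test_fun_analytic.
pose M := (K3 * S) `^ p^-1.
have M0 : 0 <= M by exact: powR_ge0.
have K3S : 0 <= K3 * S by rewrite mulr_ge0// ltW.
have fM : (hardy_norm p f <= M%:E)%E.
  apply: hardy_norm_le => // rho r01.
  rewrite /M -powRrM mulVf ?(gt_eqF p0)// powRr1//.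
  apply: le_trans (test_fun_norm J p2 lam1 n_gt0 nl b0 r01) _.
  by rewrite Sb -/K3 ler_peMl.
have fH : hardy p f by split=> //; exact: le_lt_trans fM (ltry _).
have [HfH Hle] := gk f fH.
have HkM : (hardy_norm p (hilbert_op g f) <= (k * M)%:E)%E.
  by apply: le_trans Hle _; rewrite EFinM lee_wpmul2l.
have kM0 : 0 <= k * M by rewrite mulr_ge0.
pose beta j := moment f (fun j => (n j).-1) j.
pose c j := a j * (n j)%:R * beta j.
have cl j : (j < J)%N -> x j * b j / 2 <= modulus (c j).
  move=> jJ; have nR : 0 < (n j)%:R :> R by rewrite ltr0n.
  have nm : modulus (n j)%:R = (n j)%:R :> R.
    by rewrite -(rmorph_nat (@real_complex R)) modulus_real ger0_norm.
  rewrite /c !modulusM nm.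
  pose e := b j * (n j)%:R `^ (p^-1 - 1).
  have e0 : 0 <= e by rewrite mulr_ge0 ?powR_ge0.
  have ReE t : complex.Re (f t%:C%C * t%:C%C ^+ (n j).-1) = t ^+ (n j).-1 * complex.Re (f t%:C%C).
    by rewrite -rmorphXn; case: (f _) => u v; simpc; rewrite mulrC.
  have eb : e / 2 <= modulus (beta j).
    apply: le_trans (le_trans (ler_norm _) (normr_Re_le _)); rewrite /beta /moment /cintegral01/=.
    under eq_Rintegral do rewrite ReE.
    apply: kernel_moment_lower => //.
    - have [h _] := moment_integrable_hardy ga fH j.
      by move: h; rewrite (funext ReE).
    - by move=> t t01; exact: test_fun_Re.
  apply: le_trans (ler_wpM2l _ eb); last by rewrite mulr_ge0 ?modulus_ge0.
  have nn : (n j)%:R * (n j)%:R `^ (p^-1 - 1) = (n j)%:R `^ p^-1 :> R.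
    by rewrite mulr_powRB1// invr_gt0.
  rewrite le_eqVlt; apply/orP; left; apply/eqP; rewrite /x /e -nn; ring.
have Sc : S / 16 <= (k * M) ^+ 2.
  (* The radius 1 - 1/(2 n_J) keeps r^(n_j - 1) >= 1/2 for all j < J. With the 1/2 of [cl], squaring
     gives 1/16. *)
  have bessel : S / 16 <= (2 * pi)^-1 *
      circle_int (fun t => modulus (hilbert_op g f (circle_point (1 - (2 * (n J)%:R)^-1) t)) `^ 2).
    set r := 1 - _.
    have nJ : 1 <= (n J)%:R :> R by rewrite ler1n.
    have x2 : 0 < ((2 * (n J)%:R)^-1 : R) <= 1.
      by rewrite invr_gt0 mulr_gt0 ?ltr0n// invf_le1 ?mulr_gt0 ?ltr0n//; lra.
    have r01 : 0 <= r < 1 by rewrite /r; lra.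
    have mS j : ((n j).-1 < (n j.+1).-1)%N by rewrite -ltnS !prednK.
    have pc := parseval_cvg mS (lacunary_exponent_ge ga) (hilbert_op_series ga fH) r01.
    apply: (@le_trans _ _ (\sum_(0 <= j < J) (modulus (c j) * r ^+ (n j).-1) ^+ 2)); last first.
      rewrite -(cvg_lim (@Rhausdorff R) pc); apply: nondecreasing_cvgn_le.
        by apply: nondecreasing_series => j _ _; exact: sqr_ge0.
      by apply/cvg_ex; eexists; exact: pc.
    rewrite /S /weighted_sum mulr_suml; apply: ler_sum_nat => j /andP[_ jJ].
    have rh : 2^-1 <= r ^+ (n j).-1.
      apply: le_trans (expr_ge_bernoulli _ _ (lexx r)); last by case/andP: x2 => /ltW -> ->.
      have nj : ((n j).-1 <= n J)%N.
        by apply: leq_trans (leq_pred _) _; exact: ltnW (homo_ltn ltn_trans nS jJ).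
      have : (n j).-1%:R * (2 * (n J)%:R)^-1 <= (2^-1 : R).
        rewrite invfM mulrCA ler_piMr ?invr_ge0// ler_pdivrMr ?mul1r ?ler_nat// ltr0n//.
      lra.
    have xb : (x j * b j) ^+ 2 = x j `^ q.
      have -> : x j * b j = x j `^ (q / 2).
        by rewrite /b qpE mulr_powRB1// divr_gt0.
      by rewrite powR_sqr// (_ : 2 * (q / 2) = q)//; field.
    have xb0 : 0 <= x j * b j by rewrite mulr_ge0.
    rewrite -/(x j) -xb.
    apply: (@le_trans _ _ ((x j * b j / 2 / 2) ^+ 2)).
      by rewrite le_eqVlt; apply/orP; left; apply/eqP; field.
    rewrite ler_pXn2r ?nnegrE//; last 2 first.
    - by rewrite !divr_ge0.
    - by rewrite mulr_ge0 ?modulus_ge0// (le_trans _ rh)// invr_ge0.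
    - apply: ler_pM => //; first by rewrite divr_ge0.
      exact: cl.
  move: bessel; set r := 1 - _.
  have r01 : 0 < r < 1.
    have nJ : 1 <= (n J)%:R :> R by rewrite ler1n.
    have x2 : 0 < ((2 * (n J)%:R)^-1 : R) < 1.
      by rewrite invr_gt0 mulr_gt0 ?ltr0n// invf_lt1 ?mulr_gt0 ?ltr0n//; lra.
    by rewrite /r; lra.
  have r01' : 0 <= r < 1 by case/andP: r01 => /ltW -> ->.
  set u := fun t => modulus (hilbert_op g f (circle_point r t)).
  have cu : continuous u.
    by apply: rcontinuous_modulus => t; exact: analytic_rcontinuous (hilbert_op_analytic ga fH) r01'.
  have u0 t : 0 <= u t by exact: modulus_ge0.
  have up : circle_int (fun t => u t `^ p) <= 2 * pi * (k * M) `^ p.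
    apply: le_trans (hardy_circle_int_le HfH p0 r01) _.
    rewrite ler_wpM2l ?(le_trans ler01 two_pi_ge1)//.
    have fin : hardy_norm p (hilbert_op g f) \is a fin_num.
      by rewrite ge0_fin_numE ?hardy_norm_ge0//; case: HfH.
    apply: ge0_ler_powR; rewrite ?nnegrE ?(ltW p0)// ?fine_ge0 ?hardy_norm_ge0//.
    by rewrite -lee_fin fineK.
  (* k M may be 0, whereas [circle_int_sqr_le] requires a positive constant; e is removed after
     taking square roots. *)
  have all_c e : 0 < e -> (2 * pi)^-1 * circle_int (fun t => u t `^ 2) <= (k * M + e) ^+ 2.
    move=> e0; rewrite ler_pdivrMl ?two_pi_gt0//.
    rewrite (eq_circle_int (k := fun t => u t ^+ 2)); last by move=> t; rewrite (powR_mulrn 2).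
    apply: (circle_int_sqr_le p2) => //; first by rewrite ltr_wpDl.
    apply: le_trans up _; rewrite ler_wpM2l ?(le_trans ler01 two_pi_ge1)//.
    by apply: ge0_ler_powR; rewrite ?nnegrE ?(ltW p0) ?addr_ge0 ?(ltW e0)// lerDl ltW.
  move=> /le_trans H; rewrite -[leLHS]sqr_sqrtr ?divr_ge0//.
  rewrite ler_pXn2r ?nnegrE ?sqrtr_ge0//; apply/ler_addgt0Pr => e e0.
  rewrite -[leRHS]gtr0_norm ?ltr_wpDl// -sqrtr_sqr ler_wsqrtr// H// all_c//.
(* The argument below divides by S^(2/p). *)
have [S00|S00] := eqVneq S 0.
  by rewrite S00 mulr_ge0 ?powR_ge0// mulr_ge0 ?powR_ge0.
have Sp : 0 < S by rewrite lt_def S00.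
have M2 : M ^+ 2 = K3 `^ (2 / p) * S `^ (2 / p).
  by rewrite powR_sqr// powRM// ltW.
have S2 : S `^ (2 / q) <= 16 * k ^+ 2 * K3 `^ (2 / p).
  have Sq : S = S `^ (2 / q) * S `^ (2 / p).
    rewrite -powRDp// -mulrDr qE subrK mulfV// powRr1//.
  rewrite -(ler_pM2r (powR_gt0 (2 / p) Sp)) -Sq.
  move: Sc; rewrite exprMn M2 ler_pdivrMr// => /le_trans; apply.
  by rewrite le_eqVlt; apply/orP; left; apply/eqP; ring.
have -> : S = (S `^ (2 / q)) `^ (q / 2).
  by rewrite -powRrM (_ : 2 / q * (q / 2) = 1) ?powRr1//; field; rewrite gt_eqF.
apply: (@le_trans _ _ ((16 * k ^+ 2 * K3 `^ (2 / p)) `^ (q / 2))).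
  apply: ge0_ler_powR; rewrite ?nnegrE ?powR_ge0 ?divr_ge0 ?(ltW q0)//.
  by rewrite mulr_ge0 ?powR_ge0// mulr_ge0 ?sqr_ge0.
have -> : 16 * k ^+ 2 = (4 * k) `^ 2.
  by rewrite (powR_mulrn 2) ?mulr_ge0//; ring.
rewrite powRM ?powR_ge0// -!powRrM.
have -> : 2 * (q / 2) = q by field.
have -> : 2 / p * (q / 2) = q / p by field; rewrite gt_eqF.
by rewrite powRM// mulrAC.
Qed.

End HilbertBounds.

(** * The mixed norm of g' compared with the weighted sum, and the theorem *)

Section MixedNorm.
Context {R : realType}.
Local Notation C := R[i].
Local Notation mu := (@lebesgue_measure R).
Local Notation I01 := (`[0%R, 1%R[%classic : set R).
Variables (p q lam : R).
Hypotheses (p2 : 2 < p) (qE : q^-1 = 2^-1 - p^-1) (lam1 : 1 < lam).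

Let q2 : 2 < q. Proof. exact: conj_exponent_gt2 p2 qE. Qed.
Let q0 : 0 < q. Proof. exact: lt_trans q2. Qed.

Variables (g : C -> C) (a : nat -> C) (n : nat -> nat).
Hypothesis ga : lacunary_derivative lam g a n.

Let phi r := (2 * pi)^-1 * circle_int (fun t => modulus (derive1 g (circle_point r t)) `^ 2).
Let I := (\int[mu]_(r in I01)
  (phi r `^ (q / 2) * ((q / 2 + 1) * (1 - r ^+ 2) `^ (q / 2)))%:E)%E.

Lemma lacunary_derivative_analytic : analytic_disc (derive1 g).
Proof. by case: (ga) => _ _ _ dG; exact: ps_analytic (lacunary_exponent_ge ga) dG. Qed.

Let mixed_normE : mixed_norm 2 q (q / 2) (derive1 g) = (I `^ q^-1)%E.
Proof.
rewrite /mixed_norm /I; congr poweR; apply: eq_integral => r; rewrite inE/= in_itv/= => r01.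
rewrite (integral_meanE lacunary_derivative_analytic (ltr0n R 2) r01) poweR_EFin -powRrM.
by rewrite [2^-1 * q]mulrC -EFinM.
Qed.

Let phi_lim r : 0 <= r < 1 ->
  \sum_(0 <= j < J) (modulus (a j) * (n j)%:R * r ^+ (n j).-1) ^+ 2 @[J --> \oo] --> phi r.
Proof.
move=> r01; have [n_gt0 nS nl dG] := ga.
have mS j : ((n j).-1 < (n j.+1).-1)%N by rewrite -ltnS !prednK.
have := parseval_cvg mS (lacunary_exponent_ge ga) dG r01.
have E j : modulus (a j * (n j)%:R) = modulus (a j) * (n j)%:R.
  by rewrite modulusM -[in LHS](rmorph_nat (@real_complex R)) modulus_real ger0_norm.
rewrite (_ : (fun J => _) = fun J => \sum_(0 <= j < J)
  (modulus (a j) * (n j)%:R * r ^+ (n j).-1) ^+ 2)//.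
by apply/funext => J; apply: eq_bigr => j _; rewrite E.
Qed.

Let n_gt0 j : (0 < n j)%N. Proof. by case: ga. Qed.
Let A0 j : 0 <= modulus (a j). Proof. exact: modulus_ge0. Qed.

Let I0 : (0 <= I)%E.
Proof.
apply: integral_ge0 => r _; rewrite lee_fin mulr_ge0 ?powR_ge0// mulr_ge0 ?powR_ge0//.
by move: q2; lra.
Qed.

Lemma weighted_sum_le_mixed_norm M : mixed_norm 2 q (q / 2) (derive1 g) = M%:E ->
  forall J, weighted_sum p q a n J <= 8 `^ q * M `^ q.
Proof.
rewrite mixed_normE => IM J.
have IMq : I = (M `^ q)%:E.
  have : ((I `^ q^-1) `^ q = I)%E.
    by rewrite -poweRrM mulVf ?gt_eqF// poweRe1.
  by rewrite IM poweR_EFin => <-.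
have := mixed_int_lower p2 qE A0 n_gt0 phi_lim J.
by rewrite -/I IMq -EFinM lee_fin.
Qed.

Lemma mixed_norm_le_weighted_sum B : 0 <= B ->
  (forall J, weighted_sum p q a n J <= B) ->
  (mixed_norm 2 q (q / 2) (derive1 g) <=
    (((q / 2 + 1) * 2 `^ (q / 2) * (lam / (lam - 1)) `^ (q / 2 - 1) * B) `^ q^-1)%:E)%E.
Proof.
move=> B0 SB; have [_ _ nl _] := ga.
have H := mixed_int_upper p2 qE A0 n_gt0 phi_lim lam1 nl SB.
rewrite mixed_normE -poweR_EFin; apply: gt0_ler_poweR; rewrite ?invr_ge0 ?(ltW q0)//.
  by rewrite in_itv/= I0 leey.
by rewrite in_itv/= leey andbT (le_trans I0 H).
Qed.

End MixedNorm.

Theorem theorem2 (R : realType) (p pt : R)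
    (hp : 2 < p) (hpt : pt^-1 = 2^-1 - p^-1) (lambda : R) (hlambda : 1 < lambda) :
  exists c : R, 0 < c /\
    forall g : R[i] -> R[i], analytic_disc g -> lacunary lambda g ->
      (op_bounded (hilbert_op g) p p <-> mixed_space 2 pt (pt / 2) (derive1 g)) /\
      ((c^-1)%:E * mixed_norm 2 pt (pt / 2) (derive1 g) <= op_norm (hilbert_op g) p p
         <= c%:E * mixed_norm 2 pt (pt / 2) (derive1 g))%E.
Proof.
have q2 := conj_exponent_gt2 hp hpt; have q0 : 0 < pt := lt_trans (ltr0n R 2) q2.
have powRK (x : R) : 0 <= x -> (x `^ pt) `^ pt^-1 = x.
  by move=> x0; rewrite -powRrM mulfV ?gt_eqF// powRr1.
have [K1 K10 up] := hilbert_op_upper hp hpt hlambda.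
have [K2 K20 low] := hilbert_op_lower hp hpt hlambda.
pose K3 := (pt / 2 + 1) * 2 `^ (pt / 2) * (lambda / (lambda - 1)) `^ (pt / 2 - 1).
have K30 : 0 <= K3.
  by rewrite mulr_ge0 ?powR_ge0// mulr_ge0 ?powR_ge0//; lra.
(* The q-th roots of the constants of the two comparisons with the mixed norm, combined with those
   of the operator bounds; 8 comes from 8^q in [weighted_sum_le_mixed_norm]. *)
pose k1 := K1 * 8; pose k2 := (K3 * K2) `^ pt^-1.
have k10 : 0 < k1 by rewrite mulr_gt0.
have k20 : 0 <= k2 by exact: powR_ge0.
(* One constant for both directions: N <= k2 k for every bound k, and k1 N is a bound. The positive
   summand k1 makes c invertible. *)
pose c := k1 + k2; have c0 : 0 < c by rewrite ltr_pwDl.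
exists c; split; first exact: c0.
move=> g _ gl.
have [a [n ga]] := lacunary_derive1 hlambda gl.
have Ga := lacunary_derivative_analytic ga.
set N := mixed_norm 2 pt (pt / 2) (derive1 g).
have N0 : (0 <= N)%E by exact: poweR_ge0.
have upper M : N = M%:E -> op_bound (hilbert_op g) p p (k1 * M).
  move=> NM; have M0 : 0 <= M by rewrite -lee_fin -NM.
  have -> : k1 * M = K1 * (8 `^ pt * M `^ pt) `^ pt^-1.
    by rewrite -(powRM pt (ler0n R 8) M0) powRK ?(mulr_ge0 (ler0n R 8) M0)// /k1 mulrA.
  apply: (up g a n _ ga); first by rewrite mulr_ge0 ?powR_ge0.
  exact: weighted_sum_le_mixed_norm ga _ NM.
have lower k : op_bound (hilbert_op g) p p k -> (N <= (k2 * k)%:E)%E.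
  move=> gk; have [k0 _] := gk.
  have := mixed_norm_le_weighted_sum hp hpt hlambda ga _ (low g a n k ga gk).
  rewrite -/N => /(_ (mulr_ge0 (ltW K20) (powR_ge0 _ _))).
  by rewrite -/K3 mulrA (powRM _ (mulr_ge0 K30 (ltW K20)) (powR_ge0 _ _)) powRK.
split.
  split=> [[k /lower Nk]|[_ Nfin]].
    by split; [exact: Ga|exact: le_lt_trans Nk (ltry _)].
  exists (k1 * fine N); apply: upper; rewrite fineK//.
  by rewrite ge0_fin_numE.
apply/andP; split.
  apply/ereal_infP => _ [k gk <-]; rewrite lee_pdivrMl// -EFinM.
  have [k0 _] := gk; apply: le_trans (lower k gk) _.
  by rewrite lee_fin ler_wpM2r// lerDr ltW.
(* For N = +oo the right-hand side is +oo because c > 0. *)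
have [Nfin|] := ltP N +oo%E; last first.
  by rewrite leye_eq => /eqP ->; rewrite gt0_muley ?lte_fin// leey.
have fin : N \is a fin_num by rewrite ge0_fin_numE.
apply: (@le_trans _ _ (k1 * fine N)%:E).
  apply: ereal_inf_lbound; exists (k1 * fine N); last by [].
  by apply: upper; rewrite fineK.
by rewrite EFinM fineK// lee_wpmul2r// lee_fin lerDl k20.
Qed.
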